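(* Let $(\lambda,\rho)$ be a degree distribution pair and let $G$ be chosen uniformly at random from LDPC$(n,\Lambda,\Gamma)$, used to transmit a uniformly chosen codeword $X$ over BEC$(\epsilon)$ with output $Y$. Let $x\in[0,1]$ be the largest solution of $x=\epsilon\lambda(1-\rho(1-x))$ and $y=1-\rho(1-x)$. Let $\Xi_\epsilon=(\Lambda_\epsilon,\Gamma_\epsilon)$ with $$\Lambda_\epsilon(z)=\epsilon\Lambda(zy),\qquad \Gamma_\epsilon(z)=\Gamma(1-x+zx)-\Gamma(1-x)-zx\Gamma'(1-x).$$ Assume that $\epsilon$ is non-exceptional and that $u\mapsto\Psi_{\Xi_\epsilon}(u)$ achieves its global maximum over $u\in[0,\infty)$ at $u=1$, with $\Psi''_{\Xi_\epsilon}(1)<0$. Then $$\lim_{n\to\infty}\frac1n\mathbb{E}[H_G(X\mid Y)]=P_\epsilon(x,y).$$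
   Context: A degree distribution pair is $(\lambda,\rho)$ with $\lambda(x)=\sum_{j\ge2}\lambda_jx^{j-1}$, $\rho(x)=\sum_{j\ge2}\rho_jx^{j-1}$, nonnegative coefficients, $\lambda(1)=\rho(1)=1$; node perspective $\Lambda(x)=\int_0^x\lambda/\int_0^1\lambda=\sum_i\Lambda_ix^i$, $\Gamma(x)=\int_0^x\rho/\int_0^1\rho=\sum_j\Gamma_jx^j$. LDPC$(n,\Lambda,\Gamma)$ is the standard random ensemble of Tanner graphs with $n$ variable nodes ($n\Lambda_i$ of degree $i$) and $n\Lambda'(1)/\Gamma'(1)$ check nodes (fraction $\Gamma_j$ of degree $j$), sockets matched by a uniformly random permutation; the code is the null space mod 2. BEC$(\epsilon)$ erases each bit independently with probability $\epsilon$. Entropies are in bits. Trial entropy: $P_\epsilon(x,y)=\Lambda'(1)x(1-y)-\frac{\Lambda'(1)}{\Gamma'(1)}[1-\Gamma(1-x)]+\epsilon\Lambda(y)$. $\epsilon$ is non-exceptional if it is a continuity point of the map $\epsilon\mapsto x(\epsilon)$, where $x(\epsilon)$ is the largest solution in $[0,1]$ of $x=\epsilon\lambda(1-\rho(1-x))$. For a pair $\Xi=(\Lambda,\Gamma)$ of polynomials with nonnegative coefficients $\Lambda(z)=\sum_l\Lambda_lz^l$, $\Gamma(z)=\sum_r\Gamma_rz^r$, set $\lambda(z)=\Lambda'(z)/\Lambda'(1)=\sum_l\lambda_lz^{l-1}$ and define for $u\ge0$ $$\Psi_\Xi(u)=-\Lambda'(1)\log_2\Big[\frac{1+uv}{(1+u)(1+v)}\Big]+\sum_l\Lambda_l\log_2\Big[\frac{1+u^l}{2(1+u)^l}\Big]+\frac{\Lambda'(1)}{\Gamma'(1)}\sum_r\Gamma_r\log_2\Big[1+\Big(\frac{1-v}{1+v}\Big)^r\Big],$$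 where $v=v(u)=\Big(\sum_l\frac{\lambda_l}{1+u^l}\Big)^{-1}\Big(\sum_l\frac{\lambda_lu^{l-1}}{1+u^l}\Big)$. *)

(* Defs.v *)
From HB Require Import structures.
From mathcomp Require Import all_boot all_order all_algebra.
From mathcomp Require Import all_classical all_reals all_analysis.

Set Implicit Arguments.
Unset Strict Implicit.
Unset Printing Implicit Defensive.

Import Order.TTheory GRing.Theory Num.Theory.
Local Open Scope ring_scope.

Section Defs.
Variable R : realType.

Definition log2 (t : R) : R := ln t / ln 2.

(** Degree distribution pair (edge perspective): lambda(x) = sum_{j>=2} lambda_j x^{j-1},
    i.e. zero constant coefficient, nonnegative coefficients, value 1 at 1. *)
Definition edge_dd (p : {poly R}) : Prop :=
  p`_0 = 0 /\ (forall i, 0 <= p`_i) /\ p.[1] = 1.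

Definition prim (p : {poly R}) : {poly R} :=
  \poly_(i < (size p).+1) (if i is k.+1 then p`_k / k.+1%:R else 0).

Definition node_persp (p : {poly R}) : {poly R} := (prim p).[1]^-1 *: prim p.

Definition dp (p : {poly R}) (a : R) : R := (p^`()).[a].

Definition trialP (lam rho : {poly R}) (eps x y : R) : R :=
  let Lam := node_persp lam in let Gam := node_persp rho in
  dp Lam 1 * x * (1 - y) - dp Lam 1 / dp Gam 1 * (1 - Gam.[1 - x])
  + eps * Lam.[y].

(** x(eps): largest solution in [0,1] of x = eps * lambda(1 - rho(1 - x))
    (0 is always a solution, and the solution set is closed). *)
Definition fp_set (lam rho : {poly R}) (eps : R) : set R :=
  [set t | 0 <= t <= 1 /\ t = eps * lam.[1 - rho.[1 - t]]].
Definition xfun (lam rho : {poly R}) (eps : R) : R := sup (fp_set lam rho eps).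

Definition non_exceptional (lam rho : {poly R}) (eps : R) : Prop :=
  forall e : R, 0 < e -> exists2 d : R, 0 < d &
    forall e' : R, 0 <= e' <= 1 -> `|e' - eps| < d ->
      `|xfun lam rho e' - xfun lam rho eps| < e.

Definition Psi (Lam Gam : {poly R}) (u : R) : R :=
  let L1 := dp Lam 1 in let G1 := dp Gam 1 in
  (* lambda_l = l Lambda_l / Lambda'(1), coefficient of z^{l-1} in Lambda'(z)/Lambda'(1) *)
  let laml := fun l : nat => l%:R * Lam`_l / L1 in
  let v := (\sum_(l < size Lam) laml l / (1 + u ^+ l))^-1
           * (\sum_(l < size Lam) laml l * u ^+ l.-1 / (1 + u ^+ l)) in
  - L1 * log2 ((1 + u * v) / ((1 + u) * (1 + v)))
  + \sum_(l < size Lam) Lam`_l * log2 ((1 + u ^+ l) / (2 * (1 + u) ^+ l))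
  + L1 / G1 * \sum_(r < size Gam) Gam`_r * log2 (1 + ((1 - v) / (1 + v)) ^+ r).

Definition LamEps (Lam : {poly R}) (eps y : R) : {poly R} :=
  eps *: (Lam \Po (y *: 'X)).
Definition GamEps (Gam : {poly R}) (x : R) : {poly R} :=
  Gam \Po ((1 - x)%:P + x *: 'X) - (Gam.[1 - x])%:P - (x * dp Gam (1 - x)) *: 'X.

(** Admissible Tanner-graph skeleton: n variable nodes with degrees dv, m check nodes
    with degrees dc, such that m = n Lambda'(1)/Gamma'(1), exactly n Lambda_i variable
    nodes have degree i and exactly m Gamma_j check nodes have degree j. *)
Definition admissible (lam rho : {poly R}) (n : nat) (dv : 'I_n -> nat)
    (m : nat) (dc : 'I_m -> nat) : Prop :=
  let Lam := node_persp lam in let Gam := node_persp rho in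
  m%:R = n%:R * dp Lam 1 / dp Gam 1 /\
  (forall i : nat, #|[set v | dv v == i]|%:R = n%:R * Lam`_i) /\
  (forall j : nat, #|[set a | dc a == j]|%:R = m%:R * Gam`_j).

Definition vsock (n : nat) (dv : 'I_n -> nat) := {v : 'I_n & 'I_(dv v)}.
Definition csock (m : nat) (dc : 'I_m -> nat) := {a : 'I_m & 'I_(dc a)}.

Section Graph.
Variables (n m : nat) (dv : 'I_n -> nat) (dc : 'I_m -> nat).

(** A Tanner graph = matching of variable sockets to check sockets (a bijection).
    The code is the null space mod 2 (multi-edges counted with multiplicity). *)
Definition in_code (f : {ffun vsock dv -> csock dc}) (c : {ffun 'I_n -> bool}) : bool :=
  [forall a : 'I_m,
     ~~ odd (\sum_(s : vsock dv | tag (f s) == a) nat_of_bool (c (tag s)))].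

Definition code (f : {ffun vsock dv -> csock dc}) : {set {ffun 'I_n -> bool}} :=
  [set c | in_code f c].

Definition bec (eps : R) (b : bool) (o : option bool) : R :=
  match o with None => eps | Some b' => if b' == b then 1 - eps else 0 end.

Definition pXY (eps : R) (f : {ffun vsock dv -> csock dc})
    (c : {ffun 'I_n -> bool}) (y : {ffun 'I_n -> option bool}) : R :=
  (if c \in code f then #|code f|%:R^-1 else 0) * \prod_(i < n) bec eps (c i) (y i).

Definition pY (eps : R) f (y : {ffun 'I_n -> option bool}) : R :=
  \sum_(c : {ffun 'I_n -> bool}) pXY eps f c y.

(** conditional entropy H_G(X | Y) in bits (0 log 0 = 0) *)
Definition condH (eps : R) (f : {ffun vsock dv -> csock dc}) : R :=
  - \sum_(c : {ffun 'I_n -> bool}) \sum_(y : {ffun 'I_n -> option bool})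
      (if pXY eps f c y == 0 then 0
       else pXY eps f c y * log2 (pXY eps f c y / pY eps f y)).

Definition graphs : {set {ffun vsock dv -> csock dc}} := [set f : {ffun vsock dv -> csock dc} | injectiveb f].

Definition EcondH (eps : R) : R :=
  (\sum_(f in graphs) condH eps f) / #|graphs|%:R.

End Graph.

End Defs.

(* Main.v *)
(** By linearity the conditional entropy is the expected dimension of the space of codewords
    supported on the erased positions.  Run [t] rounds of message passing and record, for every
    edge, for how many rounds each of its two messages stays an erasure.  Given this record the
    graph is still uniform among the matchings that respect it.  This gives by induction on [t]
    the law of large numbers of density evolution, since each round only asks how new labels are
    distributed over sockets that are exchangeable within the classes of the record.  The lower
    bound on the dimension counts the variables and checks that remain undetermined.  For the
    upper bound, the edges whose messages were erasures in all rounds form a single class, hence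
    a uniform matching between the residual variables and checks.  The first moment of the number
    of codewords on it is bounded by generating functions evaluated at the pair [(u, v(u))], which
    yields exactly [Psi u] plus the design rate; as [Psi <= Psi 1 = 0] the two bounds agree.
    Finally [t] tends to infinity. *)
Require Import Defs.
From HB Require Import structures.
From mathcomp Require Import all_boot all_order all_algebra.
From mathcomp Require Import perm.
From mathcomp Require Import all_classical all_reals all_analysis.
From mathcomp Require Import ring lra zify.
Import Order.TTheory GRing.Theory Num.Theory.
Import numFieldNormedType.Exports.
Local Open Scope ring_scope.
Set Implicit Arguments.
Unset Strict Implicit.
Unset Printing Implicit Defensive.

(** * Exchangeability within colour classes *)

(** The record is random, and conditional laws given it are never formed. Exchangeability enters
    through involutions: exchanging the check ends of two edges with equal labels in both directions
    preserves the measure and the record, and transposes the newly revealed labels. After [t] rounds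
    all labels are at most [t], so the number of classes does not depend on [n]. The reciprocals of
    the class sizes, summed over all sockets, are then bounded, and second moments of node
    statistics are of order [n] without any lower bound on the class sizes. Limits are taken in
    mean, uniformly over the admissible degree sequences, with [n] tending to infinity at fixed [t].
    The obstacle in the upper bound is that the residual degrees are only close to those of the pair
    $(\Lambda_\epsilon,\Gamma_\epsilon)$, and that the sockets of the residual variables may form a
    proper part of the residual class. The estimate has to tolerate these defects uniformly over the
    unbounded range of [u]; the normalisation by the maximum of [1] and [u] serves this purpose. *)

Section Expectation.
Variables (R : realType) (Om : finType) (p : Om -> R).

Definition Ex (Z : Om -> R) : R := \sum_w p w * Z w.

Lemma eq_Ex Z Z' : (forall w, p w != 0 -> Z w = Z' w) -> Ex Z = Ex Z'.
Proof.
move=> h; apply: eq_bigr => w _; have [->|pw] := eqVneq (p w) 0; first by rewrite !mul0r.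
by rewrite h.
Qed.

Lemma ExD Z Z' : Ex (fun w => Z w + Z' w) = Ex Z + Ex Z'.
Proof. by rewrite /Ex -big_split; apply: eq_bigr => w _; rewrite mulrDr. Qed.

Lemma ExZ k Z : Ex (fun w => k * Z w) = k * Ex Z.
Proof. by rewrite /Ex mulr_sumr; apply: eq_bigr => w _; rewrite mulrCA. Qed.

Lemma ExN Z : Ex (fun w => - Z w) = - Ex Z.
Proof. by rewrite /Ex -sumrN; apply: eq_bigr => w _; rewrite mulrN. Qed.

Lemma ExB Z Z' : Ex (fun w => Z w - Z' w) = Ex Z - Ex Z'.
Proof. by rewrite ExD ExN. Qed.

Lemma Ex_sum (I : Type) (r : seq I) (P : pred I) (Z : I -> Om -> R) :
  Ex (fun w => \sum_(i <- r | P i) Z i w) = \sum_(i <- r | P i) Ex (Z i).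
Proof.
rewrite /Ex exchange_big /=; apply: eq_bigr => w _; by rewrite mulr_sumr.
Qed.

Hypothesis p0 : forall w, 0 <= p w.

Lemma le_Ex Z Z' : (forall w, p w != 0 -> Z w <= Z' w) -> Ex Z <= Ex Z'.
Proof.
move=> h; apply: ler_sum => w _; have [->|pw] := eqVneq (p w) 0; first by rewrite !mul0r.
by rewrite ler_wpM2l// h.
Qed.

Lemma Ex_ge0 Z : (forall w, p w != 0 -> 0 <= Z w) -> 0 <= Ex Z.
Proof.
move=> h; rewrite -[0](_ : Ex (fun=> 0) = 0); last by rewrite /Ex big1// => w _; rewrite mulr0.
exact: le_Ex.
Qed.

Lemma Ex_abs Z : `|Ex Z| <= Ex (fun w => `|Z w|).
Proof.
apply: (le_trans (ler_norm_sum _ _ _)); apply: ler_sum => w _.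
by rewrite normrM ger0_norm.
Qed.

Hypothesis p1 : \sum_w p w = 1.

Lemma Ex_cst k : Ex (fun=> k) = k.
Proof. by rewrite /Ex -mulr_suml p1 mul1r. Qed.

(* AM-GM in place of Cauchy-Schwarz *)
Lemma Ex_abs_le_sq (Z : Om -> R) (d : R) : 0 < d ->
  Ex (fun w => `|Z w|) <= Ex (fun w => Z w ^+ 2) / d + d.
Proof.
move=> d0; rewrite mulrC -ExZ -[X in _ + X]Ex_cst -ExD; apply: le_Ex => w _.
have [h|h] := leP `|Z w| d.
  by rewrite (le_trans h)// lerDr mulr_ge0 ?sqr_ge0// invr_ge0 ltW.
rewrite -[leLHS]addr0; apply: lerD; last exact: ltW.
by rewrite ler_pdivlMl// -(real_normK (num_real (Z w))) expr2 ler_wpM2r// ltW.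
Qed.

End Expectation.

Lemma normr_prod_le1 (R : realDomainType) (I : Type) (r : seq I) (P : pred I) (F : I -> R) :
  (forall i, P i -> `|F i| <= 1) -> `|\prod_(i <- r | P i) F i| <= 1.
Proof.
move=> h; elim: r => [|i r IH]; first by rewrite big_nil normr1.
rewrite big_cons; case: ifP => // Pi.
by rewrite normrM mulr_ile1// h.
Qed.

Section Exchangeable.
Variables (R : realType) (Om : finType) (p : Om -> R).
Hypothesis p0 : forall w, 0 <= p w.
Hypothesis p1 : \sum_w p w = 1.
Variables (S K : finType) (col : Om -> S -> K) (mark : Om -> S -> nat).
Variable tw : S -> S -> Om -> Om.
Hypothesis twK : forall s s', involutive (tw s s').
Hypothesis twp : forall s s' w, p (tw s s' w) = p w.
Hypothesis tw_col : forall s s' w, p w != 0 -> col w s = col w s' -> col (tw s s' w) =1 col w.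
Hypothesis tw_mark : forall s s' w, p w != 0 -> col w s = col w s' ->
  forall r, mark (tw s s' w) r = mark w (tperm s s' r).

(** Colours are preserved whenever [s] and [s'] share one, so this event is mapped into itself; the
    same fact applied to the image of [w] shows that it is not entered from outside. A change of
    variables by the involution concludes. *)
Lemma Ex_swap s s' (F : Om -> R) :
  Ex p (fun w => if col w s == col w s' then F w else 0) =
  Ex p (fun w => if col w s == col w s' then F (tw s s' w) else 0).
Proof.
rewrite /Ex (reindex_inj (inv_inj (twK s s'))) /=; apply: eq_bigr => w _.
rewrite twp; have [->|pw] := eqVneq (p w) 0; first by rewrite !mul0r.
congr (_ * _); have [h|h] := eqVneq (col w s) (col w s').
  by rewrite !(tw_col pw h) h eqxx.
case: eqP => // h'; move: h.
have := @tw_col s s' (tw s s' w); rewrite twp twK => /(_ pw h') e.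
by rewrite !e h' eqxx.
Qed.

Definition csize (w : Om) (s : S) : nat := #|[set s' | col w s == col w s']|.

Lemma csize_gt0 w s : (0 < csize w s)%N.
Proof. by apply/card_gt0P; exists s; rewrite inE. Qed.

(** Plays the role of the conditional expectation of [phi (mark w s)] given the colouring. *)
Definition cavg (w : Om) (phi : nat -> R) (s : S) : R :=
  (\sum_(s' | col w s == col w s') phi (mark w s')) / (csize w s)%:R.

Lemma csize_tw s s' r w : p w != 0 -> col w s = col w s' -> csize (tw s s' w) r = csize w r.
Proof. by move=> pw h; apply: eq_card => r'; rewrite !inE !(tw_col pw h). Qed.

Lemma cavg_tw s s' r phi w : p w != 0 -> col w s = col w s' ->
  cavg (tw s s' w) phi r = cavg w phi r.
Proof.
move=> pw h; rewrite /cavg csize_tw//; congr (_ / _).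
rewrite (reindex_inj (@perm_inj _ (tperm s s'))) /=.
apply: eq_big => [r'|r' _]; last by rewrite tw_mark// tpermK.
rewrite !(tw_col pw h); case: tpermP => // ->; by rewrite h.
Qed.

Lemma cavg_le1 w phi s : (forall k, `|phi k| <= 1) -> `|cavg w phi s| <= 1.
Proof.
move=> h; rewrite /cavg normrM normfV normr_nat ler_pdivrMr ?ltr0n ?csize_gt0// mul1r.
apply: (le_trans (ler_norm_sum _ _ _)).
apply: (le_trans (ler_sum _ (fun i _ => h _))).
rewrite sumr_const /csize ler_nat.
by apply/eq_leq/eq_card => r; rewrite inE.
Qed.

(** The class average is an average over partners [s']. A partner outside [B] contributes zero,
    since the swap changes the sign of the difference and [X] does not notice it; a partner in [B]
    costs at most [2 * 2] divided by the class size. *)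
Lemma Ex_replace1 (X : Om -> R) (phi : nat -> R) (s : S) (B : {set S}) :
  (forall w, `|X w| <= 2) -> (forall k, `|phi k| <= 1) ->
  (forall s', s' \notin B -> forall w, p w != 0 -> col w s = col w s' -> X (tw s s' w) = X w) ->
  `|Ex p (fun w => X w * (phi (mark w s) - cavg w phi s))| <=
  #|B|%:R * (4 * Ex p (fun w => (csize w s)%:R^-1)).
Proof.
move=> X2 phi1 Xi.
pose D s' := Ex p (fun w => if col w s == col w s' then
   X w * (phi (mark w s) - phi (mark w s')) / (csize w s)%:R else 0).
have -> : Ex p (fun w => X w * (phi (mark w s) - cavg w phi s)) = \sum_s' D s'.
  rewrite -Ex_sum; apply: eq_Ex => w _; rewrite -big_mkcond /=.
  rewrite -mulr_suml -mulr_sumr -mulrA; congr (_ * _).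
  rewrite sumrB mulrBl; congr (_ - _).
  rewrite sumr_const -[phi _ *+ _]mulr_natr -mulrA.
  have -> : #|(fun s' => col w s == col w s')| = csize w s.
    by apply: eq_card => r; rewrite inE.
  by rewrite divff ?mulr1// pnatr_eq0 -lt0n csize_gt0.
rewrite (bigID (mem B)) /= [X in _ + X]big1 ?addr0 => [|s' sB].
  apply: (le_trans (ler_norm_sum _ _ _)).
  rewrite mulr_natl -sumr_const; apply: ler_sum => s' _.
  apply: (le_trans (Ex_abs p0 _)); rewrite -ExZ; apply: le_Ex => // w _.
  case: ifP => _; last by rewrite normr0 mulr_ge0// invr_ge0.
  rewrite normrM normfV normr_nat ler_wpM2r ?invr_ge0// normrM.
  have -> : 4 = 2 * 2 :> R by rewrite -natrM.
  apply: ler_pM => //; apply: (le_trans (ler_normB _ _)).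
  by rewrite (_ : 2 = 1 + 1)// lerD.
rewrite /D; have e w : (if col w s == col w s' then
     X w * (phi (mark w s) - phi (mark w s')) / (csize w s)%:R else 0) =
  (if col w s == col w s' then X w * phi (mark w s) / (csize w s)%:R else 0) -
  (if col w s == col w s' then X w * phi (mark w s') / (csize w s)%:R else 0).
  by case: ifP => _; rewrite ?subr0// mulrBr mulrBl.
rewrite (eq_Ex (fun w _ => e w)) ExB; apply/eqP; rewrite subr_eq0; apply/eqP.
rewrite Ex_swap; apply: eq_Ex => w pw; case: eqP => // h.
by rewrite Xi// csize_tw// tw_mark// tpermL.
Qed.

(** Telescoping over [L], one socket at a time. The other factors may be absorbed into [X]: marks at
    sockets of [L] are not moved by a swap of [s] with a partner outside [B], and class averages are
    invariant under every swap inside a class. *)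
Lemma Ex_replace (B : {set S}) (phi : S -> nat -> R) (L : seq S) (X : Om -> R) :
  uniq L -> {subset L <= B} -> (forall s k, `|phi s k| <= 1) ->
  (forall w, `|X w| <= 2) ->
  (forall s s', s \in L -> s' \notin B ->
     forall w, p w != 0 -> col w s = col w s' -> X (tw s s' w) = X w) ->
  `|Ex p (fun w => X w * (\prod_(s <- L) phi s (mark w s) - \prod_(s <- L) cavg w (phi s) s))| <=
  \sum_(s <- L) #|B|%:R * (4 * Ex p (fun w => (csize w s)%:R^-1)).
Proof.
move=> + + phi1; elim: L X => [|s L IH] X.
  move=> _ _ _ _; rewrite !big_nil (eq_Ex (Z' := fun=> 0)) => [|w _]; last first.
    by rewrite !big_nil subrr mulr0.
  by rewrite /Ex big1 ?normr0// => w _; rewrite mulr0.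
move=> /= /andP[sL uL] LB X2 Xi; rewrite big_cons.
have e w : X w * (\prod_(s <- s :: L) phi s (mark w s) - \prod_(s <- s :: L) cavg w (phi s) s) =
  (X w * \prod_(s <- L) phi s (mark w s)) * (phi s (mark w s) - cavg w (phi s) s) +
  (X w * cavg w (phi s) s) * (\prod_(s <- L) phi s (mark w s) - \prod_(s <- L) cavg w (phi s) s).
  by rewrite !big_cons; ring.
rewrite (eq_Ex (fun w _ => e w)) ExD; apply: (le_trans (ler_normD _ _)); apply: lerD.
  apply: Ex_replace1 => // [w|s' s'B w pw h].
    rewrite normrM -[leRHS]mulr1 ler_pM//; exact: normr_prod_le1.
  rewrite (Xi s) ?mem_head//; congr (_ * _); apply: eq_big_seq => r rL.
  rewrite tw_mark// tpermD//; first by apply: contraNneq sL => ->.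
  by apply: contraNneq s'B => ->; apply: LB; rewrite in_cons rL orbT.
apply: IH => // [r rL|w|r s' rL s'B w pw h].
- by apply: LB; rewrite in_cons rL orbT.
- by rewrite normrM -[leRHS]mulr1 ler_pM// cavg_le1.
- by rewrite cavg_tw// Xi// in_cons rL orbT.
Qed.

(* Each colour class contributes at most 1, whatever its size. *)
Lemma sum_inv_csize : \sum_s Ex p (fun w => (csize w s)%:R^-1) <= #|K|%:R.
Proof.
rewrite -Ex_sum -[leRHS](Ex_cst p1); apply: le_Ex => // w _.
rewrite (partition_big (col w) predT) //= -sum1_card natr_sum; apply: ler_sum => k _.
have [s sk|h] := pickP (fun s => col w s == k); last by rewrite big_pred0.
rewrite (eq_bigr (fun=> (csize w s)%:R^-1)) => [|s' /eqP s'k]; last first.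
  by congr (_%:R^-1); apply: eq_card => r; rewrite !inE s'k (eqP sk).
rewrite sumr_const -[_ *+ _]mulr_natl ler_pdivrMr ?ltr0n ?csize_gt0// mul1r ler_nat.
by apply/eq_leq/eq_card => r; rewrite !inE (eqP sk) eq_sym.
Qed.

End Exchangeable.

(** * Statistics of the labels around a node *)

Lemma dist_prod_le (R : realDomainType) (I : Type) (r : seq I) (P : pred I) (F G : I -> R) :
  (forall i, `|F i| <= 1) -> (forall i, `|G i| <= 1) ->
  `|\prod_(i <- r | P i) F i - \prod_(i <- r | P i) G i| <= \sum_(i <- r | P i) `|F i - G i|.
Proof.
move=> F1 G1; elim: r => [|i r IH]; first by rewrite !big_nil subrr normr0.
rewrite !big_cons; case: ifP => // Pi.
set a := \prod_(j <- r | P j) F j; set b := \prod_(j <- r | P j) G j.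
have -> : F i * a - G i * b = (F i - G i) * a + G i * (a - b) by ring.
apply: (le_trans (ler_normD _ _)); rewrite !normrM; apply: lerD.
  by rewrite ler_piMr// normr_prod_le1.
by apply: le_trans IH; rewrite ler_piMl.
Qed.

(** Products of single-socket test functions determine the joint law of the labels around a node.
    The test may depend on the position of the socket within its node, so that one socket can be
    singled out; [G] will carry the erasure of a variable. *)
Definition stat (R : realType) (N : nat) (d : 'I_N -> nat) (G : 'I_N -> R) (j : nat)
    (psi : nat -> nat -> R) (mk : {v : 'I_N & 'I_(d v)} -> nat) : R :=
  \sum_(v | d v == j) G v *
    \prod_(s : {v : 'I_N & 'I_(d v)} | tag s == v) psi (tagged s) (mk s).

(** One round as seen by a test function: a label below [t] is final, a label that has reached [t]
    moves on to [t.+1] with probability [q]. *)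
Definition star (R : realType) (q : R) (t : nat) (psi : nat -> R) (k : nat) : R :=
  if (k < t)%N then psi k else q * psi t.+1 + (1 - q) * psi t.

Lemma star_le1 (R : realType) (q : R) t psi k : 0 <= q <= 1 -> (forall k, `|psi k| <= 1) ->
  `|star q t psi k| <= 1.
Proof.
move=> /andP[q0 q1] psi1; rewrite /star; case: ifP => _ //.
apply: (le_trans (ler_normD _ _)).
rewrite !normrM (ger0_norm q0) (@ger0_norm _ (1 - q)) ?subr_ge0//.
apply: (@le_trans _ _ (q * 1 + (1 - q) * 1)); last by rewrite !mulr1 addrC subrK.
by apply: lerD; rewrite ler_wpM2l ?subr_ge0.
Qed.

Lemma card_node (N : nat) (d : 'I_N -> nat) (v : 'I_N) :
  #|[set s : {v : 'I_N & 'I_(d v)} | tag s == v]| = d v.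
Proof.
have injT : injective (fun i : 'I_(d v) => Tagged (fun v => 'I_(d v)) i).
  by move=> i i'; exact: eq_from_Tagged.
rewrite -[RHS]card_ord -(card_imset predT injT).
apply: eq_card => s; rewrite inE; apply/eqP/imsetP => [e|[i _ ->]//].
by case: s e => v' i /= e; subst v'; exists i.
Qed.

Section NodeStatistics.
Variables (R : realType) (Om : finType) (p : Om -> R).
Hypothesis p0 : forall w, 0 <= p w.
Hypothesis p1 : \sum_w p w = 1.
Variables (N : nat) (d : 'I_N -> nat).
Let S : finType := {v : 'I_N & 'I_(d v)}.
Variables (K : finType) (col : Om -> S -> K) (mark : Om -> S -> nat).
Variable tw : S -> S -> Om -> Om.
Hypothesis twK : forall s s', involutive (tw s s').
Hypothesis twp : forall s s' w, p (tw s s' w) = p w.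
Hypothesis tw_col : forall s s' w, p w != 0 -> col w s = col w s' -> col (tw s s' w) =1 col w.
Hypothesis tw_mark : forall s s' w, p w != 0 -> col w s = col w s' ->
  forall r, mark (tw s s' w) r = mark w (tperm s s' r).
Variable G : Om -> 'I_N -> R.
Hypothesis G1 : forall w v, `|G w v| <= 1.
Hypothesis tw_G : forall s s' w, p w != 0 -> col w s = col w s' -> G (tw s s' w) =1 G w.
Variables (j : nat) (psi : nat -> nat -> R).
Hypothesis psi1 : forall i k, `|psi i k| <= 1.

Let phi (s : S) := psi (tagged s).
Let P w v := \prod_(s : S | tag s == v) phi s (mark w s).
Let Pb w v := \prod_(s : S | tag s == v) cavg col mark w (phi s) s.

Let PmPb2 w v : `|P w v - Pb w v| <= 2.
Proof.
apply: (le_trans (ler_normB _ _)); rewrite (_ : 2 = 1 + 1 :> R)//; apply: lerD.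
  by apply: normr_prod_le1 => s _; apply: psi1.
by apply: normr_prod_le1 => s _; apply: cavg_le1 => k; apply: psi1.
Qed.

(** The diagonal gives at most [4] per node. Off the diagonal the sockets of one node are replaced
    by class averages, with the other node as weight; only the sockets of the two nodes, at most
    [2 * j], are forbidden partners, whence [8 * j], and the reciprocals of the class sizes sum to
    at most [#|K|]. *)
Lemma Ex_stat_avg_sq :
  Ex p (fun w => (\sum_(v | d v == j) G w v * (P w v - Pb w v)) ^+ 2) <=
  (4 + 8 * j%:R * #|K|%:R) * N%:R.
Proof.
pose X w v := G w v * (P w v - Pb w v).
have X2 w v : `|X w v| <= 2.
  rewrite normrM -[leRHS]mul1r; exact: ler_pM.
pose B v v' : {set S} := [set s | tag s == v] :|: [set s | tag s == v'].
have cB v v' : d v == j -> d v' == j -> (#|B v v'| <= 2 * j)%N.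
  move=> /eqP dv /eqP dv'; apply: (leq_trans (leq_card_setU _ _)).
  by rewrite !card_node dv dv' mul2n addnn.
have cross v v' : d v == j -> d v' == j -> v != v' ->
    Ex p (fun w => X w v * X w v') <=
    \sum_(s : S | tag s == v) 8 * j%:R * Ex p (fun w => (csize col w s)%:R^-1).
  move=> dv dv' vv'.
  pose L := enum [pred s : S | tag s == v].
  have big_L w : P w v - Pb w v =
     \prod_(s <- L) phi s (mark w s) - \prod_(s <- L) cavg col mark w (phi s) s.
    by rewrite !big_enum.
  apply: (le_trans (ler_norm _)).
  rewrite (eq_Ex (Z' := fun w => (G w v * X w v') *
     (\prod_(s <- L) phi s (mark w s) - \prod_(s <- L) cavg col mark w (phi s) s))); last first.
    by move=> w _; rewrite -big_L /X; ring.
  apply: (le_trans (Ex_replace p0 twK twp tw_col tw_mark (B := B v v') _ _ _ _ _)).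
  - exact: enum_uniq.
  - by move=> s; rewrite mem_enum !inE => ->.
  - by move=> s k; apply: psi1.
  - move=> w; rewrite normrM -[leRHS]mul1r; exact: ler_pM.
  - move=> s s'; rewrite mem_enum !inE negb_or => sv /andP[s'v s'v'] w pw h.
    rewrite /X !tw_G//; congr (_ * (_ * (_ - _))).
      apply: eq_bigr => r rv'; rewrite tw_mark// tpermD//.
        by apply: contraTneq rv' => <-; rewrite (eqP sv).
      by apply: contraTneq rv' => <-.
    by apply: eq_bigr => r rv'; apply: (cavg_tw tw_col tw_mark).
  rewrite big_enum /=; apply: ler_sum => s _.
  have E0 : 0 <= Ex p (fun w => (csize col w s)%:R^-1 : R).
    by apply: Ex_ge0 => // w _; rewrite invr_ge0.
  rewrite mulrA ler_wpM2r// (_ : 8 * j%:R = (2 * j)%:R * 4 :> R); last by rewrite natrM; ring.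
  by rewrite ler_wpM2r// ler_nat cB.
rewrite (eq_Ex (Z' := fun w => \sum_(v | d v == j) \sum_(v' | d v' == j) X w v * X w v')); last first.
  by move=> w _; rewrite expr2 mulr_suml; apply: eq_bigr => v _; rewrite mulr_sumr.
rewrite Ex_sum.
have per v : d v == j -> Ex p (fun w => \sum_(v' | d v' == j) X w v * X w v') <=
    4 + N%:R * \sum_(s : S | tag s == v) 8 * j%:R * Ex p (fun w => (csize col w s)%:R^-1).
  move=> dv; rewrite Ex_sum (bigD1 v)//=; apply: lerD.
    rewrite -[leRHS](Ex_cst p1); apply: le_Ex => // w _.
    rewrite -expr2 -real_normK ?num_real// (_ : 4 = 2 ^+ 2 :> R) ?ler_sqr ?nnegrE//.
    by rewrite -natrX.
  set C := \sum_(s : S | tag s == v) _; have C0 : 0 <= C.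
    apply: sumr_ge0 => s _; apply: mulr_ge0 => //.
    by apply: Ex_ge0 => // w _; rewrite invr_ge0.
  apply: (@le_trans _ _ (\sum_(i | (d i == j) && (i != v)) C)).
    by apply: ler_sum => v' /andP[dv' v'v]; apply: cross => //; rewrite eq_sym.
  rewrite sumr_const -[_ *+ _]mulr_natl ler_wpM2r// ler_nat.
  by rewrite -[leqRHS]card_ord max_card.
apply: (le_trans (ler_sum _ (fun v dv => per v dv))).
apply: (@le_trans _ _ (\sum_v (4 + N%:R * \sum_(s : S | tag s == v) 8 * j%:R *
     Ex p (fun w => (csize col w s)%:R^-1)))).
  rewrite [leRHS](bigID (fun v => d v == j)) /= lerDl; apply: sumr_ge0 => v _.
  apply: addr_ge0 => //; apply: mulr_ge0 => //; apply: sumr_ge0 => s _; apply: mulr_ge0 => //.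
  by apply: Ex_ge0 => // w _; rewrite invr_ge0.
rewrite big_split /= sumr_const card_ord -mulr_sumr.
rewrite -(partition_big (fun s : S => tag s) predT (P := predT)) //= -mulr_sumr.
rewrite [leRHS]mulrDl -[4 *+ _]mulr_natr lerD2l [leRHS]mulrC ler_wpM2l//.
by rewrite ler_wpM2l ?mulr_ge0// sum_inv_csize.
Qed.

Variables (base : Om -> S -> nat) (bs : K -> nat) (t : nat) (q : R).
Hypothesis col_base : forall w s, p w != 0 -> base w s = bs (col w s).
Hypothesis base_le : forall w s, p w != 0 -> (base w s <= t)%N.
Hypothesis mark_lt : forall w s, p w != 0 -> (base w s < t)%N -> mark w s = base w s.
Hypothesis mark_t : forall w s, p w != 0 -> base w s = t -> mark w s = t \/ mark w s = t.+1.
Hypothesis q01 : 0 <= q <= 1.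

(** Replacing new labels by class averages costs the second moment bound, where [del] is free and
    will be a small multiple of the number of nodes. Replacing the class averages by [star] costs
    the deviation of the surviving fraction of each open class from [q]. *)
Lemma Ex_stat_step (del : R) : 0 < del ->
  Ex p (fun w => `|stat (G w) j psi (mark w) - stat (G w) j (fun i => star q t (psi i)) (base w)|) <=
  (4 + 8 * j%:R * #|K|%:R) * N%:R / del + del +
  2 * \sum_(k : K | bs k == t) Ex p (fun w =>
     `|\sum_s ((col w s == k) && (mark w s == t.+1))%:R - q * \sum_s (col w s == k)%:R|).
Proof.
move=> del0.
pose Zb w := \sum_(v | d v == j) G w v * Pb w v.
apply: (@le_trans _ _ (Ex p (fun w => `|\sum_(v | d v == j) G w v * (P w v - Pb w v)| +
   `|Zb w - stat (G w) j (fun i => star q t (psi i)) (base w)|))).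
  apply: le_Ex => // w _; apply: le_trans (ler_normD _ _); rewrite le_eqVlt; apply/orP; left.
  apply/eqP; congr `|_|; rewrite addrA; congr (_ - _).
  by rewrite /Zb -big_split; apply: eq_bigr => v _ /=; rewrite -mulrDr subrK.
rewrite ExD; apply: lerD.
  apply: (le_trans (Ex_abs_le_sq p0 p1 _ del0)); rewrite lerD2r.
  by rewrite ler_wpM2r ?invr_ge0 ?(ltW del0)// Ex_stat_avg_sq.
rewrite -Ex_sum -ExZ; apply: le_Ex => // w pw.
rewrite /Zb /stat -sumrB.
have st1 i k : `|star q t (psi i) k| <= 1 by exact: star_le1.
apply: (@le_trans _ _ (\sum_(v | d v == j) \sum_(s : S | tag s == v)
   `|cavg col mark w (phi s) s - star q t (phi s) (base w s)|)).
  apply: (le_trans (ler_norm_sum _ _ _)); apply: ler_sum => v _.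
  rewrite -mulrBr normrM; apply: (le_trans (ler_piMl _ (G1 _ _))) => //.
  apply: dist_prod_le => s //; apply: cavg_le1 => k; exact: psi1.
apply: (@le_trans _ _ (\sum_(s : S) `|cavg col mark w (phi s) s - star q t (phi s) (base w s)|)).
  rewrite [leRHS](partition_big (fun s : S => tag s) predT) //= [leRHS](bigID (fun v => d v == j)) /= lerDl.
  by apply: sumr_ge0 => v _; apply: sumr_ge0.
rewrite (partition_big (col w) predT) //= (bigID (fun k => bs k == t)) /=.
(* In a class with base label below [t] the mark is already determined, so the average and [star]
   agree exactly. *)
rewrite [X in _ + X]big1 ?addr0; last first.
  move=> k bk; apply: big1 => s /eqP sk.
  have blt r : col w r = k -> (base w r < t)%N.
    by move=> rk; rewrite ltn_neqAle base_le// col_base// rk bk.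
  have -> : star q t (phi s) (base w s) = phi s (base w s) by rewrite /star blt.
  suff -> : cavg col mark w (phi s) s = phi s (base w s) by rewrite subrr normr0.
  rewrite /cavg (eq_bigr (fun=> phi s (base w s))) => [|r /eqP rs]; last first.
    by rewrite mark_lt ?blt -?rs// !col_base// rs.
  rewrite sumr_const -[phi _ _ *+ _]mulr_natr.
  have -> : #|(fun s' => col w s == col w s')| = csize col w s.
    by apply: eq_card => r; rewrite inE.
  by rewrite mulfK// pnatr_eq0 -lt0n csize_gt0.
rewrite mulr_sumr; apply: ler_sum => k /eqP bk.
set n1 := \sum_s _; set c := \sum_s (col w s == k)%:R.
have cE s : col w s = k -> (csize col w s)%:R = c.
  move=> sk; rewrite /c /csize -sum1_card natr_sum /=.
  rewrite [RHS](_ : _ = \sum_(r | col w r == k) 1); last first.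
    by rewrite [RHS]big_mkcond; apply: eq_bigr => r _; case: eqP.
  by apply: eq_bigl => r; rewrite inE sk eq_sym.
have [[s0 s0k]|none] := pselect (exists s, col w s = k); last first.
  rewrite big1 ?mulr_ge0// => s /eqP sk; by case: none; exists s.
have c0 : 0 < c by rewrite -(cE _ s0k) ltr0n csize_gt0.
(* Of the [c] members of the class [n1] move on, so each member has an error of at most twice the
   distance of [n1 / c] from [q]; summing over the class cancels the division by [c]. *)
apply: (@le_trans _ _ (\sum_(s | col w s == k) 2 * `|n1 - q * c| / c)).
  apply: ler_sum => s /eqP sk.
  have bt : base w s = t by rewrite col_base// sk.
  have -> : star q t (phi s) (base w s) = q * phi s t.+1 + (1 - q) * phi s t.
    by rewrite /star bt ltnn.
  have -> : cavg col mark w (phi s) s = (n1 * phi s t.+1 + (c - n1) * phi s t) / c.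
    rewrite /cavg (cE _ sk); congr (_ / _).
    rewrite big_mkcond /= mulrBl addrCA -mulrBr /c /n1 !mulr_suml -big_split /=.
    apply: eq_bigr => r _; rewrite sk eq_sym; case: eqP => rk /=; last by rewrite !mul0r addr0.
    have br : base w r = t by rewrite col_base// rk.
    have [->|->] := mark_t pw br; last by rewrite eqxx !mul1r addrC subrK.
    by rewrite ltn_eqF// mul0r addr0 mul1r.
  have -> : (n1 * phi s t.+1 + (c - n1) * phi s t) / c - (q * phi s t.+1 + (1 - q) * phi s t) =
      (phi s t.+1 - phi s t) * ((n1 - q * c) / c) by field; rewrite gt_eqF.
  rewrite normrM [X in _ * X]normrM normfV (gtr0_norm c0) mulrA ler_wpM2r ?invr_ge0 ?(ltW c0)//.
  rewrite ler_wpM2r//; apply: (le_trans (ler_normB _ _)).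
  by rewrite (_ : 2 = 1 + 1 :> R)//; apply: lerD; exact: psi1.
rewrite sumr_const -[_ *+ _]mulr_natr.
have -> : #|(fun s => col w s == k)|%:R = c.
  by rewrite -(cE _ s0k); congr (_%:R); apply: eq_card => r; rewrite inE s0k eq_sym.
by rewrite divfK// gt_eqF.
Qed.

End NodeStatistics.

(** * Message passing on a Tanner graph *)

Lemma leq_bigmin (I : finType) (P : pred I) (F : I -> nat) (t k : nat) :
  (k <= \big[minn/t]_(i | P i) F i)%N = (k <= t)%N && [forall (i | P i), (k <= F i)%N].
Proof.
have aux r : (k <= \big[minn/t]_(i <- r | P i) F i)%N =
    (k <= t)%N && all (fun i => P i ==> (k <= F i)%N) r.
  elim: r => [|i r IH]; first by rewrite big_nil andbT.
  by rewrite big_cons /=; case: ifP => //= _; rewrite leq_min IH andbCA.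
rewrite aux; congr (_ && _); apply/allP/forallP => h i; last by move=> _; apply: h.
by apply: h; apply: mem_index_enum.
Qed.

Section Messages.
Variables (n m : nat) (dv : 'I_n -> nat) (dc : 'I_m -> nat).
Implicit Types (f : {ffun vsock dv -> csock dc}) (E : {ffun 'I_n -> bool}).
Implicit Types (s : vsock dv) (r : csock dc).

(** A check returns an erasure as soon as one other incoming message is an erasure, a variable only
    if it is erased and all others are. As erasures only disappear from round to round, the counts
    combine by a maximum at checks and by a minimum at variables. *)
Definition ymsg f (X : vsock dv -> nat) s : nat :=
  \max_(s' | (s' != s) && (tag (f s') == tag (f s))) X s'.
Definition xmsg E (t : nat) (Y : vsock dv -> nat) s : nat :=
  if E (tag s) then (\big[minn/t]_(s' | (s' != s) && (tag s' == tag s)) Y s').+1 else 0%N.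

(* [xm t f E s] is the number of the first [t] rounds of message passing in which the message on
   the edge [s] towards its check is an erasure; [ym] counts the opposite messages. *)
Fixpoint xm (t : nat) f E : vsock dv -> nat :=
  if t is t'.+1 then xmsg E t' (ymsg f (xm t' f E)) else fun=> 0%N.
Definition ym (t : nat) f E : vsock dv -> nat := ymsg f (xm t f E).

Lemma ym_gt t f E s k : (k < ym t f E s)%N =
  [exists s', [&& s' != s, tag (f s') == tag (f s) & (k < xm t f E s')%N]].
Proof.
rewrite /ym /ymsg; apply/idP/existsP => [|[s' /and3P[a b c]]]; last first.
  by apply: (leq_trans c); rewrite (bigD1 s') ?a ?b//= leq_maxl.
move=> lt; apply: contrapT => h; move: lt; apply/negP; rewrite -leqNgt.
apply/bigmax_leqP => s' /andP[a b]; rewrite leqNgt; apply/negP => c; apply: h.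
by exists s'; rewrite a b c.
Qed.

Lemma xmS_gt t f E s k : (k <= t)%N -> (k < xm t.+1 f E s)%N =
  E (tag s) && [forall (s' | (s' != s) && (tag s' == tag s)), (k <= ym t f E s')%N].
Proof. by move=> kt; rewrite /= /xmsg; case: ifP => //= _; rewrite ltnS leq_bigmin kt. Qed.

Lemma xm_le t f E s : (xm t f E s <= t)%N.
Proof.
case: t => [|t] //=; rewrite /xmsg; case: ifP => // _; rewrite ltnS.
by have := leqnn (\big[minn/t]_(s' | (s' != s) && (tag s' == tag s)) ymsg f (xm t f E) s');
  rewrite leq_bigmin => /andP[].
Qed.

Lemma ym_le t f E s : (ym t f E s <= t)%N.
Proof. by apply/bigmax_leqP => s' _; apply: xm_le. Qed.

(** Whether a label passes a threshold is decided by lower thresholds one round earlier, so a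
    further round can only extend labels that have reached [t]. The successive records are therefore
    nested. *)
Lemma xy_trunc t f E : (forall s k, (k <= t)%N -> (k <= xm t f E s)%N = (k <= xm t.+1 f E s)%N) /\
  (forall s k, (k <= t)%N -> (k <= ym t f E s)%N = (k <= ym t.+1 f E s)%N).
Proof.
elim: t => [|t [IHx IHy]].
  by split=> s k; rewrite leqn0 => /eqP ->.
have hx s k : (k <= t.+1)%N -> (k <= xm t.+1 f E s)%N = (k <= xm t.+2 f E s)%N.
  case: k => // k kt; rewrite !xmS_gt//; last exact: leqW.
  by congr (_ && _); apply: eq_forallb => s'; rewrite IHy.
split=> // s [|k] // kt; rewrite !ym_gt; apply: eq_existsb => s'; by rewrite hx.
Qed.

Lemma xm_trunc t f E s k : (k <= t)%N -> (k <= xm t f E s)%N = (k <= xm t.+1 f E s)%N.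
Proof. exact: (xy_trunc t f E).1. Qed.
Lemma ym_trunc t f E s k : (k <= t)%N -> (k <= ym t f E s)%N = (k <= ym t.+1 f E s)%N.
Proof. exact: (xy_trunc t f E).2. Qed.

Lemma xm_minn t f E s : xm t f E s = minn (xm t.+1 f E s) t.
Proof.
have := xm_le t f E s; have := xm_trunc f E s (leqnn t).
have := @xm_trunc t f E s (xm t f E s) (xm_le _ _ _ _).
have [h|h] := leqP (xm t.+1 f E s) t; last by lia.
by have := xm_trunc f E s h; lia.
Qed.
Lemma ym_minn t f E s : ym t f E s = minn (ym t.+1 f E s) t.
Proof.
have := ym_le t f E s; have := ym_trunc f E s (leqnn t).
have := @ym_trunc t f E s (ym t f E s) (ym_le _ _ _ _).
have [h|h] := leqP (ym t.+1 f E s) t; last by lia.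
by have := ym_trunc f E s h; lia.
Qed.

Definition swapv s s' f : {ffun vsock dv -> csock dc} := [ffun u => f (tperm s s' u)].
Definition swapc r r' f : {ffun vsock dv -> csock dc} := [ffun u => tperm r r' (f u)].

Lemma swapvK s s' : involutive (swapv s s').
Proof. by move=> f; apply/ffunP => u; rewrite !ffunE tpermK. Qed.
Lemma swapcK r r' : involutive (swapc r r').
Proof. by move=> f; apply/ffunP => u; rewrite !ffunE tpermK. Qed.

Lemma ymsg_swapv s s' f X u : X s = X s' ->
  ymsg (swapv s s' f) X u = ymsg f X (tperm s s' u).
Proof.
move=> h; rewrite /ymsg (reindex_inj (@perm_inj _ (tperm s s'))) /=.
apply: eq_big => [v|v _]; last by case: tpermP => // ->; rewrite ?h.
by rewrite !ffunE tpermK -{1}(tpermK s s' u) (inj_eq perm_inj).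
Qed.

(** The swap exchanges two edges that carry equal labels into their checks and receive equal labels
    back, so by induction on the rounds no label changes. This is the uniformity of the matching
    given the record. *)
Lemma xy_swapv t s s' f E : xm t f E s = xm t f E s' -> ym t f E s = ym t f E s' ->
  xm t (swapv s s' f) E =1 xm t f E /\ ym t (swapv s s' f) E =1 ym t f E.
Proof.
elim: t => [|t IH] hx hy.
  by split=> // u; apply/eqP; rewrite -[_ == _]andTb eqn_leq !(leq_trans (ym_le 0 _ _ _)).
have [||IHx IHy] := IH; first by rewrite !(xm_minn t) hx.
  by rewrite !(ym_minn t) hy.
have ex : xm t.+1 (swapv s s' f) E =1 xm t.+1 f E.
  move=> u /=; rewrite /xmsg; case: ifP => // _; congr _.+1.
  by apply: eq_bigr => v _; apply: IHy.
split=> // u; rewrite /ym /ymsg (eq_bigr _ (fun v _ => ex v)).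
rewrite -/(ymsg (swapv s s' f) (xm t.+1 f E) u) ymsg_swapv// -/(ym t.+1 f E _).
by case: tpermP => // ->.
Qed.

Lemma xmS_swapv t s s' f E : xm t f E s = xm t f E s' -> ym t f E s = ym t f E s' ->
  xm t.+1 (swapv s s' f) E =1 xm t.+1 f E.
Proof.
move=> hx hy u /=; rewrite /xmsg; case: ifP => // _; congr _.+1.
by apply: eq_bigr => v _; apply: (xy_swapv hx hy).2.
Qed.

(** Variable messages of round [t.+1] read only the unchanged check messages of round [t], whereas
    the new check messages belong to the check ends and travel with them. *)
Lemma ymS_swapv t s s' f E : xm t.+1 f E s = xm t.+1 f E s' -> ym t f E s = ym t f E s' ->
  forall u, ym t.+1 (swapv s s' f) E u = ym t.+1 f E (tperm s s' u).
Proof.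
move=> hx hy u; have hx' : xm t f E s = xm t f E s' by rewrite !(xm_minn t) hx.
rewrite /ym /ymsg (eq_bigr _ (fun v _ => xmS_swapv hx' hy v)).
by rewrite -/(ymsg (swapv s s' f) (xm t.+1 f E) u) ymsg_swapv.
Qed.

(** Transports labels to the check sockets; for a bijective [f] the maximum has exactly one term,
    and no inverse has to be named. *)
Definition pull f (X : vsock dv -> nat) r : nat := \max_(s | f s == r) X s.

Lemma pullE f X s : injective f -> pull f X (f s) = X s.
Proof.
move=> fi; rewrite /pull (eq_bigl (pred1 s)) ?big_pred1_eq// => u.
by rewrite inj_eq.
Qed.

Lemma eq_pull f X X' r : X =1 X' -> pull f X r = pull f X' r.
Proof. by move=> h; apply: eq_bigr. Qed.

Lemma pull_swapc r r' f X u : pull (swapc r r' f) X u = pull f X (tperm r r' u).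
Proof.
apply: eq_bigl => s; rewrite ffunE -{1}(tpermK r r' u) (inj_eq perm_inj) //.
Qed.

(** Exchangeability of check sockets is thereby reduced to that of variable sockets. *)
Lemma swapc_swapv s s' f : injective f -> swapc (f s) (f s') f = swapv s s' f.
Proof. by move=> fi; apply/ffunP => u; rewrite !ffunE inj_tperm. Qed.

Lemma inj_swapv s s' f : injectiveb (swapv s s' f) = injectiveb f.
Proof.
apply/injectiveP/injectiveP => fi u v h.
  have := fi (tperm s s' u) (tperm s s' v); rewrite !ffunE !tpermK => /(_ h).
  exact: perm_inj.
by move: h; rewrite !ffunE => /fi/perm_inj.
Qed.

Lemma inj_swapc r r' f : injectiveb (swapc r r' f) = injectiveb f.
Proof.
apply/injectiveP/injectiveP => fi u v h; first by apply: fi; rewrite !ffunE h.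
by move: h; rewrite !ffunE => /perm_inj/fi.
Qed.

End Messages.

Arguments xm : simpl never.

(** * Degree distributions *)

Section NodePerspective.
Variables (R : realType) (p : {poly R}).

Lemma coef_prim i : (prim p)`_i = if i is k.+1 then p`_k / k.+1%:R else 0.
Proof.
rewrite coef_poly; case: i => [|k] //; rewrite ltnS; case: ltnP => // h.
by rewrite nth_default// mul0r.
Qed.

Lemma deriv_prim : (prim p)^`() = p.
Proof.
apply/polyP => i; rewrite coef_deriv coef_prim -[LHS]mulr_natr -mulrA mulVf ?mulr1//.
Qed.

Hypothesis dd : edge_dd p.

Lemma prim1_gt0 : 0 < (prim p).[1].
Proof.
case: dd => _ [p0 p1].
have pp i : 0 <= (prim p)`_i by rewrite coef_prim; case: i => // k; rewrite divr_ge0.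
have p_ge (q : {poly R}) : (forall i, 0 <= q`_i) -> q.[1] = 0 -> q = 0.
  move=> q0; rewrite horner_coef => /psumr_eq0P h; apply/polyP => i; rewrite coef0.
  have [iq|iq] := ltnP i (size q); last by rewrite nth_default.
  have := h _ (Ordinal iq) isT; rewrite /= expr1n mulr1; apply => j _.
  by rewrite expr1n mulr1.
rewrite lt_neqAle eq_sym; apply/andP; split; last first.
  by rewrite horner_coef sumr_ge0// => i _; rewrite expr1n mulr1.
apply/eqP => /(p_ge _ pp) h; move: p1; rewrite -deriv_prim h deriv0 horner0 => /eqP.
by rewrite eq_sym oner_eq0.
Qed.

Lemma node_persp_ge0 i : 0 <= (node_persp p)`_i.
Proof.
case: dd => _ [p0 p1]; rewrite coefZ coef_prim mulr_ge0 ?invr_ge0 ?(ltW prim1_gt0)//.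
by case: i => // k; rewrite divr_ge0.
Qed.

Lemma node_persp_lt2 i : (i < 2)%N -> (node_persp p)`_i = 0.
Proof.
by case: dd => p0 _; case: i => [|[|]]// _; rewrite coefZ coef_prim ?p0 ?mul0r mulr0.
Qed.

Lemma node_persp1 : (node_persp p).[1] = 1.
Proof. by rewrite hornerZ mulVf// gt_eqF// prim1_gt0. Qed.

Lemma dp_node_persp1 : dp (node_persp p) 1 = (prim p).[1]^-1.
Proof. by case: dd => _ [_ p1]; rewrite /dp derivZ hornerZ deriv_prim p1 mulr1. Qed.

Lemma dp_node_persp1_gt0 : 0 < dp (node_persp p) 1.
Proof. by rewrite dp_node_persp1 invr_gt0 prim1_gt0. Qed.

Lemma dp_node_persp a : dp (node_persp p) a = dp (node_persp p) 1 * p.[a].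
Proof. by rewrite dp_node_persp1 /dp derivZ hornerZ deriv_prim. Qed.

End NodePerspective.

Lemma dpE (R : realType) (p : {poly R}) a :
  dp p a = \sum_(i < size p) p`_i * i%:R * a ^+ i.-1.
Proof.
have -> : dp p a = \sum_(i < (size p).-1) (p^`())`_i * a ^+ i.
  apply: horner_coef_wide; apply/leq_sizeP => j h; rewrite coef_deriv nth_default ?mul0rn//.
  by case: (size p) h.
case: (size p) => [|k]; first by rewrite !big_ord0.
rewrite big_ord_recl /= mulr0 mul0r add0r; apply: eq_bigr => i _.
by rewrite coef_deriv /= mulr_natr.
Qed.

(** The integral of [psi] against the measure on labels up to [t] whose tails are [z k]; its total
    mass is [z 0]. *)
Definition mean (R : realType) (z : nat -> R) (t : nat) (psi : nat -> R) : R :=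
  \sum_(k < t) (z k - z k.+1) * psi k + z t * psi t.

Section Mean.
Variables (R : realType) (z : nat -> R).

Lemma mean0 psi : mean z 0 psi = z 0%N * psi 0%N.
Proof. by rewrite /mean big_ord0 add0r. Qed.

Lemma meanS t psi : mean z t.+1 psi = mean z t psi + z t.+1 * (psi t.+1 - psi t).
Proof. by rewrite /mean big_ord_recr /=; ring. Qed.

Lemma eq_mean t psi psi' : (forall k, (k <= t)%N -> psi k = psi' k) -> mean z t psi = mean z t psi'.
Proof.
by move=> h; rewrite /mean h//; congr (_ + _); apply: eq_bigr => k _; rewrite h// ltnW.
Qed.

(** Of the mass [z t] at the capped label a fraction [z t.+1 / z t] survives another round, so the
    [q] of a step of density evolution is a ratio of successive tails. *)
Lemma mean_star t psi : z t != 0 -> mean z t (star (z t.+1 / z t) t psi) = mean z t.+1 psi.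
Proof.
move=> zt; rewrite meanS {1}/mean /star ltnn (eq_bigr (fun k : 'I_t => (z k - z k.+1) * psi k)).
  by rewrite /mean; field.
by move=> k _; rewrite ltn_ord.
Qed.

Lemma mean_cst t : mean z t (fun=> 1) = z 0%N.
Proof. by elim: t => [|t IH]; rewrite ?mean0 ?mulr1// meanS IH subrr mulr0 addr0. Qed.

Lemma mean_ge t k : (k <= t)%N -> mean z t (fun i => (k <= i)%N%:R) = z k.
Proof.
elim: t k => [|t IH] k; first by rewrite leqn0 => /eqP ->; rewrite mean0 mulr1.
rewrite leq_eqVlt ltnS => /orP[/eqP ->|kt]; last by rewrite meanS IH// kt leqW// subrr mulr0 addr0.
rewrite meanS leqnn ltnn subr0 mulr1 -[RHS]add0r; congr (_ + _).
rewrite /mean ltnn mulr0 addr0 big1// => i _.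
by rewrite leqNgt ltnS ltnW ?mulr0.
Qed.

Lemma meanB t psi psi' : mean z t (fun i => psi i - psi' i) = mean z t psi - mean z t psi'.
Proof. by elim: t => [|t IH]; rewrite ?mean0 ?meanS ?IH; ring. Qed.

Lemma mean_lt t k : (k <= t)%N -> mean z t (fun i => (i < k)%N%:R) = z 0%N - z k.
Proof.
move=> kt; rewrite -{1}(mean_cst t) -(mean_ge kt) -meanB; apply: eq_mean => i _.
by rewrite ltnNge; case: leqP => _; rewrite ?subrr ?subr0.
Qed.

End Mean.

Section Nodes.
Variables (N : nat) (d : 'I_N -> nat).
Local Notation S := {v : 'I_N & 'I_(d v)}.

Lemma big_node (T : Type) (idx : T) (op : Monoid.com_law idx) (v : 'I_N) (F : S -> T) :
  \big[op/idx]_(s : S | tag s == v) F s =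
  \big[op/idx]_(i < d v) F (Tagged (fun v => 'I_(d v)) i).
Proof.
have injT : injective (fun i : 'I_(d v) => Tagged (fun v => 'I_(d v)) i).
  by move=> i i'; exact: eq_from_Tagged.
rewrite (eq_bigl [in [set Tagged (fun v => 'I_(d v)) i | i in 'I_(d v)]]).
  by rewrite big_imset //= => i i' _ _; apply: injT.
move=> s; apply/eqP/imsetP => [e|[i _ ->]//].
by case: s e => v' i /= e; subst v'; exists i.
Qed.

Variable R : realType.

Definition pick1 (A B : nat -> R) (i i' : nat) : nat -> R := if i' == i then A else B.

(** Passage from the edge to the node perspective: the sum over the distinguished socket of a node
    will produce the factor [l] of the derivative of the node polynomial. *)
Lemma sum_marked_stat (D : nat) (G : 'I_N -> R) (A B : nat -> R) (mk : S -> nat) :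
  (forall v, (d v < D)%N) ->
  \sum_(s : S) G (tag s) * (A (mk s) * \prod_(s' : S | (s' != s) && (tag s' == tag s)) B (mk s')) =
  \sum_(l < D) \sum_(i < l) stat G l (pick1 A B i) mk.
Proof.
move=> dD; rewrite (partition_big (fun s : S => tag s) predT) //=.
transitivity (\sum_v \sum_(i < d v) G v * \prod_(s : S | tag s == v) pick1 A B i (tagged s) (mk s)).
  apply: eq_bigr => v _; rewrite big_node; apply: eq_bigr => i _ /=; congr (_ * _).
  rewrite [RHS](bigD1 (Tagged (fun v => 'I_(d v)) i)) //= /pick1 eqxx; congr (_ * _).
  rewrite [LHS]big_andbC; apply: eq_bigr => s /andP[sv si].
  case: ifP => // h; case/negP: si; case: s sv h => v' i' /= /eqP e; subst v' => /eqP h.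
  by apply/eqP; congr (Tagged _ _); apply: val_inj.
rewrite (partition_big (fun v => Ordinal (dD v)) predT) //=; apply: eq_bigr => l _.
rewrite exchange_big /=; apply: eq_big => v // /eqP vl.
have -> : d v = l by rewrite -vl.
by [].
Qed.

End Nodes.

(** * The random graph and the erasures *)

Section Degrees.
Variables (R : realType) (P : {poly R}) (N : nat) (d : 'I_N -> nat).
Hypothesis dP : forall i : nat, #|[set v | d v == i]|%:R = N%:R * P`_i.

Lemma deg_coef_neq0 v : P`_(d v) != 0.
Proof.
apply/eqP => h; have := dP (d v); rewrite h mulr0 => /eqP.
by rewrite pnatr_eq0 => /eqP/card0_eq/(_ v); rewrite !inE eqxx.
Qed.

Lemma deg_lt v : (d v < size P)%N.
Proof. by rewrite ltnNge; apply/negP => h; have := deg_coef_neq0 v; rewrite nth_default ?eqxx. Qed.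

Lemma sum_deg (h : nat -> R) : \sum_v h (d v) = N%:R * \sum_(i < size P) P`_i * h i.
Proof.
rewrite (partition_big (fun v => Ordinal (deg_lt v)) predT) //= mulr_sumr.
apply: eq_bigr => i _; rewrite mulrA -dP (eq_bigr (fun=> h i)) => [|v /eqP <- //].
rewrite sumr_const mulr_natl; congr (_ *+ _); apply: eq_card => v.
by rewrite !inE.
Qed.

End Degrees.

Lemma card_sock (N : nat) (d : 'I_N -> nat) : #|{: {v : 'I_N & 'I_(d v)}}| = (\sum_v d v)%N.
Proof.
rewrite -sum1_card (partition_big (fun s => tag s) predT) //=; apply: eq_bigr => v _.
by rewrite big_node sum1_card card_ord.
Qed.

Section Space.
Variables (R : realType) (eps : R) (n m : nat) (dv : 'I_n -> nat) (dc : 'I_m -> nat).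
Hypothesis e01 : 0 <= eps <= 1.

Definition pE (E : {ffun 'I_n -> bool}) : R := \prod_i (if E i then eps else 1 - eps).

Definition pr (w : {ffun vsock dv -> csock dc} * {ffun 'I_n -> bool}) : R :=
  (w.1 \in graphs dv dc)%:R / #|graphs dv dc|%:R * pE w.2.

Lemma pE_ge0 E : 0 <= pE E.
Proof. by apply: prodr_ge0 => i _; case/andP: e01 => ? ?; case: ifP => _; rewrite ?subr_ge0. Qed.

Lemma sum_pE : \sum_E pE E = 1.
Proof.
rewrite /pE -(bigA_distr_bigA (fun (i : 'I_n) (b : bool) => if b then eps else 1 - eps)) /=.
by apply: big1 => i _; rewrite big_bool /= addrC subrK.
Qed.

Lemma pr_ge0 w : 0 <= pr w.
Proof. by rewrite /pr mulr_ge0 ?pE_ge0// divr_ge0. Qed.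

Hypothesis card_eq : #|{: vsock dv}| = #|{: csock dc}|.

Lemma graphs_gt0 : (0 < #|graphs dv dc|)%N.
Proof.
apply/card_gt0P; exists [ffun s => enum_val (cast_ord card_eq (enum_rank s))].
rewrite inE; apply/injectiveP => s s'; rewrite !ffunE.
by move=> /enum_val_inj/cast_ord_inj/enum_rank_inj.
Qed.

Lemma sum_pr : \sum_w pr w = 1.
Proof.
rewrite -(pair_bigA _ (fun f E => pr (f, E))) /=.
under eq_bigr => f _ do rewrite /pr /= -mulr_sumr sum_pE mulr1.
rewrite -mulr_suml -natr_sum.
have -> : (\sum_f (f \in graphs dv dc))%N = #|graphs dv dc|.
  by rewrite -sum1_card [RHS]big_mkcond /=; apply: eq_bigr => f _; case: ifP.
by rewrite divff// pnatr_eq0 -lt0n graphs_gt0.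
Qed.

Lemma pr_inj w : pr w != 0 -> injective w.1.
Proof.
rewrite /pr; case: (boolP (w.1 \in _)) => [|_]; last by rewrite !mul0r eqxx.
by rewrite inE => /injectiveP.
Qed.

Lemma bij_sock (f : {ffun vsock dv -> csock dc}) : injective f -> bijective f.
Proof. by move=> fi; apply: inj_card_bij => //; rewrite card_eq. Qed.

Lemma pr_bij w : pr w != 0 -> bijective w.1.
Proof. by move=> /pr_inj/bij_sock. Qed.

Lemma Ex_pr (Z : {ffun vsock dv -> csock dc} -> {ffun 'I_n -> bool} -> R) :
  Ex pr (fun w => Z w.1 w.2) =
  (\sum_(f in graphs dv dc) \sum_E pE E * Z f E) / #|graphs dv dc|%:R.
Proof.
rewrite /Ex -(pair_bigA _ (fun f E => pr (f, E) * Z f E)) /= mulr_suml [RHS]big_mkcond /=.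
apply: eq_bigr => f _; rewrite /pr /=; case: ifP => _; last first.
  by apply: big1 => E _; rewrite !mul0r.
rewrite mulr_suml; apply: eq_bigr => E _; rewrite mul1r; ring.
Qed.

Lemma pr_swapv s s' w : pr (swapv s s' w.1, w.2) = pr w.
Proof. by rewrite /pr /= !inE inj_swapv. Qed.
Lemma pr_swapc r r' w : pr (swapc r r' w.1, w.2) = pr w.
Proof. by rewrite /pr /= !inE inj_swapc. Qed.

End Space.

Section Model.
Variables (R : realType) (lam rho : {poly R}) (eps : R).
Hypothesis dl : edge_dd lam.
Hypothesis dr : edge_dd rho.
Hypothesis e01 : 0 <= eps <= 1.
Local Notation Lam := (node_persp lam).
Local Notation Gam := (node_persp rho).

(** Bundled so that limits can be stated uniformly over all admissible skeletons. *)
Record cfg := Cfg { cn : nat; cm : nat; cdv : 'I_cn -> nat; cdc : 'I_cm -> nat;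
  cadm : admissible lam rho cdv cdc }.

Definition kap : R := dp Lam 1 / dp Gam 1.

Lemma kap_gt0 : 0 < kap.
Proof. by rewrite divr_gt0// dp_node_persp1_gt0. Qed.

Lemma kapG : kap * dp Gam 1 = dp Lam 1.
Proof. by rewrite divfK// gt_eqF// dp_node_persp1_gt0. Qed.

Variable c : cfg.

Lemma cmE : (cm c)%:R = (cn c)%:R * kap.
Proof. by have [-> _] := cadm c; rewrite /kap mulrA. Qed.

Lemma cdvE i : #|[set v | cdv (c := c) v == i]|%:R = (cn c)%:R * Lam`_i.
Proof. by have [_ [h _]] := cadm c. Qed.

Lemma cdcE i : #|[set v | cdc (c := c) v == i]|%:R = (cm c)%:R * Gam`_i.
Proof. by have [_ [_ h]] := cadm c. Qed.

Lemma cdv_ge2 v : (1 < cdv (c := c) v)%N.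
Proof.
rewrite ltnNge; apply/negP => h; have := deg_coef_neq0 cdvE v.
by rewrite node_persp_lt2 ?eqxx.
Qed.

Lemma cdc_ge2 v : (1 < cdc (c := c) v)%N.
Proof.
rewrite ltnNge; apply/negP => h; have := deg_coef_neq0 cdcE v.
by rewrite node_persp_lt2 ?eqxx.
Qed.

Lemma card_vsock : #|{: vsock (cdv (c := c))}|%:R = (cn c)%:R * dp Lam 1.
Proof.
rewrite card_sock natr_sum (sum_deg cdvE (fun i => i%:R)) dpE; congr (_ * _).
by apply: eq_bigr => i _; rewrite expr1n mulr1.
Qed.

Lemma card_csock : #|{: csock (cdc (c := c))}|%:R = (cn c)%:R * dp Lam 1.
Proof.
rewrite card_sock natr_sum (sum_deg cdcE (fun i => i%:R)) cmE -mulrA -kapG dpE; congr (_ * (_ * _)).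
by apply: eq_bigr => i _; rewrite expr1n mulr1.
Qed.

Lemma card_vc : #|{: vsock (cdv (c := c))}| = #|{: csock (cdc (c := c))}|.
Proof. by apply/eqP; rewrite -(eqr_nat R) card_vsock card_csock. Qed.

Definition Om : finType :=
  ({ffun vsock (cdv (c := c)) -> csock (cdc (c := c))} * {ffun 'I_(cn c) -> bool})%type.
Definition prc : Om -> R := @pr R eps (cn c) (cm c) (@cdv c) (@cdc c).

Lemma prc_ge0 w : 0 <= prc w. Proof. exact: pr_ge0. Qed.
Lemma sum_prc : \sum_w prc w = 1. Proof. exact: sum_pr card_vc. Qed.

End Model.

(** * Concentration of the messages (density evolution) *)

Section Convergence.
Variables (R : realType) (lam rho : {poly R}) (eps : R).
Hypothesis dl : edge_dd lam.
Hypothesis dr : edge_dd rho.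
Hypothesis e01 : 0 <= eps <= 1.
Local Notation Lam := (node_persp lam).
Local Notation Gam := (node_persp rho).
Local Notation cfg := (cfg lam rho).
Local Notation kap := (kap lam rho).

Let pr0 (c : cfg) (w : Om c) : 0 <= prc eps w. Proof. exact: prc_ge0. Qed.
Let pr1 (c : cfg) : \sum_(w : Om c) prc eps w = 1. Proof. exact: sum_prc. Qed.

(** Convergence in mean of [Z / n], uniform over skeletons. It is stable under linear combinations
    and bounds expectations directly, so exceptional events need not be tracked. *)
Definition tendsL (Z : forall c : cfg, Om c -> R) (z : R) : Prop :=
  forall e : R, 0 < e -> exists N : nat, forall c : cfg, (N <= cn c)%N ->
    Ex (@prc _ _ _ eps c) (fun w => `|Z c w / (cn c)%:R - z|) <= e.

Lemma eq_tendsL (Z Z' : forall c : cfg, Om c -> R) z :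
  (forall c w, prc eps w != 0 -> Z c w = Z' c w) -> tendsL Z z -> tendsL Z' z.
Proof.
move=> h T e e0; have [N hN] := T e e0; exists N => c Nc; apply: le_trans (hN c Nc).
by apply: le_Ex => // w pw; rewrite h.
Qed.

Lemma tendsL_cst z : tendsL (fun c w => z * (cn c)%:R) z.
Proof.
move=> e e0; exists 1%N => c n1; rewrite (eq_Ex (Z' := fun=> 0)) ?Ex_cst ?ltW// => w _.
by rewrite mulfK ?subrr ?normr0// pnatr_eq0 -lt0n.
Qed.

Lemma tendsLD Z Z' z z' : tendsL Z z -> tendsL Z' z' ->
  tendsL (fun c w => Z c w + Z' c w) (z + z').
Proof.
move=> T T' e e0; have e2 : 0 < e / 2 by rewrite divr_gt0.
have [N hN] := T _ e2; have [N' hN'] := T' _ e2; exists (maxn N N') => c.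
rewrite geq_max => /andP[Nc Nc']; rewrite [e]splitr.
apply: le_trans (lerD (hN c Nc) (hN' c Nc')); rewrite -ExD; apply: le_Ex => // w _.
by apply: le_trans (ler_normD _ _); rewrite mulrDl opprD addrACA.
Qed.

Lemma tendsLZ k Z z : tendsL Z z -> tendsL (fun c w => k * Z c w) (k * z).
Proof.
move=> T e e0; have k1 : 0 < `|k| + 1 by rewrite ltr_wpDl.
have [N hN] := T _ (divr_gt0 e0 k1); exists N => c Nc.
apply: (@le_trans _ _ ((`|k| + 1) * (e / (`|k| + 1)))); last first.
  by rewrite mulrC divfK// gt_eqF.
apply: le_trans (ler_wpM2l (ltW k1) (hN c Nc)); rewrite -ExZ; apply: le_Ex => // w _.
rewrite -mulrA -mulrBr normrM; apply: ler_wpM2r => //; by rewrite lerDl.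
Qed.

Lemma tendsLB Z Z' z z' : tendsL Z z -> tendsL Z' z' ->
  tendsL (fun c w => Z c w - Z' c w) (z - z').
Proof.
move=> T T'; rewrite -(mulN1r z'); apply: (@eq_tendsL (fun c w => Z c w + (-1) * Z' c w)).
  by move=> c w _; rewrite mulN1r.
by apply: tendsLD => //; apply: tendsLZ.
Qed.

Lemma tendsL_sum (I : eqType) (r : seq I) (P : pred I) (Z : I -> forall c : cfg, Om c -> R) (z : I -> R) :
  (forall i, P i -> tendsL (Z i) (z i)) ->
  tendsL (fun c w => \sum_(i <- r | P i) Z i c w) (\sum_(i <- r | P i) z i).
Proof.
move=> T; elim: r => [|i r IH].
  rewrite big_nil; apply: (eq_tendsL _ (tendsL_cst 0)) => c w _.
  by rewrite big_nil mul0r.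
rewrite big_cons; case: (boolP (P i)) => Pi.
  apply: (@eq_tendsL (fun c w => Z i c w + \sum_(i <- r | P i) Z i c w)).
    by move=> c w _; rewrite big_cons Pi.
  by apply: tendsLD => //; apply: T.
by apply: (eq_tendsL _ IH) => c w _; rewrite big_cons (negbTE Pi).
Qed.

Lemma tendsL_abs0 Z : tendsL Z 0 -> tendsL (fun c w => `|Z c w|) 0.
Proof.
move=> T e e0; have [N hN] := T e e0; exists N => c Nc; apply: le_trans (hN c Nc).
apply: le_Ex => // w _; rewrite !subr0 !normrM normr_id.
by rewrite normfV normr_nat.
Qed.

Lemma tendsL_perturb (I : finType) (P : pred I) Z Z' z (C : R)
    (cnt : I -> forall c : cfg, Om c -> R) :
  0 <= C -> tendsL Z z -> (forall k, P k -> tendsL (cnt k) 0) ->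
  (forall c del, 0 < del -> Ex (@prc _ _ _ eps c) (fun w => `|Z' c w - Z c w|) <=
     C * (cn c)%:R / del + del + 2 * \sum_(k | P k) Ex (@prc _ _ _ eps c) (fun w => `|cnt k c w|)) ->
  tendsL Z' z.
Proof.
move=> C0 T Tc h e e0.
have e4 : 0 < e / 4 by rewrite divr_gt0.
have e8 : 0 < e / 8 by rewrite divr_gt0.
have [N1 hN1] := T _ e4.
have [N2 hN2] := tendsL_sum (index_enum I) (fun k Pk => tendsL_abs0 (Tc k Pk)) e8.
(* With [del] equal to [e / 8] times [n], the second moment term is [8 * C / e]; divided by [n] it
   is at most [e / 8] once [n >= 64 * C / e ^ 2]. *)
pose N3 := (Num.bound (64 * C / e ^+ 2)).+1.
exists (maxn N1 (maxn N2 N3)) => c; rewrite !geq_max => /and3P[n1 n2 n3].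
have nb : 64 * C / e ^+ 2 <= (cn c)%:R.
  have c0 : 0 <= 64 * C / e ^+ 2.
    by apply: divr_ge0; [exact: mulr_ge0|exact: sqr_ge0].
  by apply/ltW/(lt_trans (archi_boundP c0)); rewrite ltr_nat.
have n0 : 0 < (cn c)%:R :> R by rewrite ltr0n; apply: leq_trans n3.
have := h c _ (mulr_gt0 e8 n0).
set S := \sum_(k | P k) _ => hc.
have S8 : S / (cn c)%:R <= e / 8.
  apply: le_trans (hN2 c n2); rewrite /S -Ex_sum mulrC -ExZ; apply: le_Ex => // w _.
  rewrite [X in _ - X]big1// subr0 ger0_norm; first by rewrite mulrC.
  by rewrite divr_ge0// sumr_ge0.
apply: (@le_trans _ _ (Ex (@prc _ _ _ eps c) (fun w => `|Z c w / (cn c)%:R - z|) +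
    Ex (@prc _ _ _ eps c) (fun w => `|Z' c w - Z c w|) / (cn c)%:R)).
  rewrite [X in _ + X]mulrC -ExZ -ExD; apply: le_Ex => // w _.
  rewrite (_ : Z' c w / _ - z = (Z c w / (cn c)%:R - z) + (Z' c w - Z c w) / (cn c)%:R).
    by apply: (le_trans (ler_normD _ _)); rewrite lerD2l normrM normfV normr_nat [leLHS]mulrC.
  by rewrite mulrBl; ring.
have -> : e = e / 4 + (e / 8 + e / 8 + 2 * (e / 8) + e / 4) by field.
apply: lerD; first exact: hN1.
apply: (@le_trans _ _ ((C * (cn c)%:R / (e / 8 * (cn c)%:R) + e / 8 * (cn c)%:R + 2 * S) / (cn c)%:R)).
  by rewrite ler_wpM2r ?invr_ge0 ?(ltW n0).
rewrite (_ : _ / (cn c)%:R = 8 * C / e / (cn c)%:R + e / 8 + 2 * (S / (cn c)%:R)); last first.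
  by field; rewrite !gt_eqF.
have : 8 * C / e / (cn c)%:R <= e / 8.
  rewrite ler_pdivrMr// -(ler_pM2l e8) .
  rewrite ler_pdivrMr ?exprn_gt0// in nb.
  rewrite (_ : e / 8 * (8 * C / e) = C); last by field; rewrite gt_eqF.
  rewrite (_ : e / 8 * _ = ((cn c)%:R * e ^+ 2) / 64); last by field.
  by rewrite ler_pdivlMr// mulrC.
lra.
Qed.

(** The asymptotic probability that the label of a variable-to-check message is at least [k]; for
    [k = 0] the condition is void. *)
Fixpoint xi (k : nat) : R := if k is k'.+1 then eps * lam.[1 - rho.[1 - xi k']] else 1.
Definition etad (k : nat) : R := 1 - rho.[1 - xi k].

Definition cstat j (psi : nat -> nat -> R) t (c : cfg) (w : Om c) : R :=
  stat (fun=> 1) j psi (pull w.1 (xm t w.1 w.2)).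
Definition vstat l (psi : nat -> nat -> R) t (c : cfg) (w : Om c) : R :=
  stat (fun v => (w.2 v)%:R) l psi (ym t w.1 w.2).

(** Asymptotically the labels around a check are independent with tails [xi]. In [HV] the labels
    around a variable are independent with tails [etad], and independent of its own erasure, which
    contributes [eps]. *)
Definition HC t := forall j psi, (forall i k, `|psi i k| <= 1) ->
  tendsL (cstat j psi t) (kap * Gam`_j * \prod_(i < j) mean xi t (psi i)).
Definition HV t := forall l psi, (forall i k, `|psi i k| <= 1) ->
  tendsL (vstat l psi t) (eps * Lam`_l * \prod_(i < l) mean etad t (psi i)).

Lemma prod_pick1 z t (A B : nat -> R) l (i : 'I_l) :
  \prod_(i' < l) mean z t (pick1 A B i i') = mean z t A * mean z t B ^+ l.-1.
Proof.
rewrite (bigD1 i)//= /pick1 eqxx; congr (_ * _).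
rewrite (eq_bigr (fun=> mean z t B)) => [|i' ii']; last by rewrite (inj_eq val_inj) (negbTE ii').
rewrite prodr_const; congr (_ ^+ _).
by rewrite cardC1 card_ord.
Qed.

Lemma sum_pick1 (P : {poly R}) (k : R) z t (A B : nat -> R) :
  \sum_(l < size P) \sum_(i < l) k * P`_l * \prod_(i' < l) mean z t (pick1 A B i i') =
  k * mean z t A * dp P (mean z t B).
Proof.
rewrite dpE mulr_sumr; apply: eq_bigr => l _.
under eq_bigr => i _ do rewrite prod_pick1.
by rewrite sumr_const card_ord -[_ *+ _]mulr_natr; ring.
Qed.

Lemma pick1_le1 (A B : nat -> R) i : (forall k, `|A k| <= 1) -> (forall k, `|B k| <= 1) ->
  forall i' k, `|pick1 A B i i' k| <= 1.
Proof. by move=> A1 B1 i' k; rewrite /pick1; case: ifP. Qed.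

Lemma HV_marked t A B : HV t -> (forall k, `|A k| <= 1) -> (forall k, `|B k| <= 1) ->
  tendsL (fun c w => \sum_(s : vsock (@cdv _ _ _ c)) (w.2 (tag s))%:R * (A (ym t w.1 w.2 s) *
    \prod_(s' : vsock (@cdv _ _ _ c) | (s' != s) && (tag s' == tag s)) B (ym t w.1 w.2 s')))
  (eps * mean etad t A * dp Lam (mean etad t B)).
Proof.
move=> hv A1 B1; rewrite -sum_pick1.
apply: (@eq_tendsL (fun c w => \sum_(l < size Lam) \sum_(i < l) vstat l (pick1 A B i) t w)).
  move=> c w _; rewrite /vstat.
  by rewrite -(@sum_marked_stat _ _ _ (size Lam)) // => v; apply: (deg_lt (cdvE c)).
apply: tendsL_sum => // l _; apply: tendsL_sum => // i _; apply: hv; exact: pick1_le1.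
Qed.

Lemma HC_marked t A B : HC t -> (forall k, `|A k| <= 1) -> (forall k, `|B k| <= 1) ->
  tendsL (fun c w => \sum_(r : csock (@cdc _ _ _ c)) (A (pull w.1 (xm t w.1 w.2) r) *
    \prod_(r' : csock (@cdc _ _ _ c) | (r' != r) && (tag r' == tag r)) B (pull w.1 (xm t w.1 w.2) r')))
  (kap * mean xi t A * dp Gam (mean xi t B)).
Proof.
move=> hc A1 B1; rewrite -sum_pick1.
apply: (@eq_tendsL (fun c w => \sum_(l < size Gam) \sum_(i < l) cstat l (pick1 A B i) t w)).
  move=> c w _; rewrite /cstat.
  rewrite -(@sum_marked_stat _ _ _ (size Gam)) => [|v]; last by apply: (deg_lt (cdcE c)).
  by apply: eq_bigr => r _; rewrite mul1r.
apply: tendsL_sum => // l _; apply: tendsL_sum => // i _; apply: hc; exact: pick1_le1.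
Qed.

Lemma xi0 : xi 0 = 1. Proof. by []. Qed.
Lemma xiS t : xi t.+1 = eps * lam.[etad t]. Proof. by []. Qed.
Lemma eta0 : etad 0 = 1.
Proof. by rewrite /etad xi0 subrr horner_coef0; case: dr => -> _; rewrite subr0. Qed.

Lemma HC0 : HC 0.
Proof.
move=> j psi psi1.
apply: (eq_tendsL _ (tendsL_cst _)) => c w _.
rewrite /cstat /stat [RHS](eq_bigr (fun=> \prod_(i < j) psi i 0%N)); last first.
  move=> a /eqP <-; rewrite mul1r big_node; apply: eq_bigr => i _ /=; congr (psi _ _).
  by rewrite /pull big1.
rewrite sumr_const -[RHS]mulr_natl.
have -> : #|(fun v : 'I_(cm c) => cdc (c := c) v == j)|%:R = (cn c)%:R * kap * Gam`_j.
  by rewrite -cmE -cdcE; congr (_%:R); apply: eq_card => a; rewrite !inE.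
have -> : \prod_(i < j) mean xi 0 (psi i) = \prod_(i < j) psi i 0%N.
  by apply: eq_bigr => i _; rewrite mean0 mul1r.
ring.
Qed.

Lemma Ex_prc_E (c : cfg) (h : {ffun 'I_(cn c) -> bool} -> R) :
  Ex (@prc _ _ _ eps c) (fun w => h w.2) = \sum_E pE eps E * h E.
Proof.
rewrite (Ex_pr eps (fun f E => h E)) sumr_const -[_ *+ _]mulr_natr mulfK//.
by rewrite pnatr_eq0 -lt0n graphs_gt0// card_vc.
Qed.

(** All labels are zero at the start, so this is the weak law for the erasure indicators, which are
    pairwise uncorrelated. *)
Lemma HV0 : HV 0.
Proof.
move=> l psi psi1; set k := \prod_(i < l) _.
have T : tendsL (fun c w => \sum_(v | @cdv _ _ _ c v == l) (w.2 v)%:R) (eps * Lam`_l).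
  (* No colour classes are involved, hence the empty index type. *)
  apply: (@tendsL_perturb void pred0 (fun c w => eps * Lam`_l * (cn c)%:R)
    _ _ 1 (fun _ _ _ => 0)) => //; first exact: tendsL_cst.
  move=> c del del0; rewrite big_pred0_eq mulr0 addr0 mul1r.
  pose X (E : {ffun 'I_(cn c) -> bool}) v : R := (E v)%:R - eps.
  rewrite (eq_Ex (Z' := fun w : Om c => `|\sum_(v | cdv (c := c) v == l) X w.2 v|)); last first.
    move=> w _; congr `|_|; rewrite /X sumrB; congr (_ - _).
    rewrite sumr_const -[RHS]mulr_natr -mulrA; congr (_ * _); rewrite mulrC -cdvE.
    by congr (_%:R); apply: eq_card => a; rewrite !inE.
  apply: (le_trans (Ex_abs_le_sq _ _ _ del0)) => //; rewrite lerD2r ler_wpM2r ?invr_ge0 ?(ltW del0)//.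
  rewrite (Ex_prc_E (fun E => (\sum_(v | cdv (c := c) v == l) X E v) ^+ 2)).
  have indep v v' : v != v' -> \sum_E pE eps E * (X E v * X E v') = 0.
    move=> vv'.
    pose g (i : 'I_(cn c)) (b : bool) : R := (if b then eps else 1 - eps) *
       (if (i == v) || (i == v') then b%:R - eps else 1).
    rewrite (eq_bigr (fun E : {ffun _ -> _} => \prod_i g i (E i))) => [|E _]; last first.
      rewrite /pE /g big_split /=; congr (_ * _).
      rewrite (bigD1 v)//= eqxx /=; congr (_ * _).
      rewrite (bigD1 v') 1?eq_sym//= eqxx orbT big1 ?mulr1// => i /andP[/negbTE -> /negbTE ->].
      by [].
    rewrite -(bigA_distr_bigA g) (bigD1 v)//= big_bool /g eqxx /=.
    by rewrite (_ : eps * (1 - eps) + (1 - eps) * (0 - eps) = 0) ?mul0r//; ring.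
  have sq v : \sum_E pE eps E * (X E v * X E v) <= 1.
    rewrite -(sum_pE eps (cn c)); apply: ler_sum => E _; rewrite ler_piMr ?pE_ge0//.
    by rewrite /X; case/andP: e01 => ? ?; case: (E v) => /=; nra.
  under eq_bigr => E _.
    rewrite expr2 mulr_suml mulr_sumr; under eq_bigr => v _ do rewrite mulr_sumr mulr_sumr.
    over.
  rewrite exchange_big /=.
  apply: (@le_trans _ _ (\sum_(v | cdv (c := c) v == l) 1)).
    apply: ler_sum => v vl; rewrite exchange_big /= (bigD1 v)//= [X in _ + X]big1 ?addr0 ?sq// => v' /andP[_ h].
    by rewrite indep// eq_sym.
  by rewrite sumr_const ler_nat -[leqRHS]card_ord max_card.
have := tendsLZ k T; rewrite mulrC; apply: eq_tendsL => c w _.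
rewrite /vstat /stat mulr_sumr; apply: eq_bigr => v /eqP vl; rewrite mulrC; congr (_ * _).
rewrite /k -vl big_node; apply: eq_bigr => i _ /=; rewrite mean0 eta0 mul1r; congr (psi _ _).
by apply/eqP; rewrite eq_sym -leqn0 ym_le.
Qed.


Hypothesis xi_gt0 : forall k, 0 < xi k.
Hypothesis eta_gt0 : forall k, 0 < etad k.
Hypothesis xi_dec : forall k, xi k.+1 <= xi k.
Hypothesis eta_dec : forall k, etad k.+1 <= etad k.

Lemma nat1_le1 (b : bool) : `|b%:R : R| <= 1.
Proof. by case: b; rewrite ?normr1 ?normr0. Qed.

Lemma prod_bool (I : finType) (P : pred I) (b : I -> bool) :
  \prod_(i | P i) (b i)%:R = [forall (i | P i), b i]%:R :> R.
Proof.
case: (boolP [forall (i | P i), b i]) => [/forallP h|/forallPn[i]].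
  by rewrite big1// => i Pi; have := h i; rewrite Pi => /= ->.
by rewrite negb_imply => /andP[Pi /negbTE bi]; rewrite (bigD1 i)//= bi mul0r.
Qed.

(** A message survives round [t.+1] exactly when its variable is erased and all other incoming
    labels equal [t]. The label [g] arriving on the edge itself is asymptotically independent of
    this, whence the product. *)
Lemma count_xS t (g : nat) : HV t ->
  tendsL (fun c w => \sum_(s : vsock (@cdv _ _ _ c))
     ((ym t w.1 w.2 s == g) && (xm t.+1 w.1 w.2 s == t.+1))%:R)
  (dp Lam 1 * mean etad t (fun k => (k == g)%:R) * xi t.+1).
Proof.
move=> hv; rewrite xiS.
have := HV_marked hv (A := fun k => (k == g)%:R) (B := fun k => (t <= k)%N%:R).
move=> /(_ (fun k => nat1_le1 _) (fun k => nat1_le1 _)).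
rewrite mean_ge// (dp_node_persp dl) (_ : eps * _ * _ = dp Lam 1 * mean etad t (fun k => (k == g)%:R) *
  (eps * lam.[etad t])); last by ring.
apply: eq_tendsL => c w _; apply: eq_bigr => s _; rewrite prod_bool -!natrM; congr (_%:R).
by rewrite [xm _ _ _ _ == _]eqn_leq xm_le xmS_gt//= !mulnb andbCA.
Qed.

Lemma count_x t (g : nat) : (g <= t)%N -> HV t ->
  tendsL (fun c w => \sum_(s : vsock (@cdv _ _ _ c))
     ((ym t w.1 w.2 s == g) && (xm t w.1 w.2 s == t))%:R)
  (dp Lam 1 * mean etad t (fun k => (k == g)%:R) * xi t).
Proof.
case: t => [|t] gt hv.
  move: gt; rewrite leqn0 => /eqP ->; rewrite mean0 eta0 eqxx !mulr1.
  apply: (eq_tendsL _ (tendsL_cst _)) => c w _.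
  rewrite mulrC -card_vsock -sum1_card natr_sum; apply: eq_bigr => s _.
  by have := ym_le 0 w.1 w.2 s; rewrite leqn0 => ->.
rewrite xiS.
have := HV_marked hv (A := fun k => (k == g)%:R) (B := fun k => (t <= k)%N%:R).
move=> /(_ (fun k => nat1_le1 _) (fun k => nat1_le1 _)).
rewrite mean_ge// (dp_node_persp dl) (_ : eps * _ * _ = dp Lam 1 * mean etad t.+1 (fun k => (k == g)%:R) *
  (eps * lam.[etad t])); last by ring.
apply: eq_tendsL => c w _; apply: eq_bigr => s _; rewrite prod_bool -!natrM; congr (_%:R).
rewrite [xm _ _ _ _ == _]eqn_leq xm_le xmS_gt//= !mulnb andbCA; congr [&& _, _ & _].
by apply: eq_forallb => s'; rewrite (ym_trunc _ _ _ (leqnn t)).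
Qed.

(** The complement has product form: for positive [k] a label is below [k] exactly when all other
    labels at the check are. The limit is a difference of two marked statistics. *)
Lemma count_y t (h k : nat) : (k <= t)%N -> HC t ->
  tendsL (fun c w => \sum_(s : vsock (@cdv _ _ _ c))
     ((xm t w.1 w.2 s == h) && (k <= ym t w.1 w.2 s)%N)%:R)
  (dp Lam 1 * mean xi t (fun i => (i == h)%:R) * etad k).
Proof.
move=> kt hc.
have h1 := HC_marked hc (A := fun i => (i == h)%:R) (B := fun=> 1)
  (fun k => nat1_le1 _) (fun k => nat1_le1 true).
have h2 := HC_marked hc (A := fun i => (i == h)%:R) (B := fun i => (i < k)%N%:R)
  (fun k => nat1_le1 _) (fun k => nat1_le1 _).
have := tendsLB h1 h2; rewrite mean_cst mean_lt// xi0 (dp_node_persp dr (1 - _)).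
rewrite (_ : _ - _ = dp Lam 1 * mean xi t (fun i => (i == h)%:R) * etad k); last first.
  by rewrite /etad -(kapG lam dr); ring.
apply: eq_tendsL => c w pw; have fb := pr_bij (card_vc dr c) pw; have fi := bij_inj fb.
rewrite -sumrB (reindex w.1); last exact: onW_bij.
apply: eq_bigr => s _; rewrite pullE// prod_bool big1 // mulr1.
set b := [forall (r' | (r' != w.1 s) && (tag r' == tag (w.1 s))), _]; rewrite (_ : (k <= ym t w.1 w.2 s)%N = ~~ b).
  by case: (xm t w.1 w.2 s == h); case: b; rewrite /= ?mulr1 ?mulr0 ?mul0r ?subrr ?subr0.
(* For [k = 0] the product over the other sockets must vanish, which holds because a check of degree
   at least two has another socket. *)
rewrite /b; case: k kt {h1 h2 b} => [_|k kt].
  apply/esym/forallPn.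
  have [r' h'] : exists r' : csock (@cdc _ _ _ c), (r' != w.1 s) && (tag r' == tag (w.1 s)).
    have : (1 < #|[set r : csock (@cdc _ _ _ c) | tag r == tag (w.1 s)]|)%N.
      by rewrite card_node cdc_ge2.
    rewrite (cardsD1 (w.1 s)) inE eqxx ltnS => /card_gt0P[r'].
    by rewrite !inE => h'; exists r'.
  by exists r'; rewrite h'.
rewrite ym_gt negb_forall; case: fb => g fK gK.
apply/existsP/existsP => [[s' /and3P[a b c']]|[r' ]].
  exists (w.1 s'); rewrite negb_imply (inj_eq fi) a b /= pullE//.
  by rewrite -leqNgt.
rewrite negb_imply => /andP[/andP[a b]]; rewrite -{1}(gK r') pullE// -leqNgt => c'.
exists (g r'); rewrite gK b c' andbT /=; rewrite andbT; by apply: contra_neq a => <-; rewrite gK.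
Qed.

Lemma inord_eq (t a b : nat) : (a <= t)%N -> (b <= t)%N -> (inord a == inord b :> 'I_t.+1) = (a == b).
Proof. by move=> h1 h2; rewrite -(inj_eq val_inj) /= !inordK. Qed.

(** The colour is the pair of labels in both directions after [t] rounds, which is what makes a swap
    respect the history; the mark is the label after one more round. *)
Lemma HCS t : HC t -> HV t -> HC t.+1.
Proof.
move=> hc hv j psi psi1.
pose q := xi t.+1 / xi t.
have q01 : 0 <= q <= 1.
  by rewrite divr_ge0 ?(ltW (xi_gt0 _))//= ler_pdivrMr// mul1r.
pose K := ('I_t.+1 * 'I_t.+1)%type.
pose X (c : cfg) (w : Om c) := pull w.1 (xm t w.1 w.2).
pose Y (c : cfg) (w : Om c) := pull w.1 (ym t w.1 w.2).
have pl (c : cfg) (w : Om c) Z r : (forall s, Z s <= t)%N -> (pull w.1 Z r <= t)%N.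
  by move=> Zt; apply/bigmax_leqP => s _.
have Xt c w r : (X c w r <= t)%N by apply: pl => s; apply: xm_le.
have Yt c w r : (Y c w r <= t)%N by apply: pl => s; apply: ym_le.
pose col (c : cfg) (w : Om c) r : K := (inord (X c w r), inord (Y c w r)).
have colE c w r r' : (col c w r == col c w r') = (X c w r == X c w r') && (Y c w r == Y c w r').
  by rewrite xpair_eqE !inord_eq.
pose tw (c : cfg) (r r' : csock (@cdc _ _ _ c)) (w : Om c) : Om c := (swapc r r' w.1, w.2).
pose cnt (k : K) (c : cfg) (w : Om c) : R := \sum_(r : csock (@cdc _ _ _ c))
   ((col c w r == k) && (pull w.1 (xm t.+1 w.1 w.2) r == t.+1))%:R -
   q * \sum_(r : csock (@cdc _ _ _ c)) (col c w r == k)%:R.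
rewrite (_ : \prod_(i < j) _ = \prod_(i < j) mean xi t (star q t (psi i))); last first.
  by apply: eq_bigr => i _; rewrite mean_star ?gt_eqF.
have st1 i k : `|star q t (psi i) k| <= 1 by exact: star_le1.
have Ts := hc j (fun i => star q t (psi i)) st1.
apply: (@tendsL_perturb (K : finType) (fun k => val k.1 == t) _ (cstat j psi t.+1) _
  ((4 + 8 * j%:R * #|{: K}|%:R) * kap) cnt _ Ts _ _).
- by rewrite mulr_ge0 ?(ltW (kap_gt0 dl dr))// addr_ge0// mulr_ge0// mulr_ge0.
- move=> k /eqP k1.
  have k2 : (val k.2 <= t)%N by rewrite -ltnS ltn_ord.
  have h1 := count_xS (val k.2) hv.
  have h2 := count_x k2 hv.
  have := tendsLB h1 (tendsLZ q h2).
  (* The surviving fraction of an open class tends to [xi t.+1 / xi t] whatever the label in the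
     opposite direction. *)
  rewrite (_ : _ - _ = 0); last by rewrite /q; field; rewrite gt_eqF.
  apply: eq_tendsL => c w pw; have fb := pr_bij (card_vc dr c) pw; have fi := bij_inj fb.
  have ck s : (col c w (w.1 s) == k) = (ym t w.1 w.2 s == val k.2) && (xm t w.1 w.2 s == t).
    rewrite -pair_eqE /= -!(inj_eq val_inj) /= k1 !inordK ?ltnS//.
    by rewrite /X /Y !pullE// andbC.
  rewrite /cnt; congr (_ - q * _).
    rewrite [RHS](reindex w.1); last exact: onW_bij.
    apply: eq_bigr => s _; rewrite ck pullE//; congr (_%:R); case: eqP => //= _.
    by case: eqP => [h|_]; rewrite ?andbF// andbT (xm_minn t) h (minn_idPr (leqnSn t)) eqxx.
  rewrite [RHS](reindex w.1); last exact: onW_bij.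
  by apply: eq_bigr => s _; rewrite ck.
move=> c del del0.
rewrite -[(4 + _) * kap * _]mulrA [kap * _]mulrC -cmE.
have swX r r' (w : Om c) : prc eps w != 0 -> col c w r = col c w r' ->
    [/\ xm t (swapc r r' w.1) w.2 =1 xm t w.1 w.2, ym t (swapc r r' w.1) w.2 =1 ym t w.1 w.2 &
     xm t.+1 (swapc r r' w.1) w.2 =1 xm t.+1 w.1 w.2].
  move=> pw /eqP; rewrite colE => /andP[]; have [g fK gK] := pr_bij (card_vc dr c) pw.
  have fi := can_inj fK.
  rewrite -(gK r) -(gK r') /X /Y !pullE// => /eqP hx /eqP hy; rewrite swapc_swapv//.
  by have [a b] := xy_swapv hx hy; split=> //; apply: xmS_swapv.
apply: (@Ex_stat_step R (Om c) (prc eps (c := c)) (pr0 (c := c)) (pr1 c) (cm c) (@cdc _ _ _ c)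
  K (col c) (fun w => pull w.1 (xm t.+1 w.1 w.2)) (@tw c) _ _ _ _ (fun _ _ => 1) _ _ j psi psi1
  (X c) (fun k => val k.1) t q _ _ _ _ q01 del del0).
- by move=> r r' [f E]; rewrite /tw /= swapcK.
- by move=> r r' w; apply: pr_swapc.
- move=> r r' w pw h u; have [a b _] := swX r r' w pw h.
  rewrite /col /X /Y /tw /= (eq_pull _ _ a) (eq_pull _ _ b) !pull_swapc.
  by case: tpermP => [->|->|//]; [exact: (esym h)|exact: h].
- move=> r r' w pw h u; have [_ _ a] := swX r r' w pw h.
  by rewrite /tw /= (eq_pull _ _ a) pull_swapc.
- by move=> w v; rewrite normr1.
- by [].
- by move=> w r _; rewrite /= inordK// ltnS.
- by move=> w r _; apply: Xt.
- move=> w r pw; have [g fK gK] := pr_bij (card_vc dr c) pw; have fi := can_inj fK.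
  rewrite -(gK r) /X !pullE// (xm_minn t); lia.
- move=> w r pw; have [g fK gK] := pr_bij (card_vc dr c) pw; have fi := can_inj fK.
  rewrite -(gK r) /X !pullE// (xm_minn t); have := xm_le t.+1 w.1 w.2 (g r); lia.
Qed.

(** The record now holds the variable messages of round [t.+1] and the check messages of round [t]:
    equality of these is what [ymS_swapv] requires. *)
Lemma HVS t : HC t.+1 -> HV t -> HV t.+1.
Proof.
move=> hc hv j psi psi1.
pose q := etad t.+1 / etad t.
have q01 : 0 <= q <= 1.
  by rewrite divr_ge0 ?(ltW (eta_gt0 _))//= ler_pdivrMr// mul1r.
pose K := ('I_t.+2 * 'I_t.+2)%type.
pose X (c : cfg) (w : Om c) := xm t.+1 w.1 w.2.
pose Y (c : cfg) (w : Om c) := ym t w.1 w.2.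
have Xt c w r : (X c w r <= t.+1)%N by apply: xm_le.
have Yt c w r : (Y c w r <= t.+1)%N by apply: leq_trans (ym_le _ _ _ _) (leqnSn _).
pose col (c : cfg) (w : Om c) r : K := (inord (Y c w r), inord (X c w r)).
have colE c w r r' : (col c w r == col c w r') = (Y c w r == Y c w r') && (X c w r == X c w r').
  by rewrite xpair_eqE !inord_eq.
pose tw (c : cfg) (r r' : vsock (@cdv _ _ _ c)) (w : Om c) : Om c := (swapv r r' w.1, w.2).
pose cnt (k : K) (c : cfg) (w : Om c) : R := \sum_(r : vsock (@cdv _ _ _ c))
   ((col c w r == k) && (ym t.+1 w.1 w.2 r == t.+1))%:R -
   q * \sum_(r : vsock (@cdv _ _ _ c)) (col c w r == k)%:R.
rewrite (_ : \prod_(i < j) _ = \prod_(i < j) mean etad t (star q t (psi i))); last first.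
  by apply: eq_bigr => i _; rewrite mean_star ?gt_eqF.
have st1 i k : `|star q t (psi i) k| <= 1 by exact: star_le1.
have Ts := hv j (fun i => star q t (psi i)) st1.
apply: (@tendsL_perturb (K : finType) (fun k => val k.1 == t) _ (vstat j psi t.+1) _
  (4 + 8 * j%:R * #|{: K}|%:R) cnt _ Ts _ _).
- by rewrite addr_ge0// mulr_ge0// mulr_ge0.
- move=> k /eqP k1.
  have h1 := count_y (val k.2) (leqnn t.+1) hc.
  have h2 := count_y (val k.2) (leqnSn t) hc.
  have := tendsLB h1 (tendsLZ q h2).
  rewrite (_ : _ - _ = 0); last by rewrite /q; field; rewrite gt_eqF.
  apply: eq_tendsL => c w pw.
  have ck s : (col c w s == k) = (xm t.+1 w.1 w.2 s == val k.2) && (ym t w.1 w.2 s == t).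
    by rewrite -pair_eqE /= -!(inj_eq val_inj) /= k1 !inordK ?ltnS// /X /Y andbC.
  have yt s : (t <= ym t.+1 w.1 w.2 s)%N = (ym t w.1 w.2 s == t).
    by rewrite -(ym_trunc _ _ _ (leqnn t)) eqn_leq ym_le.
  rewrite /cnt; congr (_ - q * _).
    apply: eq_bigr => s _; rewrite ck -yt; congr (_%:R); rewrite -andbA; congr (_ && _).
    by rewrite eqn_leq ym_le /=; case: (ltnP t) => h; rewrite ?andbF// andbT ltnW.
  by apply: eq_bigr => s _; rewrite ck yt.
move=> c del del0.
have h' r r' (w : Om c) : col c w r = col c w r' -> Y c w r = Y c w r' /\ X c w r = X c w r'.
  by move=> /eqP; rewrite colE => /andP[/eqP ? /eqP ?].
have hx' r r' (w : Om c) : X c w r = X c w r' -> xm t w.1 w.2 r = xm t w.1 w.2 r'.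
  by move=> h; rewrite !(xm_minn t) -/(X c w r) h.
apply: (@Ex_stat_step R (Om c) (prc eps (c := c)) (pr0 (c := c)) (pr1 c) (cn c) (@cdv _ _ _ c)
  K (col c) (fun w => ym t.+1 w.1 w.2) (@tw c) _ _ _ _ (fun w v => (w.2 v)%:R) _ _ j psi psi1
  (Y c) (fun k => val k.1) t q _ _ _ _ q01 del del0).
- by move=> r r' [f E]; rewrite /tw /= swapvK.
- by move=> r r' w; apply: pr_swapv.
- move=> r r' w pw /h'[hy hx] u; have hx1 := hx' _ _ _ hx.
  rewrite /col /X /Y /tw /=.
  have -> := (xy_swapv hx1 hy).2 u; by have /= -> := xmS_swapv hx1 hy u.
- by move=> r r' w pw /h'[hy hx] u; apply: ymS_swapv.
- by move=> w v; apply: nat1_le1.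
- by [].
- by move=> w r _; rewrite /= inordK// ltnS.
- by move=> w r _; apply: ym_le.
- move=> w r pw; rewrite /Y (ym_minn t); lia.
- move=> w r pw; rewrite /Y (ym_minn t); have := ym_le t.+1 w.1 w.2 r; lia.
Qed.

Lemma HCV t : HC t /\ HV t.
Proof.
elim: t => [|t [hc hv]]; first by split; [exact: HC0|exact: HV0].
have hcS := HCS hc hv; by split=> //; apply: HVS.
Qed.

End Convergence.

(** * The conditional entropy as an expected dimension *)

Section Entropy.
Variables (R : realType) (eps : R) (n m : nat) (dv : 'I_n -> nat) (dc : 'I_m -> nat).
Implicit Types (f : {ffun vsock dv -> csock dc}) (c : {ffun 'I_n -> bool}) (E : {ffun 'I_n -> bool}).

Definition xorf c c' : {ffun 'I_n -> bool} := [ffun i => c i (+) c' i].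

Lemma xorfK c : involutive (xorf c).
Proof. by move=> c'; apply/ffunP => i; rewrite !ffunE addbA addbb. Qed.

Lemma in_codeE f c : in_code f c =
  [forall a, ~~ \big[addb/false]_(s : vsock dv | tag (f s) == a) c (tag s)].
Proof.
apply: eq_forallb => a; congr (~~ _); rewrite (big_morph odd oddD (erefl _)).
by apply: eq_bigr => s _; case: (c _).
Qed.

Lemma in_code_xor f c c' : in_code f c -> in_code f (xorf c c') = in_code f c'.
Proof.
rewrite !in_codeE => /forallP h; apply: eq_forallb => a.
rewrite (eq_bigr (fun s : vsock dv => c (tag s) (+) c' (tag s))) => [|s _]; last by rewrite ffunE.
by rewrite big_split /= (negbTE (h a)).
Qed.

Definition ecode f E : {set {ffun 'I_n -> bool}} := [set c in Defs.code f | [forall i, c i ==> E i]].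

Lemma ecode0 f E : [ffun=> false] \in ecode f E.
Proof.
rewrite !inE in_codeE; apply/andP; split; apply/forallP => a; rewrite ?ffunE//.
by rewrite big1// => s _; rewrite ffunE.
Qed.

Lemma ecode_gt0 f E : (0 < #|ecode f E|)%N.
Proof. by apply/card_gt0P; exists [ffun=> false]; rewrite ecode0. Qed.

Lemma code_gt0 f : (0 < #|Defs.code f|)%N.
Proof.
by apply/card_gt0P; exists [ffun=> false]; have := ecode0 f [ffun=> false]; rewrite !inE => /andP[].
Qed.

Let mk c E : {ffun 'I_n -> option bool} := [ffun i => if E i then None else Some (c i)].
Let er (y : {ffun 'I_n -> option bool}) : {ffun 'I_n -> bool} := [ffun i => y i == None].

Let er_mk c E : er (mk c E) = E.
Proof. by apply/ffunP => i; rewrite !ffunE; case: (E i). Qed.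

Let bec_mk c c' E : \prod_i bec eps (c' i) (mk c E i) =
  if [forall i, xorf c c' i ==> E i] then pE eps E else 0.
Proof.
case: (boolP [forall i, xorf c c' i ==> E i]) => [/forallP h|/forallPn[i]].
  apply: eq_bigr => i _; have := h i; rewrite !ffunE; case: (E i) => //=.
  by rewrite implybF => /negbTE; case: (c i); case: (c' i).
rewrite negb_imply !ffunE => /andP[h /negbTE Ei]; rewrite (bigD1 i)//= ffunE Ei /=.
by rewrite (_ : (c i == c' i) = false) ?mul0r//; case: (c i) h; case: (c' i).
Qed.

Let bec0 c y : y != mk c (er y) -> \prod_i bec eps (c i) (y i) = 0.
Proof.
move=> h; have [i yi] : exists i, y i != mk c (er y) i.
  by apply/existsP; apply: contraR h => /existsPn h; apply/eqP/ffunP => i; apply/eqP/negPn.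
rewrite (bigD1 i)//=; move: yi; rewrite !ffunE; case: (y i) => [b|]//=.
by rewrite (inj_eq Some_inj) => /negbTE ->; rewrite mul0r.
Qed.

(** Pairs of positive probability are parametrised by a codeword and an erasure pattern. Given the
    output, the codeword is uniform on a coset of the code words supported on the erasures. *)
Lemma condH_ecode f : condH eps f = \sum_E pE eps E * log2 #|ecode f E|%:R.
Proof.
have cd0 : #|Defs.code f|%:R != 0 :> R by rewrite pnatr_eq0 -lt0n code_gt0.
have pXYmk c c' E : c \in Defs.code f -> pXY eps f c' (mk c E) =
    if xorf c c' \in ecode f E then #|Defs.code f|%:R^-1 * pE eps E else 0.
  rewrite /pXY bec_mk !inE => h; rewrite in_code_xor//; case: ifP => /=; last by rewrite mul0r.
  by case: ifP; rewrite ?mulr0.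
have pYmk c E : c \in Defs.code f -> pY eps f (mk c E) = #|ecode f E|%:R * (#|Defs.code f|%:R^-1 * pE eps E).
  move=> h; rewrite /pY; under eq_bigr => c' _ do rewrite pXYmk//.
  rewrite (reindex_inj (inv_inj (xorfK c))) /= -big_mkcond /=.
  rewrite (eq_bigl (mem (ecode f E))) => [|c']; last by rewrite xorfK.
  by rewrite sumr_const -[_ *+ _]mulr_natl.
have pXYE c E : c \in Defs.code f -> pXY eps f c (mk c E) = #|Defs.code f|%:R^-1 * pE eps E.
  move=> h; rewrite pXYmk// (_ : xorf c c = [ffun=> false]) ?ecode0//.
  by apply/ffunP => i; rewrite !ffunE addbb.
rewrite /condH (bigID (mem (Defs.code f))) /= [X in _ + X]big1 ?addr0; last first.
  by move=> c h; apply: big1 => y _; rewrite /pXY (negbTE h) mul0r eqxx.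
rewrite -sumrN (eq_bigr (fun=> #|Defs.code f|%:R^-1 * \sum_E pE eps E * log2 #|ecode f E|%:R)).
  by rewrite sumr_const -[_ *+ _]mulr_natl mulrA divff// mul1r.
move=> c h; rewrite (bigID (fun y => y == mk c (er y))) /= [X in _ + X]big1 ?addr0; last first.
  by move=> y /bec0 b0; rewrite /pXY b0 mulr0 eqxx.
rewrite (reindex_onto (mk c) er) => [|y /eqP <- //].
rewrite (eq_bigl predT) => [|E]; last by rewrite er_mk !eqxx.
rewrite -sumrN mulr_sumr; apply: eq_bigr => E _; rewrite pXYE// pYmk// mulf_eq0 invr_eq0 (negbTE cd0) /=.
have [->|pE0] := eqVneq (pE eps E) 0; first by rewrite mul0r mulr0 oppr0.
rewrite -invf_div mulfK ?mulf_neq0 ?invr_eq0//.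
rewrite /log2 lnV ?posrE ?ltr0n ?ecode_gt0//; ring.
Qed.

Lemma EcondH_Ex : EcondH dv dc eps = Ex (pr eps (dv := dv) (dc := dc)) (fun w => log2 #|ecode w.1 w.2|%:R).
Proof.
rewrite (Ex_pr eps (fun f E => log2 #|ecode f E|%:R)) /EcondH; congr (_ / _).
by apply: eq_bigr => f _; rewrite condH_ecode.
Qed.

End Entropy.

(** * The residual graph *)

Section Residual.
Variables (n m : nat) (dv : 'I_n -> nat) (dc : 'I_m -> nat).
Implicit Types (f : {ffun vsock dv -> csock dc}) (c : {ffun 'I_n -> bool}) (E : {ffun 'I_n -> bool}).
Implicit Types (s : vsock dv) (r : csock dc) (D : {set csock dc}).

(** The variables not resolved by message passing. *)
Definition Uset (t : nat) f E : {set 'I_n} :=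
  [set v | E v && [forall (s : vsock dv | tag s == v), ym t f E s == t]].

Definition sub_set c (U : {set 'I_n}) : bool := [forall i, c i ==> (i \in U)].

Definition tops (t : nat) f E (a : 'I_m) : {set csock dc} :=
  [set r | (tag r == a) && (pull f (xm t f E) r == t)].

(** A check with a single unresolved incoming edge resolves it, hence the threshold two. *)
Definition R2set (t : nat) f E : {set 'I_m} := [set a | (1 < #|tops t f E a|)%N].

Lemma Uset_xm t f E s : tag s \in Uset t f E -> xm t f E s = t /\ ym t f E s = t.
Proof.
rewrite inE => /andP[Es /forallP h].
have y s' : tag s' == tag s -> ym t f E s' = t by move=> e; apply/eqP; have := h s'; rewrite e.
split; last exact: y.
have : (t < xm t.+1 f E s)%N.
  rewrite xmS_gt// Es /=; apply/forallP => s'; apply/implyP => /andP[_ e].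
  by rewrite y.
by move=> lt; rewrite (xm_minn t); lia.
Qed.

Lemma Uset_R2 t f E s : injective f -> tag s \in Uset t.+1 f E -> tag (f s) \in R2set t.+1 f E.
Proof.
move=> fi sU; have [xs ys] := Uset_xm sU.
have : (t < ym t.+1 f E s)%N by rewrite ys.
rewrite ym_gt => /existsP[s' /and3P[ss' e lt]].
have xs' : xm t.+1 f E s' = t.+1 by have := xm_le t.+1 f E s'; lia.
rewrite inE (cardsD1 (f s)) (cardsD1 (f s')) !inE e !eqxx !pullE// xs xs' eqxx /=.
by rewrite (inj_eq fi) ss'.
Qed.

Lemma card_sub_set (U : {set 'I_n}) : #|[set c : {ffun 'I_n -> bool} | sub_set c U]| = (2 ^ #|U|)%N.
Proof.
pose g (A : {set 'I_n}) : {ffun 'I_n -> bool} := [ffun i => i \in A].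
rewrite -card_powerset -(card_imset (powerset U) (f := g)); last first.
  by move=> A B /ffunP h; apply/setP => i; have := h i; rewrite !ffunE.
apply: eq_card => c; rewrite inE; apply/forallP/imsetP => [h|[A]].
  exists [set i | c i]; last by apply/ffunP => i; rewrite ffunE inE.
  by rewrite inE; apply/fintype.subsetP => i; rewrite inE => ci; have := h i; rewrite ci.
by rewrite inE => /fintype.subsetP h -> i; rewrite ffunE; apply/implyP/h.
Qed.

Definition synd f c : {set 'I_m} :=
  [set a | \big[addb/false]_(s : vsock dv | tag (f s) == a) c (tag s)].

(** Vectors supported on the unresolved variables have syndromes supported on [R2set], and adding
    one element of a fibre of the syndrome carries the fibre into [ecode f E]. With at least one
    round, an unresolved edge has a second unresolved edge at its check. *)
Lemma card_ecode_ge t f E : injective f ->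
  (2 ^ #|Uset t.+1 f E| <= #|ecode f E| * 2 ^ #|R2set t.+1 f E|)%N.
Proof.
move=> fi; set U := Uset t.+1 f E; set R2 := R2set t.+1 f E.
pose CU := [set c : {ffun 'I_n -> bool} | sub_set c U].
have sR c : c \in CU -> synd f c \in powerset R2.
  rewrite !inE => /forallP cU; apply/fintype.subsetP => a; rewrite inE => h.
  apply/negPn/negP => aR; move: h; rewrite big1// => s /eqP sa.
  apply/negP => cs; have := cU (tag s); rewrite cs => /(Uset_R2 fi); rewrite sa.
  exact/negP.
have fib (D : {set 'I_m}) : (#|[set c in CU | synd f c == D]| <= #|ecode f E|)%N.
  have [->|[c0]] := set_0Vmem [set c in CU | synd f c == D]; first by rewrite cards0.
  rewrite inE => /andP[c0U /eqP sD].
  rewrite -(card_imset _ (inv_inj (xorfK c0))); apply/subset_leq_card/fintype.subsetP => _ /imsetP[c + ->].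
  rewrite !inE => /andP[/forallP cU /eqP e]; apply/andP; split; last first.
    apply/forallP => i; rewrite !ffunE; apply/implyP => h.
    suff : i \in U by rewrite inE => /andP[].
    move: c0U; rewrite inE => /forallP /(_ i) u0; have u1 := cU i.
    by case: (c0 i) h u0 u1; case: (c i).
  rewrite in_codeE; apply/forallP => a.
  rewrite (eq_bigr (fun s : vsock dv => c0 (tag s) (+) c (tag s))) => [|s _]; last by rewrite ffunE.
  rewrite big_split /=; move/setP: sD => /(_ a); move/setP: e => /(_ a); rewrite !inE => -> ->.
  by rewrite addbb.
rewrite -card_sub_set -/CU -card_powerset mulnC -sum1_card.
rewrite (partition_big (synd f) (fun D : {set 'I_m} => D \in powerset R2)) //= -sum_nat_const; apply: leq_sum => D _.
apply: leq_trans (fib D); rewrite sum1_card; apply/eq_leq/eq_card => c.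
by rewrite [in RHS]inE.
Qed.

(** The support of a codeword is a stopping set: a check that meets it does so along at least two
    edges, so no message on these edges is ever resolved. *)
Lemma ecode_top f E c s : c \in ecode f E -> c (tag s) ->
  forall t, xm t f E s = t /\ ym t f E s = t.
Proof.
rewrite !inE in_codeE => /andP[/forallP par /forallP cE].
have parity s1 : c (tag s1) -> exists s2, [&& s2 != s1, tag (f s2) == tag (f s1) & c (tag s2)].
  move=> c1; apply/existsP; have := par (tag (f s1)); apply: contraR => /existsPn h.
  rewrite (bigD1 s1)//= c1 big1// => s2 /andP[e ne]; have := h s2.
  by rewrite ne e /=; apply: negbTE.
move=> cs t; elim: t => [|t IH] in s cs *; last first.
  have x1 s1 : c (tag s1) -> xm t.+1 f E s1 = t.+1.
    move=> c1; have : (t < xm t.+1 f E s1)%N.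
      have := cE (tag s1); rewrite c1 => /= E1; rewrite xmS_gt// E1 /=.
      apply/forallP => s2; apply/implyP => /andP[_ /eqP e].
      by have [|_ ->] := IH s2; rewrite ?e.
    by have := xm_le t.+1 f E s1; lia.
  split; first exact: x1.
  have [s2 /and3P[a b c2]] := parity s cs.
  have : (t < ym t.+1 f E s)%N.
    by rewrite ym_gt; apply/existsP; exists s2; rewrite a b x1 /=.
  by have := ym_le t.+1 f E s; lia.
by split; apply/eqP; rewrite -leqn0 ?xm_le ?ym_le.
Qed.

Lemma ecode_sub_Uset t f E c : c \in ecode f E -> sub_set c (Uset t f E).
Proof.
move=> cE; apply/forallP => i; apply/implyP => ci; rewrite inE.
have := cE; rewrite !inE => /andP[_ /forallP/(_ i)]; rewrite ci => /= ->.
by apply/forallP => s; apply/implyP => /eqP si; have [|_ ->] := @ecode_top f E c s cE _ t; rewrite ?si.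
Qed.

(** The class of edges whose messages were erasures throughout in both directions, seen from the
    checks. Codewords of [ecode] use edges of this class only. *)
Definition Kset (t : nat) f E : {set csock dc} :=
  [set r | (pull f (xm t f E) r == t) && (pull f (ym t f E) r == t)].
Definition Wset c : {set vsock dv} := [set s | c (tag s)].
Definition evn D : bool := [forall a : 'I_m, ~~ odd #|[set r in D | tag r == a]|].
Definition ncheck (K : {set csock dc}) (w : nat) : nat :=
  #|[set D : {set csock dc} | [&& D \subset K, #|D| == w & evn D]]|.

Lemma code_evn f c : injective f -> (c \in Defs.code f) = evn (f @: Wset c).
Proof.
move=> fi; rewrite inE; apply: eq_forallb => a; congr (~~ odd _).
rewrite (eq_bigr (fun s : vsock dv => if c (tag s) then 1%N else 0%N)) => [|s _]; last by case: (c _).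
rewrite -big_mkcondr /= sum1_card -(card_imset _ fi); apply: eq_card => r.
rewrite inE; apply/imsetP/andP => [[s + ->]|[/imsetP[s + ->] e]].
  rewrite unfold_in => /andP[-> cs]; split=> //; apply/imsetP; exists s => //; by rewrite inE.
by rewrite inE => cs; exists s => //; rewrite unfold_in e.
Qed.

Lemma ecode_Kset t f E c : injective f -> c \in ecode f E -> f @: Wset c \subset Kset t f E.
Proof.
move=> fi cE; apply/fintype.subsetP => _ /imsetP[s + ->]; rewrite !inE => cs.
by rewrite !pullE//; have [-> ->] := ecode_top cE cs t; rewrite eqxx.
Qed.

Lemma Kset_swap t f E r r' : bijective f -> r \in Kset t f E -> r' \in Kset t f E ->
  Kset t (swapc r r' f) E = Kset t f E /\ Uset t (swapc r r' f) E = Uset t f E.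
Proof.
move=> [g fK gK] rK r'K; have fi := can_inj fK.
have [X Y] : xm t (swapc r r' f) E =1 xm t f E /\ ym t (swapc r r' f) E =1 ym t f E.
  move: rK r'K; rewrite -(gK r) -(gK r') !inE !pullE// swapc_swapv//.
  move=> /andP[/eqP x1 /eqP y1] /andP[/eqP x2 /eqP y2].
  by apply: xy_swapv; rewrite ?x1 ?x2 ?y1 ?y2.
split; apply/setP => u; rewrite !inE.
  rewrite (eq_pull _ _ X) (eq_pull _ _ Y) !pull_swapc.
  by case: tpermP => [->|->|//]; move: rK r'K; rewrite !inE => -> ->.
by congr (_ && _); apply: eq_forallb => s; rewrite Y.
Qed.

Lemma imset_swapc r r' f (W : {set vsock dv}) : swapc r r' f @: W = tperm r r' @: (f @: W).
Proof. by rewrite -imset_comp; apply: eq_imset => s; rewrite /= ffunE. Qed.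

End Residual.

(** Transpositions inside [K] connect any two of its subsets of equal size: exchanging an element of
    [D :\: D'] with one of [D' :\: D] reduces the difference. *)
Lemma tperm_inv_card (T : finType) (X : Type) (K : {set T}) (Q : {set T} -> X) :
  (forall r r' (D : {set T}), r \in K -> r' \in K -> Q (tperm r r' @: D) = Q D) ->
  forall D D' : {set T}, D \subset K -> D' \subset K -> #|D| = #|D'| -> Q D = Q D'.
Proof.
move=> inv D D'; have [k] := ubnP #|D :\: D'|; elim: k D => // k IH D; rewrite ltnS => Dk DK D'K eD.
have e2 : #|D' :\: D| = #|D :\: D'|.
  by have := cardsID D' D; have := cardsID D D'; rewrite finset.setIC eD => <- /eqP; rewrite eqn_add2l => /eqP.
have [/eqP D0|[r]] := set_0Vmem (D :\: D').
  rewrite finset.setD_eq0 in D0; congr Q; apply/eqP; by rewrite eqEcard D0 eD leqnn.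
rewrite inE => /andP[rD' rD].
have [r' ] : exists r', r' \in D' :\: D.
  by apply/card_gt0P; rewrite e2; apply/card_gt0P; exists r; rewrite inE rD' rD.
rewrite inE => /andP[r'D r'D'].
have rK := fintype.subsetP DK _ rD; have r'K := fintype.subsetP D'K _ r'D'.
rewrite -(inv r r' D)//.
have cD : #|tperm r r' @: D| = #|D| by rewrite card_imset//; apply: perm_inj.
apply: IH; rewrite ?cD//.
  apply: leq_trans Dk; apply: proper_card; apply/properP; split.
    apply/fintype.subsetP => u; rewrite !inE => /andP[uD' /imsetP[z zD ez]].
    move: ez uD'; case: tpermP => [zr ->|zr' _|_ _ ->]; rewrite ?r'D' ?zD ?andbT//.
    by move: zD; rewrite zr' (negbTE r'D).
  exists r; first by rewrite inE rD' rD.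
  rewrite inE rD' /=; apply/imsetP => -[z zD]; case: tpermP => [zr e|zr' _|/eqP zr _ e].
  - by move: rD'; rewrite e r'D'.
  - by move: zD; rewrite zr' (negbTE r'D).
  - by rewrite e eqxx in zr.
apply/fintype.subsetP => u /imsetP[z zD ->]; case: tpermP => [_|_|_ _].
- by [].
- by [].
- exact: (fintype.subsetP DK).
Qed.

(** * The first moment over the uniform residual matching *)

Section FirstMoment.
Variables (R : realType) (n m : nat) (dv : 'I_n -> nat) (dc : 'I_m -> nat).
Hypothesis card_eq : #|{: vsock dv}| = #|{: csock dc}|.
Variables (t : nat) (E : {ffun 'I_n -> bool}).
Implicit Types (f : {ffun vsock dv -> csock dc}) (c : {ffun 'I_n -> bool}).
Implicit Types (K D : {set csock dc}) (U : {set 'I_n}).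

(** The expected number of codewords if the edges of a word of weight [w] occupy a uniform
    [w]-subset of [K], which has to be even at every check. For [w] above [#|K|] the quotient is
    zero. *)
Definition Nbound U K : R := \sum_(c : {ffun 'I_n -> bool} | sub_set c U)
  (ncheck K #|Wset dv c|)%:R / 'C(#|K|, #|Wset dv c|)%:R.

Lemma ncheck_le K w : (ncheck K w <= 'C(#|K|, w))%N.
Proof.
rewrite -cards_draws; apply/subset_leq_card/fintype.subsetP => D; rewrite !inE.
by case/and3P => -> ->.
Qed.

Lemma Nbound_le U K : Nbound U K <= 2 ^+ #|U|.
Proof.
rewrite /Nbound -natrX -card_sub_set -[in leRHS]sum1_card natr_sum [leLHS]big_mkcond [leRHS]big_mkcond /=.
apply: ler_sum => c _; rewrite inE; case: ifP => // _.
have [->|h] := eqVneq 'C(#|K|, #|Wset dv c|)%:R (0 : R); first by rewrite invr0 mulr0.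
by rewrite ler_pdivrMr ?lt_def ?h//= mul1r ler_nat ncheck_le.
Qed.

Lemma Nbound_ge1 U K : 1 <= Nbound U K.
Proof.
have z0 : sub_set ([ffun=> false] : {ffun 'I_n -> bool}) U by apply/forallP => i; rewrite ffunE.
rewrite /Nbound (bigD1 [ffun=> false])//=.
have -> : Wset dv [ffun=> false] = finset.set0 by apply/setP => s; rewrite !inE ffunE.
rewrite cards0 bin0 divr1 -[leLHS]addr0; apply: lerD; last by apply: sumr_ge0 => c _; rewrite divr_ge0.
rewrite ler1n; apply/card_gt0P; exists finset.set0; rewrite inE finset.sub0set cards0 eqxx /=.
by apply/forallP => a; rewrite (_ : [set r in finset.set0 | _] = finset.set0) ?cards0//; apply/setP => r; rewrite !inE.
Qed.

(** An arbitrary weight [g] depending on [Uset] and [Kset] replaces conditioning on them. Swaps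
    inside [K] preserve both sets, so the total weight [Q D] of the matchings that send [W] to [D]
    depends on the size of [D] alone. *)
Lemma sum_code_le (g : {set 'I_n} -> {set csock dc} -> R) c : (forall U K, 0 <= g U K) ->
  \sum_(f in graphs dv dc) (c \in ecode f E)%:R * g (Uset t f E) (Kset t f E) <=
  \sum_(f in graphs dv dc) (if sub_set c (Uset t f E) then
     (ncheck (Kset t f E) #|Wset dv c|)%:R / 'C(#|Kset t f E|, #|Wset dv c|)%:R else 0) *
     g (Uset t f E) (Kset t f E).
Proof.
move=> g0; set W := Wset dv c.
rewrite (partition_big (fun f => Kset t f E) predT) //= [leRHS](partition_big (fun f => Kset t f E) predT) //=.
apply: ler_sum => K _.
pose P f := [&& f \in graphs dv dc, Kset t f E == K & sub_set c (Uset t f E)].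
pose Q D : R := \sum_(f | P f && (f @: W == D)) g (Uset t f E) K.
pose T : R := \sum_(f | P f) g (Uset t f E) K.
have ginj f : f \in graphs dv dc -> injective f by rewrite inE => /injectiveP.
have -> : \sum_(f | (f \in graphs dv dc) && (Kset t f E == K))
   (if sub_set c (Uset t f E) then
     (ncheck (Kset t f E) #|W|)%:R / 'C(#|Kset t f E|, #|W|)%:R else 0) * g (Uset t f E) (Kset t f E) =
   (ncheck K #|W|)%:R / 'C(#|K|, #|W|)%:R * T.
  rewrite /T mulr_sumr [RHS]big_mkcond /= [LHS]big_mkcond /=; apply: eq_bigr => f _.
  rewrite /P; case: (f \in _) => //=; case: eqP => //= ->; by case: ifP; rewrite ?mul0r.
have invQ r r' D : r \in K -> r' \in K -> Q (tperm r r' @: D) = Q D.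
  move=> rK r'K; rewrite /Q (reindex_inj (inv_inj (swapcK (dv := dv) r r'))) /=.
  have PK f : P f -> Kset t (swapc r r' f) E = Kset t f E /\ Uset t (swapc r r' f) E = Uset t f E.
    move=> /and3P[/ginj fi /eqP fK _]; apply: Kset_swap; rewrite ?fK//.
    exact: bij_sock card_eq _ fi.
  have Pimp f : P f -> P (swapc r r' f).
    move=> Pf; have [a b] := PK f Pf; rewrite /P a b inE inj_swapc.
    by move: Pf => /and3P[]; rewrite inE => -> -> ->.
  have Pe f : P (swapc r r' f) = P f.
    by apply/idP/idP => [/Pimp|/Pimp//]; rewrite swapcK.
  apply: eq_big => [f|f /andP[]].
    by rewrite Pe imset_swapc (inj_eq (imset_inj perm_inj)).
  by rewrite Pe => /PK[_ ->].
pose good D := [&& D \subset K, #|D| == #|W| & evn D].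
apply: (@le_trans _ _ (\sum_(D | good D) Q D)).
  have -> : \sum_(D | good D) Q D = \sum_(f | P f && good (f @: W)) g (Uset t f E) K.
    rewrite [RHS](partition_big (fun f => f @: W) good) /= => [|f /andP[]//].
    apply: eq_bigr => D gD; apply: eq_bigl => f; rewrite -andbA; congr (_ && _).
    by case: eqP => [->|]; rewrite ?andbF// andbT gD.
  rewrite [leLHS]big_mkcond [leRHS]big_mkcond /=; apply: ler_sum => f _.
  case: (boolP (f \in _)) => [fg|_]; last by rewrite /P /=; case: ifP => // _; exact: g0.
  case: eqP => [fK|_] /=; last by case: ifP => // _; exact: g0.
  case: (boolP (c \in ecode f E)) => [cE|_]; last by rewrite mul0r; case: ifP => // _; exact: g0.
  have fi := ginj _ fg; rewrite mul1r fK.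
  have -> : P f by rewrite /P fg fK eqxx ecode_sub_Uset.
  have -> // : good (f @: W).
  rewrite /good -{1}fK ecode_Kset// card_imset// eqxx /= -code_evn//.
  by move: cE; rewrite inE => /andP[].
have QT D : D \subset K -> #|D| = #|W| -> 'C(#|K|, #|W|)%:R * Q D <= T.
  move=> DK Dw; rewrite -cards_draws mulr_natl -sumr_const.
  rewrite (eq_bigr Q) => [|D' /[!inE] /andP[D'K /eqP D'w]]; last first.
    by apply: (tperm_inv_card invQ) => //; rewrite Dw D'w.
  rewrite /T (bigID (fun f => (f @: W \subset K) && (#|f @: W| == #|W|))) /= -[leLHS]addr0.
  apply: lerD; last by apply: sumr_ge0 => f _; exact: g0.
  rewrite [leRHS](partition_big (fun f => f @: W) (fun D => (D \subset K) && (#|D| == #|W|))) /=;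
    last by move=> f /andP[].
  rewrite le_eqVlt; apply/orP; left; apply/eqP; apply: eq_big => [D'|D']; first by rewrite inE.
  rewrite inE => gD; apply: eq_bigl => f; rewrite -andbA; congr (_ && _).
  by case: eqP => [->|]; rewrite ?andbF// andbT gD.
have T0 : 0 <= T by apply: sumr_ge0 => f _; exact: g0.
have [h|h] := posnP 'C(#|K|, #|W|).
  rewrite big_pred0 => [|D]; first by rewrite mulr_ge0// divr_ge0.
  apply/negP => gD; have := ncheck_le K #|W|; rewrite h leqn0 => /eqP/cards0_eq/setP/(_ D).
  by rewrite !inE -/(good D) gD.
rewrite mulrAC ler_pdivlMr ?ltr0n// mulrC mulr_sumr.
apply: (@le_trans _ _ (\sum_(D | good D) T)).
  by apply: ler_sum => D /and3P[DK /eqP Dw _]; apply: QT.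
rewrite sumr_const -[_ *+ _]mulr_natl ler_wpM2r// ler_nat.
by apply/eq_leq/eq_card => D; rewrite inE.
Qed.

(** Jensen's inequality in the form [ln z <= z - 1], with [z] the ratio of the number of codewords
    to [Nbound]; the weight [1 / Nbound] keeps the mean of this ratio at most one. *)
Lemma sum_log_code_le :
  \sum_(f in graphs dv dc) log2 #|ecode f E|%:R <=
  \sum_(f in graphs dv dc) log2 (Nbound (Uset t f E) (Kset t f E)).
Proof.
have ln2 : 0 < ln 2 :> R by rewrite ln_gt0// ltr1n.
pose g U K : R := (Nbound U K)^-1.
have N0 U K : 0 < Nbound U K by apply: lt_le_trans (Nbound_ge1 _ _).
have g0 U K : 0 <= g U K by rewrite invr_ge0 ltW.
have key : \sum_(f in graphs dv dc) #|ecode f E|%:R * g (Uset t f E) (Kset t f E) <=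
   \sum_(f in graphs dv dc) 1.
  have e1 f : #|ecode f E|%:R * g (Uset t f E) (Kset t f E) =
     \sum_c (c \in ecode f E)%:R * g (Uset t f E) (Kset t f E).
    rewrite -mulr_suml; congr (_ * _); rewrite -sum1_card natr_sum big_mkcond /=.
    by apply: eq_bigr => c _; case: ifP.
  under eq_bigr => f _ do rewrite e1.
  rewrite exchange_big /=; apply: (le_trans (ler_sum _ (fun c _ => sum_code_le c g0))).
  rewrite exchange_big /= le_eqVlt; apply/orP; left; apply/eqP; apply: eq_bigr => f _.
  by rewrite -mulr_suml -big_mkcond /= -/(Nbound _ _) mulfV// gt_eqF.
rewrite -subr_ge0 -sumrB.
apply: (@le_trans _ _ ((\sum_(f in graphs dv dc) 1 -
   \sum_(f in graphs dv dc) #|ecode f E|%:R * g (Uset t f E) (Kset t f E)) / ln 2)).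
  by rewrite divr_ge0 ?(ltW ln2)// subr_ge0.
rewrite -sumrB mulr_suml; apply: ler_sum => f _.
rewrite /log2 -mulrBl ler_wpM2r ?invr_ge0 ?(ltW ln2)//.
set a := #|ecode f E|%:R; set b := Nbound _ _.
have a0 : 0 < a by rewrite ltr0n ecode_gt0.
have b0 : 0 < b by apply: N0.
rewrite /g -/b lerBrDr -lerBrDl.
have -> : ln a = ln (a / b) + ln b by rewrite -lnM ?posrE ?divr_gt0// divfK// gt_eqF.
have ab0 : 0 < a / b by rewrite divr_gt0.
have h : -1 < a / b - 1 by lra.
have := le_ln1Dx h; rewrite (_ : 1 + (a / b - 1) = a / b); last by ring.
lra.
Qed.

End FirstMoment.

(** * Generating functions of the residual ensemble *)

(* [w] is the mode of the binomial distribution with parameters [K] and [w / K]. *)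
Lemma bin_mode (K w : nat) : (w <= K)%N ->
  (K ^ K <= K.+1 * ('C(K, w) * w ^ w * (K - w) ^ (K - w)))%N.
Proof.
move=> wK; pose T j := ('C(K, j) * w ^ j * (K - w) ^ (K - j))%N.
have rat j : (j < K)%N -> (T j.+1 * (j.+1 * (K - w)) = T j * ((K - j) * w))%N.
  move=> jK; rewrite /T (_ : (K - j = (K - j.+1).+1)%N); last by lia.
  rewrite !expnS; have := mul_bin_left K j; rewrite (_ : (K - j = (K - j.+1).+1)%N); last by lia.
  move=> e; transitivity ((j.+1 * 'C(K, j.+1)) * (w * w ^ j * (K - w) ^ (K - j.+1) * (K - w)))%N; first by ring.
  by rewrite e; ring.
have up j : (j < w)%N -> (T j <= T j.+1)%N.
  move=> jw; have jK : (j < K)%N by lia.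
  have := rat j jK; have h : (j.+1 * (K - w) <= (K - j) * w)%N by nia.
  have p : (0 < (K - j) * w)%N by rewrite muln_gt0; lia.
  move=> e; rewrite -(leq_pmul2r p) -e leq_mul2l h orbT//.
have dn j : (w <= j)%N -> (j < K)%N -> (T j.+1 <= T j)%N.
  move=> wj jK; have h : ((K - j) * w <= j.+1 * (K - w))%N by nia.
  have p : (0 < j.+1 * (K - w))%N by rewrite muln_gt0; lia.
  by rewrite -(leq_pmul2r p) rat// leq_mul2l h orbT.
have mx j : (j <= K)%N -> (T j <= T w)%N.
  move=> jK; have [jw|wj] := leqP j w.
    rewrite -(subKn jw); elim: (w - j)%N (leq_subr j w) => [|k IH] kw; first by rewrite subn0.
    apply: leq_trans (IH (ltnW kw)); rewrite (_ : (w - k = (w - k.+1).+1)%N); last by lia.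
    by apply: up; lia.
  have down k : (w + k <= K)%N -> (T (w + k) <= T w)%N.
    elim: k => [|k IH] h; first by rewrite addn0.
    by rewrite addnS; apply: leq_trans (IH _); [apply: dn; lia|lia].
  by rewrite -(subnKC (ltnW wj)) down// subnKC// ltnW.
have -> : (K ^ K = (K - w + w) ^ K)%N by rewrite subnK.
rewrite expnDn -[X in (_ <= X * _)%N]card_ord -sum_nat_const; apply: leq_sum => j _.
apply: leq_trans (mx j _); last by rewrite -ltnS.
by apply/eq_leq; rewrite /T; ring.
Qed.

Lemma sum_subset_pow (R : comNzRingType) (T : finType) (S : {set T}) (z : R) :
  \sum_(A : {set T} | A \subset S) z ^+ #|A| = (1 + z) ^+ #|S|.
Proof.
rewrite exprDn (partition_big (fun A : {set T} => inord #|A| : 'I_#|S|.+1) predT) //=.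
apply: eq_bigr => k _; rewrite expr1n mul1r.
rewrite (eq_bigl (mem [set A : {set T} | (A \subset S) && (#|A| == k)])).
  rewrite (eq_bigr (fun=> z ^+ k)) => [|A /[!inE] /andP[_ /eqP ->]//].
  by rewrite sumr_const cards_draws.
move=> A; rewrite !inE; case: (boolP (A \subset S)) => //= AS.
by rewrite -(inj_eq val_inj) /= inordK// ltnS subset_leq_card.
Qed.

Definition Bev (R : realType) (r : nat) (v : R) : R := ((1 + v) ^+ r + (1 - v) ^+ r) / 2.

Lemma sum_even_pow (R : realType) (T : finType) (S : {set T}) (z : R) :
  \sum_(A : {set T} | (A \subset S) && ~~ odd #|A|) z ^+ #|A| = Bev #|S| z.
Proof.
rewrite /Bev -!sum_subset_pow -big_split /= mulr_suml [LHS]big_mkcondr /=.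
apply: eq_bigr => A _; rewrite exprNn -signr_odd; case: (odd #|A|) => /=; last by field.
by rewrite expr1 mulN1r subrr mul0r.
Qed.

Section GeneratingFunctions.
Variables (R : realType) (n m : nat) (dv : 'I_n -> nat) (dc : 'I_m -> nat).
Variables (U : {set 'I_n}) (K : {set csock dc}).
Implicit Types (c : {ffun 'I_n -> bool}) (D : {set csock dc}).
Let S := csock dc.

Definition kdeg (a : 'I_m) : nat := #|[set r in K | tag r == a]|.

Definition nvar (w : nat) : nat := #|[set c | sub_set c U && (#|Wset dv c| == w)]|.

Lemma card_Wset c : #|Wset dv c| = (\sum_(i | c i) dv i)%N.
Proof.
rewrite -sum1_card (partition_big (fun s : vsock dv => tag s) (fun i => c i)) /=; last first.
  by move=> s; rewrite inE.
apply: eq_bigr => i ci; rewrite -[RHS](card_node dv) -sum1_card; apply: eq_bigl => s.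
by rewrite !inE; case: eqP => [->|]; rewrite ?ci ?andbF.
Qed.

(** One term of a generating function with nonnegative coefficients is at most its value. *)
Lemma nvar_le (u : R) w : 0 <= u -> (nvar w)%:R * u ^+ w <= \prod_(i in U) (1 + u ^+ dv i).
Proof.
move=> u0.
pose F (i : 'I_n) (b : bool) : R := if b then (i \in U)%:R * u ^+ dv i else 1.
have F0 i b : 0 <= F i b by rewrite /F; case: b => //; rewrite mulr_ge0 ?exprn_ge0.
have -> : \prod_(i in U) (1 + u ^+ dv i) = \sum_(c : {ffun 'I_n -> bool}) \prod_i F i (c i).
  rewrite -(bigA_distr_bigA F) [LHS]big_mkcond /=; apply: eq_bigr => i _.
  by rewrite big_bool /F /=; case: (i \in U); rewrite ?mul1r ?mul0r; [exact: addrC|rewrite add0r].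
rewrite (bigID (fun c => sub_set c U && (#|Wset dv c| == w))) /= -[leLHS]addr0.
apply: lerD; last by apply: sumr_ge0 => c _; apply: prodr_ge0.
rewrite mulr_natl -sumr_const /nvar [leRHS](eq_bigl (mem [set c | sub_set c U && (#|Wset dv c| == w)])); last first.
  by move=> c; rewrite !inE.
apply: ler_sum => c; rewrite inE => /andP[/forallP cU /eqP <-].
rewrite card_Wset expr_sum big_mkcond /=; apply: ler_prod => i _.
rewrite /F; case: ifP => ci; last by rewrite ler01 lexx.
by have := cU i; rewrite ci => /= ->; rewrite mul1r exprn_ge0/=.
Qed.

Lemma ncheck_gf_le (v : R) w : 0 <= v -> (ncheck K w)%:R * v ^+ w <= \prod_a Bev (kdeg a) v.
Proof.
move=> v0.
pose G (a : 'I_m) (A : {set S}) := (A \subset [set r in K | tag r == a]) && ~~ odd #|A|.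
pose F (a : 'I_m) (A : {set S}) : R := if G a A then v ^+ #|A| else 0.
have -> : \prod_a Bev (kdeg a) v = \sum_(h : {ffun 'I_m -> {set S}}) \prod_a F a (h a).
  by rewrite -(bigA_distr_bigA F); apply: eq_bigr => a _; rewrite -sum_even_pow [LHS]big_mkcond.
pose H D : {ffun 'I_m -> {set S}} := [ffun a => [set r in D | tag r == a]].
have Hi : injective H.
  move=> D D' /ffunP h; apply/setP => r; have := h (tag r); rewrite !ffunE => /setP/(_ r).
  by rewrite !inE eqxx !andbT.
have F0 a A : 0 <= F a A by rewrite /F; case: ifP => // _; rewrite exprn_ge0.
pose X := [set D : {set S} | [&& D \subset K, #|D| == w & evn D]].
rewrite (bigID (fun h => h \in H @: X)) /= -[leLHS]addr0.
apply: lerD; last by apply: sumr_ge0 => h _; apply: prodr_ge0.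
rewrite big_imset /=; last by move=> D D' _ _; apply: Hi.
rewrite mulr_natl -sumr_const; apply: ler_sum => D; rewrite inE => /and3P[DK /eqP <- /forallP ev].
have -> : #|D| = (\sum_a #|[set r in D | tag r == a]|)%N.
  rewrite -sum1_card (partition_big (fun r : S => tag r) predT) //=; apply: eq_bigr => a _.
  by rewrite -sum1_card; apply: eq_bigl => r; rewrite !inE.
rewrite expr_sum; apply: ler_prod => a _; rewrite exprn_ge0//= /F /G ffunE ev andbT ifT//.
apply/fintype.subsetP => r; rewrite !inE => /andP[rD ->]; by rewrite (fintype.subsetP DK).
Qed.

Hypothesis dv1 : forall i, (0 < dv i)%N.
Hypothesis UK : (\sum_(i in U) dv i <= #|K|)%N.

(** As degrees are positive, a word using all of [K] must contain every variable of [U]. This weight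
    corresponds to infinite [u] and escapes the generating function bound. *)
Lemma nvar_top : (nvar #|K| <= 1)%N.
Proof.
apply/card_le1_eqP => c c'; rewrite !inE => /andP[/forallP cU /eqP cw] /andP[/forallP c'U /eqP c'w].
suff full (b : {ffun 'I_n -> bool}) : (forall i, b i ==> (i \in U)) -> #|Wset dv b| = #|K| ->
    forall i, b i = (i \in U).
  by apply/ffunP => i; rewrite !full.
move=> bU bw i; apply/idP/idP => [bi|iU]; first by have := bU i; rewrite bi.
apply/negPn/negP => bi; move: UK; rewrite -bw card_Wset.
rewrite (bigD1 i)//= leqNgt => /negP; apply.
rewrite -[ltnLHS]add0n -addSn; apply: leq_add; first exact: dv1.
rewrite [leqLHS]big_mkcond [leqRHS]big_mkcond /=; apply: leq_sum => j _.
case: ifP => // bj; have := bU j; rewrite bj => /= ->.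
by rewrite (_ : j != i)//; apply: contraTneq bj => ->.
Qed.

(** For each weight the parameters are tuned so that [u v / (1 + u v) = w / #|K|]; the binomial
    coefficient is then the modal one and costs one factor [#|K|.+1]. The other factor counts the
    weights. *)
Lemma Nbound_gf (X : R) : 1 <= X ->
  (forall w, (w < #|K|)%N -> exists u v : R,
    [/\ 0 <= u, 0 <= v, u * v * (#|K| - w)%:R = w%:R &
     (\prod_(i in U) (1 + u ^+ dv i)) * (\prod_a Bev (kdeg a) v) / (1 + u * v) ^+ #|K| <= X]) ->
  Nbound R dv U K <= (#|K|.+1 ^ 2)%:R * X.
Proof.
move=> X1 hw; set k := #|K|.
have Wle c : sub_set c U -> (#|Wset dv c| < k.+1)%N.
  move=> /forallP cU; rewrite ltnS; apply: leq_trans UK; rewrite card_Wset.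
  rewrite [leqLHS]big_mkcond [leqRHS]big_mkcond /=; apply: leq_sum => j _.
  by case: ifP => // cj; have := cU j; rewrite cj => /= ->.
have -> : Nbound R dv U K = \sum_(w < k.+1) (nvar w)%:R * (ncheck K w)%:R / 'C(k, w)%:R.
  rewrite /Nbound (partition_big (fun c => inord #|Wset dv c| : 'I_k.+1) predT) //=.
  apply: eq_bigr => w _; rewrite -mulrA mulr_natl -sumr_const.
  apply: eq_big => [c|c /andP[cU /eqP e]].
    rewrite inE; case: (boolP (sub_set c U)) => //= cU.
    by rewrite -(inj_eq val_inj) /= inordK ?Wle.
  by rewrite (_ : #|Wset dv c| = w)// -e inordK ?Wle.
have kX : 0 <= k%:R * X by rewrite mulr_ge0// (le_trans _ X1).
have X0 : 0 < X by apply: lt_le_trans X1.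
apply: (@le_trans _ _ (\sum_(w < k.+1) k.+1%:R * X)); last first.
  by rewrite sumr_const card_ord -[_ *+ _]mulr_natl mulrA -natrM.
apply: ler_sum => -[w wk] _ /=.
have C0 : (0 < 'C(k, w))%N by rewrite bin_gt0.
rewrite ler_pdivrMr ?ltr0n//.
have [kw|wk'] := leqP k w.
  have -> : w = k by apply/eqP; rewrite eqn_leq kw -ltnS wk.
  rewrite binn mulr1; apply: (@le_trans _ _ 1).
    by rewrite -natrM lern1 -[X in (_ <= X)%N]muln1 leq_mul ?nvar_top// (leq_trans (ncheck_le _ _))// binn.
  by rewrite mulr_ege1// ler1n.
have [u [v [u0 v0 uv hX]]] := hw w wk'.
have kw0 : 0 < (k - w)%:R :> R by rewrite ltr0n subn_gt0.
have th : u * v = w%:R / (k - w)%:R by rewrite -uv mulfK// gt_eqF.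
have th1 : 1 + u * v = k%:R / (k - w)%:R.
  have -> : k%:R = (k - w)%:R + w%:R :> R by rewrite -natrD subnK// ltnW.
  by rewrite th mulrDl divff// gt_eqF.
have md : (1 + u * v) ^+ k <= k.+1%:R * 'C(k, w)%:R * (u * v) ^+ w.
  rewrite th1 th !expr_div_n ler_pdivrMr ?exprn_gt0//.
  have -> : k.+1%:R * 'C(k, w)%:R * (w%:R ^+ w / (k - w)%:R ^+ w) * (k - w)%:R ^+ k =
     k.+1%:R * ('C(k, w)%:R * w%:R ^+ w * (k - w)%:R ^+ (k - w)) :> R.
    have -> : (k - w)%:R ^+ k = (k - w)%:R ^+ (k - w) * (k - w)%:R ^+ w :> R.
      by rewrite -exprD subnK// ltnW.
    by field; rewrite expf_neq0// gt_eqF.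
  by rewrite -!natrX -!natrM ler_nat bin_mode// ltnW.
have p0 : 0 < (1 + u * v) ^+ k by rewrite exprn_gt0// ltr_wpDr// mulr_ge0.
have uv0 : 0 < (u * v) ^+ w.
  have [->|w0] := posnP w; first by rewrite expr0.
  by rewrite exprn_gt0// th divr_gt0// ltr0n.
rewrite -(ler_pM2r uv0).
apply: (@le_trans _ _ (X * (1 + u * v) ^+ k)).
  rewrite -ler_pdivrMr//; apply: le_trans hX; rewrite ler_wpM2r ?invr_ge0 ?(ltW p0)//.
  rewrite exprMn mulrACA; apply: ler_pM; rewrite ?mulr_ge0 ?exprn_ge0//.
    exact: nvar_le.
  exact: ncheck_gf_le.
rewrite -mulrA -mulrA [X in _ <= X]mulrC -!mulrA; apply: ler_wpM2l; first exact: ltW.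
by apply: (le_trans md); rewrite le_eqVlt; apply/orP; left; apply/eqP; ring.
Qed.

End GeneratingFunctions.

(** * The function Psi *)

Section Log2.
Variable R : realType.
Implicit Types a b : R.

Lemma ln2_gt0 : 0 < ln 2 :> R. Proof. by rewrite ln_gt0// ltr1n. Qed.

Lemma log2M a b : 0 < a -> 0 < b -> log2 (a * b) = log2 a + log2 b.
Proof. by move=> a0 b0; rewrite /log2 lnM ?posrE// mulrDl. Qed.

Lemma log2V a : 0 < a -> log2 a^-1 = - log2 a.
Proof. by move=> a0; rewrite /log2 lnV ?posrE// mulNr. Qed.

Lemma log2D a b : 0 < a -> 0 < b -> log2 (a / b) = log2 a - log2 b.
Proof. by move=> a0 b0; rewrite log2M ?invr_gt0// log2V. Qed.

Lemma log2X a k : 0 < a -> log2 (a ^+ k) = k%:R * log2 a.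
Proof. by move=> a0; rewrite /log2 lnXn// -[ln a *+ k]mulr_natl mulrA. Qed.

Lemma log2_2 : log2 2 = 1 :> R.
Proof. by rewrite /log2 divff// gt_eqF// ln2_gt0. Qed.

Lemma log2_1 : log2 1 = 0 :> R.
Proof. by rewrite /log2 ln1 mul0r. Qed.

Lemma ler_log2 a b : 0 < a -> a <= b -> log2 a <= log2 b.
Proof.
move=> a0 ab; rewrite /log2 ler_wpM2r ?invr_ge0 ?(ltW ln2_gt0)// ler_ln ?posrE//.
exact: lt_le_trans ab.
Qed.

Lemma log2_ge0 a : 1 <= a -> 0 <= log2 a.
Proof. by move=> a1; apply: divr_ge0; [exact: ln_ge0|exact: ltW ln2_gt0]. Qed.

Lemma log2_prod (I : finType) (P : pred I) (F : I -> R) : (forall i, P i -> 0 < F i) ->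
  log2 (\prod_(i | P i) F i) = \sum_(i | P i) log2 (F i).
Proof.
move=> F0; suff [] : 0 < \prod_(i | P i) F i /\
  log2 (\prod_(i | P i) F i) = \sum_(i | P i) log2 (F i) by [].
elim: (index_enum I) => [|i r [y0 IH]]; first by rewrite !big_nil log2_1.
rewrite !big_cons; case: ifP => // Pi.
by rewrite mulr_gt0 ?F0// log2M ?F0// IH.
Qed.

End Log2.

Section Psi.
Variables (R : realType) (Lam Gam : {poly R}) (D : nat).
Hypothesis LamD : (size Lam <= D)%N.
Hypothesis GamD : (size Gam <= D)%N.
Hypothesis Lam0 : forall l, 0 <= Lam`_l.
Hypothesis Lam2 : forall l, (l < 2)%N -> Lam`_l = 0.
Hypothesis Gam2 : forall r, (r < 2)%N -> Gam`_r = 0.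
Hypothesis L1_gt0 : 0 < dp Lam 1.
Hypothesis G1_gt0 : 0 < dp Gam 1.

Let L1 := dp Lam 1.
Let ga r := L1 / dp Gam 1 * Gam`_r.
Let ll l := l%:R * Lam`_l / L1.

Lemma sum_wide (p : {poly R}) (F : nat -> R -> R) : (size p <= D)%N -> (forall l, F l 0 = 0) ->
  \sum_(l < size p) F l p`_l = \sum_(l < D) F l p`_l.
Proof.
move=> pD F0; rewrite -!(big_mkord xpredT (fun l => F l p`_l)) (big_cat_nat _ pD)//= [X in _ + X]big1_seq ?addr0//.
by move=> l /andP[_]; rewrite mem_index_iota => /andP[h _]; rewrite nth_default.
Qed.

Lemma dp1_wide (p : {poly R}) : (size p <= D)%N -> dp p 1 = \sum_(l < D) l%:R * p`_l.
Proof.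
move=> pD; rewrite dpE -(sum_wide (F := fun l a => l%:R * a))// => [|l]; last by rewrite mulr0.
by apply: eq_bigr => l _; rewrite expr1n mulr1 mulrC.
Qed.

Lemma sum_rga : \sum_(r < D) r%:R * ga r = L1.
Proof.
under eq_bigr => r _ do rewrite mulrCA.
by rewrite -mulr_sumr -dp1_wide// divfK// gt_eqF.
Qed.

Lemma ll_ge0 l : 0 <= ll l.
Proof. by rewrite divr_ge0 ?mulr_ge0// ltW. Qed.

Lemma sum_ll : \sum_(l < D) ll l = 1.
Proof. by rewrite -mulr_suml -dp1_wide// divff// gt_eqF. Qed.

Lemma ll0 : ll 0 = 0. Proof. by rewrite /ll !mul0r. Qed.

(** If a variable of degree [l] is set to one with odds [u ^ l], a random edge ends in a zero with
    probability [pu u] and in a one with probability [qu u]. *)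
Definition pu (u : R) : R := \sum_(l < D) ll l / (1 + u ^+ l).
Definition qu (u : R) : R := \sum_(l < D) ll l * (u ^+ l / (1 + u ^+ l)).
Definition vu (u : R) : R := (pu u)^-1 * \sum_(l < D) ll l * u ^+ l.-1 / (1 + u ^+ l).

Let X1 (u : R) l : 0 <= u -> 0 < 1 + u ^+ l.
Proof. by move=> u0; rewrite ltr_wpDr ?exprn_ge0. Qed.

Lemma puqu u : 0 <= u -> pu u + qu u = 1.
Proof.
move=> u0; rewrite -sum_ll -big_split /=; apply: eq_bigr => l _.
by field; rewrite gt_eqF ?X1.
Qed.

Lemma pu_gt0 u : 0 <= u -> 0 < pu u.
Proof.
move=> u0; have p0 : 0 <= pu u by apply: sumr_ge0 => l _; rewrite divr_ge0 ?ll_ge0 ?(ltW (X1 _ _)).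
rewrite lt_neqAle eq_sym p0 andbT; apply/eqP => /psumr_eq0P h.
have : \sum_(l < D) ll l = 0.
  apply: big1 => l _; have := h (fun i _ => divr_ge0 (ll_ge0 i) (ltW (X1 i u0))) l isT.
  by move=> /eqP; rewrite mulf_eq0 invr_eq0 (gt_eqF (X1 _ u0)) orbF => /eqP.
by rewrite sum_ll => /eqP; rewrite oner_eq0.
Qed.

(** The point of the choice of [v(u)]: it makes [u v / (1 + u v)] equal to [qu u], so tuning to the
    weight [w] means solving [qu u = w / #|K|]. *)
Lemma u_vu u : 0 <= u -> u * vu u = qu u / pu u.
Proof.
move=> u0; rewrite /vu mulrCA mulrC; congr (_ / _); rewrite mulr_sumr; apply: eq_bigr => -[[|l] lD] _ /=.
  by rewrite ll0 !mul0r mulr0.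
by rewrite exprS; ring.
Qed.

Lemma u_vu1 u : 0 <= u -> 1 + u * vu u = (pu u)^-1.
Proof.
move=> u0; rewrite u_vu// -[X in X + _](@divff _ (pu u)) ?gt_eqF ?pu_gt0// -mulrDl puqu//.
by rewrite mul1r.
Qed.

Lemma vu_ge0 u : 0 <= u -> 0 <= vu u.
Proof.
move=> u0; rewrite mulr_ge0 ?invr_ge0 ?(ltW (pu_gt0 u0))// sumr_ge0// => l _.
apply: divr_ge0; last exact: ltW (X1 _ u0).
by apply: mulr_ge0; [exact: ll_ge0|exact: exprn_ge0].
Qed.

Lemma uv1_gt0 u : 0 <= u -> 0 < 1 + u * vu u.
Proof. by move=> u0; rewrite u_vu1// invr_gt0 pu_gt0. Qed.

Lemma vu_le1 u : 0 <= u <= 1 -> vu u <= 1.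
Proof.
move=> /andP[u0 u1]; rewrite /vu mulrC ler_pdivrMr ?pu_gt0// mul1r; apply: ler_sum => l _.
by rewrite ler_wpM2r ?invr_ge0 ?(ltW (X1 _ _))// ler_piMr ?ll_ge0// exprn_ile1.
Qed.

Lemma vu_ge1 u : 1 <= u -> 1 <= vu u.
Proof.
move=> u1; have u0 : 0 <= u by apply: le_trans u1.
rewrite /vu mulrC ler_pdivlMr ?pu_gt0// mul1r; apply: ler_sum => l _.
by rewrite ler_wpM2r ?invr_ge0 ?(ltW (X1 _ _))// ler_peMr ?ll_ge0// exprn_ege1.
Qed.

Lemma qu_continuous (u : R) : 0 <= u -> {for u, continuous qu}.
Proof.
move=> u0; rewrite /qu; elim: (index_enum _) => [|i r IH].
  rewrite (_ : (fun x : R => _) = fun=> 0); first exact: cvg_cst.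
  by apply/funext => x; rewrite big_nil.
rewrite (_ : (fun x : R => _) = fun x => ll i * (x ^+ i * (1 + x ^+ i)^-1) +
   \sum_(l <- r) ll l * (x ^+ l / (1 + x ^+ l))); last by apply/funext => x; rewrite big_cons.
apply: cvgD => //; apply: cvgM; first exact: cvg_cst.
apply: cvgM; first exact: exprn_continuous.
apply: cvgV; first by rewrite gt_eqF ?X1.
by apply: cvgD; [exact: cvg_cst|exact: exprn_continuous].
Qed.

Lemma qu_surj (y : R) : 0 <= y < 1 -> exists2 u, 0 <= u & qu u = y.
Proof.
(* As [u0 >= 1] and edges have positive degree, [qu u0 >= u0 / (1 + u0) = 1 / (2 - y)], which is at
   least [y]. *)
move=> /andP[y0 y1]; pose u0 := (1 - y)^-1.
have y1' : 0 < 1 - y by rewrite subr_gt0.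
have u01 : 1 <= u0 by rewrite invf_ge1// lerBlDr lerDl.
have u0p : 0 < u0 by rewrite invr_gt0.
have q0 : qu 0 = 0.
  rewrite /qu big1// => -[[|l] lD] _ /=; first by rewrite ll0 mul0r.
  by rewrite expr0n mul0r mulr0.
have q1 : y <= qu u0.
  apply: (@le_trans _ _ (u0 / (1 + u0))).
    rewrite ler_pdivlMr ?addr_gt0// /u0.
    by rewrite mulrDr mulr1 -lerBrDr -{1}[(1 - y)^-1]mul1r -mulrBl divff ?gt_eqF// ltW.
  rewrite -[leLHS]mul1r -[X in X * _ <= _]sum_ll mulr_suml; apply: ler_sum => -[[|l] lD] _ /=.
    by rewrite ll0 !mul0r.
  apply: ler_wpM2l; first exact: ll_ge0.
  have mono (z w : R) : 0 < z -> z <= w -> z / (1 + z) <= w / (1 + w).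
    move=> z0 zw; have w0 := lt_le_trans z0 zw.
    rewrite ler_pdivrMr ?addr_gt0// mulrAC ler_pdivlMr ?addr_gt0//; nra.
  by apply: mono => //; rewrite exprS ler_peMr ?(ltW u0p)// exprn_ege1.
have [||u] := @IVT R qu 0 u0 y (ltW u0p).
- apply: continuous_in_subspaceT => x; rewrite inE /= in_itv /= => /andP[x0 _].
  exact: qu_continuous.
- by rewrite q0 ge_min y0 le_max q1 orbT.
by rewrite in_itv /= => /andP[? _] <-; exists u.
Qed.

Lemma Bev_gt0 r (v : R) : 0 <= v -> 0 < Bev r v.
Proof.
move=> v0; rewrite /Bev divr_gt0//; case: r => [|r]; first by rewrite !expr0.
have [->|vn] := eqVneq v 0; first by rewrite addr0 subr0 expr1n.
have vp : 0 < v by rewrite lt_def vn.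
have : `|(1 - v) ^+ r.+1| < (1 + v) ^+ r.+1.
  rewrite normrX ltrXn2r//=.
  by rewrite ltr_norml; apply/andP; split; lra.
by rewrite ltr_norml => /andP[]; lra.
Qed.

Lemma Bev_le r (v : R) : 0 <= v -> Bev r v <= (1 + v) ^+ r.
Proof.
move=> v0; rewrite /Bev ler_pdivrMr// mulr_natr mulr2n lerD2l.
apply: (le_trans (ler_norm _)); rewrite normrX lerXn2r ?nnegrE ?addr_ge0//.
by rewrite ler_norml; apply/andP; split; lra.
Qed.

(** The terms [log2 (1 + u ^ l)] are unbounded in [u]. Moving [l * log2 (mu u)] from the variables
    to the checks leaves both sides bounded above uniformly in [u], and keeps the total in the ideal
    ensemble, where both sides have equally many edges. *)
Definition mu (u : R) : R := Num.max 1 u.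
Definition gl (u : R) (l : nat) : R := log2 (1 + u ^+ l) - l%:R * log2 (mu u).
Definition gr (u : R) (r : nat) : R :=
  log2 (Bev r (vu u)) - r%:R * log2 (1 + u * vu u) + r%:R * log2 (mu u).

Let mu1 u : 1 <= mu u. Proof. by rewrite le_max lexx. Qed.
Let mu0 u : 0 < mu u. Proof. exact: lt_le_trans (mu1 u). Qed.

Lemma gl_le1 u l : 0 <= u -> gl u l <= 1.
Proof.
move=> u0; rewrite /gl lerBlDr -log2X// -[X in _ <= X + _]log2_2 -log2M ?exprn_gt0//; apply: ler_log2; first exact: X1.
rewrite mulr_natl mulr2n; apply: lerD; first by rewrite exprn_ege1.
by rewrite lerXn2r ?nnegrE ?(ltW (mu0 _))// le_max lexx orbT.
Qed.

Lemma gr_le u r : 0 <= u -> gr u r <= r%:R.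
Proof.
move=> u0; have v0 := vu_ge0 u0; have uv := uv1_gt0 u0.
have v1 : 0 < 1 + vu u by rewrite ltr_wpDr.
apply: (@le_trans _ _ (r%:R * log2 ((1 + vu u) * mu u / (1 + u * vu u)))).
  rewrite log2D ?mulr_gt0// log2M// mulrBr mulrDr /gr addrAC lerD2r lerD2r -log2X//.
  by apply: ler_log2; [exact: Bev_gt0|exact: Bev_le].
rewrite -[leRHS]mulr1 ler_wpM2l// -[leRHS]log2_2; apply: ler_log2; first by rewrite divr_gt0 ?mulr_gt0.
(* The bound by [2] holds because [vu u] lies on the same side of [1] as [u]. *)
rewrite ler_pdivrMr// /mu; have [u1|u1] := leP u 1.
  by have := vu_le1 (u := u); rewrite u0 u1 => /(_ isT); nra.
by have := vu_ge1 (ltW u1); nra.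
Qed.

Definition Phi (u : R) : R := \sum_(l < D) Lam`_l * gl u l + \sum_(r < D) ga r * gr u r.
(** The design rate: variables minus checks, per unit of [n]. *)
Definition P0 : R := \sum_(l < D) Lam`_l - \sum_(r < D) ga r.

Lemma Psi_Phi u : 0 <= u -> Defs.Psi Lam Gam u = Phi u - P0.
Proof.
move=> u0; rewrite /Defs.Psi.
have v0 := vu_ge0 u0; have uv := uv1_gt0 u0.
have v1 : 0 < 1 + vu u by rewrite ltr_wpDr.
have u1 : 0 < 1 + u by rewrite ltr_wpDr.
rewrite -/L1 (sum_wide (F := fun l a => l%:R * a / L1 / (1 + u ^+ l)) LamD); last first.
  by move=> l; rewrite mulr0 !mul0r.
rewrite (sum_wide (F := fun l a => l%:R * a / L1 * u ^+ l.-1 / (1 + u ^+ l)) LamD); last first.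
  by move=> l; rewrite mulr0 !mul0r.
rewrite -/(pu u) -/(vu u) (sum_wide (F := fun l a => a * log2 ((1 + u ^+ l) / (2 * (1 + u) ^+ l))) LamD); last first.
  by move=> l; rewrite mul0r.
rewrite (sum_wide (F := fun r a => a * log2 (1 + ((1 - vu u) / (1 + vu u)) ^+ r)) GamD); last first.
  by move=> l; rewrite mul0r.
set A := log2 (1 + u); set B := log2 (1 + vu u); set C := log2 (1 + u * vu u); set M := log2 (mu u).
have -> : log2 ((1 + u * vu u) / ((1 + u) * (1 + vu u))) = C - (A + B).
  by rewrite log2D ?mulr_gt0// log2M.
have e1 : \sum_(l < D) Lam`_l * log2 ((1 + u ^+ l) / (2 * (1 + u) ^+ l)) =
   \sum_(l < D) Lam`_l * gl u l + (M - A) * L1 - \sum_(l < D) Lam`_l.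
  rewrite /L1 dp1_wide// mulr_sumr -big_split -sumrB /=; apply: eq_bigr => l _.
  rewrite log2D ?X1 ?mulr_gt0 ?exprn_gt0// log2M ?exprn_gt0// log2X// log2_2 /gl -/A -/M; ring.
have e2 : L1 / dp Gam 1 * \sum_(r < D) Gam`_r * log2 (1 + ((1 - vu u) / (1 + vu u)) ^+ r) =
   \sum_(r < D) ga r * gr u r + (C - M - B) * L1 + \sum_(r < D) ga r.
  rewrite -[X in _ + (C - M - B) * X + _]sum_rga !mulr_sumr -!big_split /=; apply: eq_bigr => r _; rewrite /gr mulrA -/(ga r).
  have -> : log2 (1 + ((1 - vu u) / (1 + vu u)) ^+ r) = log2 (Bev r (vu u)) + 1 - r%:R * B.
    have -> : 1 + ((1 - vu u) / (1 + vu u)) ^+ r = Bev r (vu u) * 2 / (1 + vu u) ^+ r.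
      by rewrite /Bev expr_div_n; field; rewrite expf_neq0// gt_eqF.
    have b0 := Bev_gt0 r v0.
    have b2 : 0 < Bev r (vu u) * 2 by apply: mulr_gt0.
    by rewrite (log2D b2) ?exprn_gt0// (log2M b0)// log2_2 log2X.
  rewrite -/C -/M [LHS]mulrA -/(ga r); ring.
rewrite e1 e2 /Phi /P0; ring.
Qed.

Lemma Phi1 : Phi 1 = P0.
Proof.
have m1 : mu 1 = 1 by rewrite /mu maxxx.
have v1 : vu 1 = 1.
  rewrite /vu /pu; under [X in _ * X]eq_bigr => l _ do rewrite expr1n mulr1.
  by rewrite mulVf// gt_eqF// pu_gt0.
rewrite /Phi /P0; congr (_ + _).
  by apply: eq_bigr => l _; rewrite /gl m1 log2_1 mulr0 subr0 expr1n log2_2 mulr1.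
rewrite -sumrN; apply: eq_bigr => -[[|r] rD] _ /=; first by rewrite /ga Gam2// mulr0 mul0r oppr0.
rewrite /gr v1 m1 log2_1 mulr0 addr0 mulr1 log2_2 mulr1 /Bev subrr expr0n /= addr0.
rewrite exprS (_ : 2 * 2 ^+ r / 2 = 2 ^+ r); last by field.
by rewrite log2X// log2_2 -natr1; ring.
Qed.

(** Variable degrees of at least two give [vu 0 = 0], since a degree one would contribute [u ^ 0].
    The value serves to deduce [P0 >= 0] from [Phi <= P0]. *)
Lemma Phi0 : Phi 0 = 0.
Proof.
have m1 : mu 0 = 1 by rewrite /mu max_l.
have v1 : vu 0 = 0.
  rewrite /vu big1 ?mulr0// => -[[|[|l]] lD] _ /=; rewrite ?ll0 ?mul0r//.
    by rewrite /ll Lam2// mulr0 !mul0r.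
  by rewrite expr0n mulr0 mul0r.
rewrite /Phi big1 ?add0r; last first.
  move=> -[[|l] lD] _ /=; first by rewrite Lam2// mul0r.
  by rewrite /gl m1 expr0n addr0 log2_1 !mulr0 subr0 mulr0.
apply: big1 => r _.
have b1 : Bev r (0 : R) = 1 by rewrite /Bev addr0 subr0 expr1n; field.
by rewrite /gr v1 m1 b1 mulr0 addr0 log2_1 !mulr0 subr0 addr0 mulr0.
Qed.

(** * The bound for a residual graph with nearly ideal degrees *)

Section Bound.
Hypothesis Phi_le : forall u, 0 <= u -> Phi u <= P0.
Variables (n m : nat) (dv : 'I_n -> nat) (dc : 'I_m -> nat).
Variables (U : {set 'I_n}) (K : {set csock dc}).
Hypothesis dv1 : forall i, (0 < dv i)%N.
Hypothesis UK : (\sum_(i in U) dv i <= #|K|)%N.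
Hypothesis dvD : forall i, (dv i < D)%N.
Hypothesis kD : forall a, (kdeg K a < D)%N.
Hypothesis k1 : forall a, kdeg K a != 1%N.
Variable del : R.
Hypothesis del01 : 0 <= del <= 1.

Definition nu (l : nat) : R := #|[set i in U | dv i == l]|%:R.
Definition ch (r : nat) : R := #|[set a | kdeg K a == r]|%:R.
Hypothesis nu_ge : forall l, (1 - del) * n%:R * Lam`_l <= nu l.
Hypothesis ch_ge : forall r, (1 < r)%N -> (1 - del) * n%:R * ga r <= ch r.

(** The uniform bounds on [gl] and [gr] are upper bounds, so a surplus of nodes is controlled but
    not a deficit. Shrinking the ideal counts by [1 - del] turns all differences into surpluses. *)
Definition dev : R := \sum_(l < D) (nu l - (1 - del) * n%:R * Lam`_l) +
  \sum_(r < D | (1 < r)%N) (ch r - (1 - del) * n%:R * ga r).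

Lemma sum_nu (h : nat -> R) : \sum_(i in U) h (dv i) = \sum_(l < D) nu l * h l.
Proof.
rewrite (partition_big (fun i => Ordinal (dvD i)) predT) //=; apply: eq_bigr => l _.
rewrite (eq_bigr (fun=> h l)) => [|i /andP[_ /eqP <-]//].
rewrite sumr_const mulr_natl; congr (_ *+ _); apply: eq_card => i.
by rewrite !inE.
Qed.

Lemma sum_ch (h : nat -> R) : h 0%N = 0 ->
  \sum_a h (kdeg K a) = \sum_(r < D | (1 < r)%N) ch r * h r.
Proof.
move=> h0; rewrite (partition_big (fun a => Ordinal (kD a)) predT) //= [RHS]big_mkcond /=.
apply: eq_bigr => r _; rewrite (eq_bigr (fun=> h r)) => [|a /eqP <-//].
rewrite sumr_const; case: ifP => r1.
  by rewrite mulr_natl; congr (_ *+ _); apply: eq_card => a; rewrite !inE.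
have [r0|rn] := eqVneq (r : nat) 0%N; first by rewrite r0 h0 mul0rn.
rewrite (_ : #|_| = 0%N) ?mulr0n//; apply: eq_card0 => a; rewrite !inE.
apply/negP => /eqP e; have := k1 a; rewrite (_ : kdeg K a = r) -?e//=.
by move: rn r1; rewrite -e /=; case: (kdeg K a) => [|[|]].
Qed.

Lemma card_K : #|K| = (\sum_a kdeg K a)%N.
Proof.
rewrite -sum1_card (partition_big (fun r : csock dc => tag r) predT) //=; apply: eq_bigr => a _.
by rewrite /kdeg -sum1_card; apply: eq_bigl => r; rewrite !inE.
Qed.

Lemma dev_ge0 : 0 <= dev.
Proof.
by apply: addr_ge0; apply: sumr_ge0 => i i1; rewrite subr_ge0; [exact: nu_ge|exact: ch_ge].
Qed.

(** A surplus node contributes at most [D]. As [UK] is an inequality, the corrections by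
    [log2 (mu u)] need not cancel, but the remainder has the right sign because [mu u >= 1]. *)
Lemma log2_gf u : 0 <= u ->
  log2 ((\prod_(i in U) (1 + u ^+ dv i)) * (\prod_a Bev (kdeg K a) (vu u)) / (1 + u * vu u) ^+ #|K|) <=
  (1 - del) * n%:R * P0 + D%:R * dev.
Proof.
move=> u0; have v0 := vu_ge0 u0; have uv := uv1_gt0 u0.
have A0 : 0 < \prod_(i in U) (1 + u ^+ dv i) by apply: prodr_gt0 => i _; apply: X1.
have B0 : 0 < \prod_a Bev (kdeg K a) (vu u) by apply: prodr_gt0 => a _; apply: Bev_gt0.
have AB0 := mulr_gt0 A0 B0.
rewrite (log2D AB0) ?exprn_gt0// (log2M A0 B0) (log2X _ uv) !log2_prod; last 2 first.
- by move=> i _; apply: X1.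
- by move=> a _; apply: Bev_gt0.
have Dn0 : (0 < D)%N.
  by rewrite lt0n; apply/eqP => D0; move: L1_gt0; rewrite dp1_wide// D0 big_ord0 ltxx.
have D1 : 1 <= D%:R :> R by rewrite ler1n.
have M0 : 0 <= log2 (mu u) by apply: log2_ge0.
apply: (@le_trans _ _ (\sum_(i in U) gl u (dv i) + \sum_a gr u (kdeg K a))).
  have -> : \sum_(i in U) gl u (dv i) = \sum_(i in U) log2 (1 + u ^+ dv i) -
     (\sum_(i in U) dv i)%N%:R * log2 (mu u).
    by rewrite natr_sum mulr_suml -sumrB.
  have -> : \sum_a gr u (kdeg K a) = \sum_a log2 (Bev (kdeg K a) (vu u)) -
     #|K|%:R * log2 (1 + u * vu u) + #|K|%:R * log2 (mu u).
    by rewrite card_K natr_sum !mulr_suml -sumrB -big_split.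
  have : (\sum_(i in U) dv i)%N%:R * log2 (mu u) <= #|K|%:R * log2 (mu u).
    by rewrite ler_wpM2r// ler_nat.
  lra.
rewrite (sum_nu (gl u)) sum_ch; last first.
  have b0 : Bev 0 (vu u) = 1 by rewrite /Bev !expr0; field.
  by rewrite /gr b0 log2_1 !mul0r subr0 addr0.
apply: (@le_trans _ _ ((1 - del) * n%:R * Phi u + D%:R * dev)); last first.
  rewrite lerD2r ler_wpM2l ?Phi_le// mulr_ge0// subr_ge0; by case/andP: del01.
rewrite /Phi /dev.
have -> : \sum_(r < D) ga r * gr u r = \sum_(r < D | (1 < r)%N) ga r * gr u r.
  rewrite [RHS]big_mkcond; apply: eq_bigr => r _; case: ifP => // /negbT; rewrite -leqNgt => r1.
  by rewrite /ga Gam2// mulr0 mul0r.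
rewrite !mulrDr !mulr_sumr addrACA -!big_split /=; apply: lerD; apply: ler_sum => i.
  move=> _; have h := nu_ge i; have := gl_le1 i u0; nra.
move=> i1; have h := ch_ge i1; have := gr_le i u0.
have iD : i%:R <= D%:R :> R by rewrite ler_nat ltnW.
nra.
Qed.

Lemma P0_ge0 : 0 <= P0.
Proof. by rewrite -Phi0; apply: Phi_le. Qed.

Lemma log2_Nbound : log2 (Nbound R dv U K) <=
  2 * log2 #|K|.+1%:R + (1 - del) * n%:R * P0 + D%:R * dev.
Proof.
set be := (1 - del) * n%:R * P0 + D%:R * dev.
(* This gives [X >= 1], which [Nbound_gf] uses at the full weight. *)
have be0 : 0 <= be.
  rewrite addr_ge0 ?mulr_ge0 ?P0_ge0 ?dev_ge0// subr_ge0; by case/andP: del01.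
pose X := expR (be * ln 2).
have X1' : 1 <= X by rewrite -expR0 ler_expR mulr_ge0// ltW// ln2_gt0.
have lX : log2 X = be by rewrite /log2 expRK mulfK// gt_eqF// ln2_gt0.
have X0 : 0 < X by apply: expR_gt0.
have : Nbound R dv U K <= (#|K|.+1 ^ 2)%:R * X.
  apply: Nbound_gf => // w wK.
  have K0 : 0 < #|K|%:R :> R by rewrite ltr0n; apply: leq_ltn_trans wK.
  have [|u u0 qe] := @qu_surj (w%:R / #|K|%:R).
    by rewrite divr_ge0//= ltr_pdivrMr// mul1r ltr_nat.
  exists u, (vu u); split=> //; first exact: vu_ge0.
    have kw0 : 0 < (#|K| - w)%:R :> R by rewrite ltr0n subn_gt0.
    have pe : pu u = (#|K| - w)%:R / #|K|%:R.
      by have := puqu u0; rewrite qe natrB ?(ltnW wK)// mulrBl divff ?gt_eqF// => /(canRL (addrK _)) ->.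
    rewrite u_vu// qe pe; field; by rewrite !gt_eqF.
  have uv := uv1_gt0 u0; have v0 := vu_ge0 u0.
  set Z := _ / _; have Z0 : 0 < Z.
    rewrite /Z divr_gt0 ?exprn_gt0// mulr_gt0//; apply: prodr_gt0 => i _; first exact: X1.
    exact: Bev_gt0.
  have := log2_gf u0; rewrite -/Z -/be -lX /log2 ler_pM2r ?invr_gt0 ?ln2_gt0//.
  by rewrite ler_ln ?posrE.
move=> /(ler_log2 _) h; have N0 : 0 < Nbound R dv U K by apply: lt_le_trans (Nbound_ge1 _ _ _ _).
apply: (le_trans (h N0)); rewrite log2M ?ltr0n ?expn_gt0// natrX log2X ?ltr0n// lX.
by rewrite /be addrA.
Qed.

End Bound.

End Psi.

(** * The limit of density evolution *)

Section PolyMono.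
Variables (R : realType) (p : {poly R}).
Hypothesis p0 : forall i, 0 <= p`_i.

Lemma horner_nneg a : 0 <= a -> 0 <= p.[a].
Proof. by move=> a0; rewrite horner_coef sumr_ge0// => i _; rewrite mulr_ge0 ?exprn_ge0. Qed.

Lemma horner_mono a b : 0 <= a -> a <= b -> p.[a] <= p.[b].
Proof.
move=> a0 ab; rewrite !horner_coef; apply: ler_sum => i _; rewrite ler_wpM2l//.
by rewrite lerXn2r ?nnegrE// (le_trans a0).
Qed.

End PolyMono.

Definition ev0 (R : realType) (s : nat -> R) : Prop :=
  forall e : R, 0 < e -> exists T : nat, forall t, (T <= t)%N -> s t <= e.

Lemma ev0_sum (R : realType) (I : Type) (r : seq I) (P : pred I) (s : I -> nat -> R) :
  (forall i, P i -> ev0 (s i)) -> ev0 (fun t => \sum_(i <- r | P i) s i t).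
Proof.
move=> h; elim: r => [|i r IH] e e0; first by exists 0%N => t _; rewrite big_nil ltW.
have [Pi|Pi] := boolP (P i); last first.
  by have [T hT] := IH e e0; exists T => t Tt; rewrite big_cons (negbTE Pi) hT.
have e2 : 0 < e / 2 by rewrite divr_gt0.
have [T hT] := h i Pi _ e2; have [T' hT'] := IH _ e2; exists (maxn T T') => t.
rewrite geq_max => /andP[t1 t2]; rewrite big_cons Pi [e]splitr; apply: lerD; [exact: hT|exact: hT'].
Qed.

Lemma ev0D (R : realType) (s s' : nat -> R) : ev0 s -> ev0 s' -> ev0 (fun t => s t + s' t).
Proof.
move=> h h' e e0; have e2 : 0 < e / 2 by rewrite divr_gt0.
have [T hT] := h _ e2; have [T' hT'] := h' _ e2; exists (maxn T T') => t.
rewrite geq_max => /andP[t1 t2]; rewrite [e]splitr; apply: lerD; [exact: hT|exact: hT'].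
Qed.

Lemma horner_ev0 (R : realType) (p : {poly R}) (z : nat -> R) (l : R) :
  (z @ \oo --> l)%classic -> ev0 (fun t => `|p.[z t] - p.[l]|).
Proof.
move=> zl e e0.
have /cvgrPdist_le/(_ _ e0)[T _ hT] : ((fun t => p.[z t]) @ \oo --> p.[l])%classic.
  by apply: (continuous_cvg _ _ zl); apply: continuous_horner.
by exists T => t Tt; rewrite distrC; apply: hT.
Qed.

Section Limit.
Variables (R : realType) (lam rho : {poly R}) (eps x y : R).
Hypothesis dl : edge_dd lam.
Hypothesis dr : edge_dd rho.
Hypothesis e01 : 0 <= eps <= 1.
Hypothesis x01 : 0 <= x <= 1.
Hypothesis xfix : x = eps * lam.[1 - rho.[1 - x]].
Hypothesis xmax : forall t : R, 0 <= t <= 1 -> t = eps * lam.[1 - rho.[1 - t]] -> t <= x.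
Hypothesis yE : y = 1 - rho.[1 - x].
Hypothesis x_gt0 : 0 < x.

Local Notation xi := (xi lam rho eps).
Local Notation etad := (etad lam rho eps).

Let lam0 i : 0 <= lam`_i. Proof. by case: dl => _ []. Qed.
Let rho0 i : 0 <= rho`_i. Proof. by case: dr => _ []. Qed.
Let lam1 : lam.[1] = 1. Proof. by case: dl => _ []. Qed.
Let rho1 : rho.[1] = 1. Proof. by case: dr => _ []. Qed.
Let eps0 : 0 <= eps. Proof. by case/andP: e01. Qed.
Let eps1 : eps <= 1. Proof. by case/andP: e01. Qed.

Let chk a b : 0 <= a -> a <= b -> b <= 1 -> 1 - rho.[1 - a] <= 1 - rho.[1 - b].
Proof. by move=> a0 ab b1; rewrite lerD2l lerN2 horner_mono// ?subr_ge0// lerD2l lerN2. Qed.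

Let chk0 a : 0 <= a -> a <= 1 -> 0 <= 1 - rho.[1 - a].
Proof.
move=> a0 a1; rewrite subr_ge0 -[leRHS]rho1; apply: horner_mono => //; first by rewrite subr_ge0.
by rewrite lerBlDr lerDl.
Qed.

Lemma y_ge0 : 0 <= y.
Proof. by rewrite yE chk0//; case/andP: x01. Qed.

Lemma y_gt0 : 0 < y.
Proof.
rewrite lt_def y_ge0 andbT; apply/eqP => h; move: x_gt0; rewrite xfix -yE h horner_coef0.
by case: dl => -> _; rewrite mulr0 ltxx.
Qed.

(** The iteration is monotone and fixes [x], so iterates started at [1] stay above [x]. *)
Lemma xi_eta_bounds k : x <= xi k <= 1 /\ y <= etad k <= 1.
Proof.
case/andP: x01 => x0 x1.
have step z : x <= z <= 1 -> y <= 1 - rho.[1 - z] <= 1.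
  move=> /andP[xz z1]; rewrite yE chk//= lerBlDr lerDl horner_nneg// subr_ge0//.
elim: k => [|k [IHx IHy]]; first by split; [rewrite xi0 x1 lexx|apply: step; rewrite xi0 x1 lexx].
suff h : x <= xi k.+1 <= 1 by split=> //; apply: step.
case/andP: IHy => yk k1; have k0 : 0 <= etad k by apply: le_trans yk; apply: y_ge0.
rewrite xiS {1}xfix -yE ler_wpM2l ?horner_mono ?y_ge0//=.
by apply: mulr_ile1 => //; [exact: horner_nneg|rewrite -[leRHS]lam1; exact: horner_mono].
Qed.

Lemma xi_gt0 k : 0 < xi k.
Proof. by have [/andP[h _] _] := xi_eta_bounds k; apply: lt_le_trans h. Qed.
Lemma eta_gt0 k : 0 < etad k.
Proof. by have [_ /andP[h _]] := xi_eta_bounds k; apply: lt_le_trans h; apply: y_gt0. Qed.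

Lemma xi_dec k : xi k.+1 <= xi k.
Proof.
elim: k => [|k IH]; first by have [/andP[_ ?] _] := xi_eta_bounds 1.
rewrite !(xiS lam rho eps); apply: ler_wpM2l => //; apply: horner_mono => //; first exact: ltW (eta_gt0 _).
by apply: chk => //; [exact: ltW (xi_gt0 _)|have [/andP[]] := xi_eta_bounds k].
Qed.

Lemma eta_dec k : etad k.+1 <= etad k.
Proof.
by apply: chk; [exact: ltW (xi_gt0 _)|exact: xi_dec|have [/andP[]] := xi_eta_bounds k].
Qed.

(** The decreasing iterates converge to a fixed point not below [x], which is [x] by maximality. *)
Lemma xi_cvg : (xi @ \oo --> x)%classic.
Proof.
have xic : cvgn xi.
  apply: nonincreasing_is_cvgn; first by apply/nonincreasing_seqP => k; apply: xi_dec.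
  by exists x => _ [k _ <-]; have [/andP[]] := xi_eta_bounds k.
pose F : {poly R} := eps *: (lam \Po (1 - rho \Po (1 - 'X))).
have FE z : F.[z] = eps * lam.[1 - rho.[1 - z]].
  by rewrite /F !(hornerE, horner_comp).
have c1 : ((fun k => F.[xi k]) @ \oo --> F.[limn xi])%classic.
  by apply: (continuous_cvg _ _ xic); apply: continuous_horner.
have c2 : ((fun k => F.[xi k]) @ \oo --> limn xi)%classic.
  have -> : (fun k => F.[xi k]) = (fun k => xi k.+1) by apply/funext => k; rewrite FE.
  by rewrite cvg_shiftS.
have fx : limn xi = F.[limn xi].
  exact: (cvg_unique _ c2 c1).
have xz : x <= limn xi.
  by apply: limr_ge => //; near=> k; have [/andP[]] := xi_eta_bounds k.
have z1 : limn xi <= 1.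
  by apply: limr_le => //; near=> k; have [/andP[]] := xi_eta_bounds k.
suff <- : limn xi = x by [].
apply/eqP; rewrite eq_le xz andbT; apply: xmax; first by rewrite z1 (le_trans (ltW x_gt0)).
by rewrite -FE.
Unshelve. all: by end_near.
Qed.

Lemma eta_cvg : (etad @ \oo --> y)%classic.
Proof.
pose F : {poly R} := 1 - rho \Po (1 - 'X).
have FE z : F.[z] = 1 - rho.[1 - z] by rewrite /F !(hornerE, horner_comp).
have -> : y = F.[x] by rewrite FE.
have -> : etad = (fun k => F.[xi k]) by apply/funext => k; rewrite FE.
by apply: (continuous_cvg _ _ xi_cvg); apply: continuous_horner.
Qed.

End Limit.

(** * Thinning of the check degrees *)

Section Thinning.
Variable R : realType.

(** The probability of [r] successes in [j] trials, as a polynomial in the success probability. It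
    is a sum over patterns to match products of single-socket tests. *)
Definition binP (j r : nat) : {poly R} := \sum_(b : {ffun 'I_j -> bool} | #|[set i | b i]| == r)
  \prod_i (if b i then 'X else 1 - 'X).
Definition topP (p : {poly R}) (r : nat) : {poly R} := \sum_(j < size p) p`_j *: binP j r.

Lemma horner_binP j r z : (binP j r).[z] =
  \sum_(b : {ffun 'I_j -> bool} | #|[set i | b i]| == r) \prod_i (if b i then z else 1 - z).
Proof.
rewrite horner_sum; apply: eq_bigr => b _; rewrite horner_prod; apply: eq_bigr => i _.
by case: (b i); rewrite !hornerE.
Qed.

Lemma coef_thin (p : {poly R}) z r : (p \Po ((1 - z)%:P + z *: 'X))`_r = (topP p r).[z].
Proof.
rewrite comp_polyE coef_sum horner_sum; apply: eq_bigr => j _; rewrite coefZ hornerZ; congr (_ * _).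
rewrite horner_binP.
pose F (i : 'I_j) (b : bool) : {poly R} := if b then z *: 'X else (1 - z)%:P.
have -> : ((1 - z)%:P + z *: 'X) ^+ j = \prod_(i < j) \sum_b F i b.
  rewrite [RHS](eq_bigr (fun=> (1 - z)%:P + z *: 'X)); first by rewrite prodr_const card_ord.
  by move=> i _; rewrite big_bool; exact: addrC.
rewrite (bigA_distr_bigA F) coef_sum [RHS]big_mkcond /=; apply: eq_bigr => b _.
have -> : \prod_i F i (b i) = (\prod_i (if b i then z else 1 - z)) *: 'X^(#|[set i | b i]|).
  rewrite (eq_bigr (fun i => (if b i then z else 1 - z) *: (if b i then 'X else 1))).
    rewrite scaler_prod; congr (_ *: _); rewrite -big_mkcond /= prodr_const; congr (_ ^+ _).
    by apply: eq_card => i; rewrite inE.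
  by move=> i _; rewrite /F; case: (b i) => //; rewrite alg_polyC.
by rewrite coefZ coefXn eq_sym; case: eqP => _; rewrite ?mulr1 ?mulr0.
Qed.

End Thinning.

(** * Statistics of the residual graph *)

Lemma coef_comp_scaleX (R : realType) (p : {poly R}) (y : R) l : (p \Po (y *: 'X))`_l = p`_l * y ^+ l.
Proof.
rewrite comp_polyE coef_sum.
under eq_bigr => j _ do rewrite coefZ exprZn coefZ coefXn.
have [lp|lp] := ltnP l (size p); last first.
  rewrite nth_default// mul0r; apply: big1 => j _.
  by rewrite gtn_eqF ?mulr0//; apply: leq_trans lp.
rewrite (bigD1 (Ordinal lp))//= eqxx mulr1 big1 ?addr0// => j jl.
by rewrite (_ : (l == j) = false) ?mulr0//; apply/negbTE; apply: contraNneq jl => lj; apply/eqP/val_inj.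
Qed.

Section Statistics.
Variables (R : realType) (lam rho : {poly R}) (eps : R).
Hypothesis dl : edge_dd lam.
Hypothesis dr : edge_dd rho.
Hypothesis e01 : 0 <= eps <= 1.
Local Notation Lam := (node_persp lam).
Local Notation Gam := (node_persp rho).
Local Notation xi := (xi lam rho eps).
Local Notation etad := (etad lam rho eps).
Hypothesis H : forall t, HC lam rho eps t /\ HV lam rho eps t.

Lemma nu_tends t l :
  tendsL eps (fun (c : cfg lam rho) w => nu R (@cdv _ _ _ c) (Uset t w.1 w.2) l)
    (LamEps Lam eps (etad t))`_l.
Proof.
have := (H t).2 l (fun _ k => (t <= k)%N%:R) (fun _ k => nat1_le1 _ _).
rewrite (eq_bigr (fun=> etad t)) => [|i _]; last by rewrite mean_ge.
rewrite prodr_const card_ord (_ : (LamEps Lam eps (etad t))`_l = eps * Lam`_l * etad t ^+ l); last first.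
  by rewrite /LamEps coefZ coef_comp_scaleX mulrA.
apply: (eq_tendsL e01) => c w _; rewrite /vstat /stat /nu -sum1_card natr_sum [RHS]big_mkcond [LHS]big_mkcond /=.
apply: eq_bigr => v _; rewrite !inE; case: (cdv v == l); rewrite ?andbF// andbT prod_bool -natrM mulnb.
rewrite (_ : [forall (s | _), _] = [forall (s : vsock (@cdv _ _ _ c) | tag s == v), ym t w.1 w.2 s == t]).
  by case: (_ && _).
by apply: eq_forallb => s; rewrite eqn_leq ym_le.
Qed.

Definition bget j (b : {ffun 'I_j -> bool}) (i : nat) : bool := if insub i is Some o then b o else false.

Lemma bgetE j (b : {ffun 'I_j -> bool}) (i : 'I_j) : bget b i = b i.
Proof. by rewrite /bget valK. Qed.

(** The count is split according to the pattern [b] of the unresolved sockets of a check; each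
    pattern is a product of single-socket tests, to which [HC] applies. *)
Lemma top_tends t r :
  tendsL eps (fun (c : cfg lam rho) w => #|[set a | #|tops t w.1 w.2 a| == r]|%:R)
    (kap lam rho * (topP Gam r).[xi t]).
Proof.
pose psi j (b : {ffun 'I_j -> bool}) (i k : nat) : R := if bget b i then (t <= k)%N%:R else (k < t)%N%:R.
have psi1 j b i k : `|psi j b i k| <= 1 by rewrite /psi; case: ifP => _; apply: nat1_le1.
rewrite (_ : kap lam rho * _ = \sum_(j < size Gam) \sum_(b : {ffun 'I_j -> bool} | #|[set i | b i]| == r)
   kap lam rho * Gam`_j * \prod_(i < j) mean xi t (psi j b i)); last first.
  rewrite /topP horner_sum mulr_sumr; apply: eq_bigr => j _.
  rewrite hornerZ horner_binP mulrA mulr_sumr; apply: eq_bigr => b _; congr (_ * _).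
  apply: eq_bigr => i _; rewrite /psi bgetE; case: (b i); first by rewrite mean_ge.
  by rewrite mean_lt.
have T : tendsL eps (fun (c : cfg lam rho) w => \sum_(j < size Gam)
    \sum_(b : {ffun 'I_j -> bool} | #|[set i | b i]| == r) cstat j (psi j b) t w)
   (\sum_(j < size Gam) \sum_(b : {ffun 'I_j -> bool} | #|[set i | b i]| == r)
   kap lam rho * Gam`_j * \prod_(i < j) mean xi t (psi j b i)).
  apply: (tendsL_sum dr e01) => j _; apply: (tendsL_sum dr e01) => b _.
  exact: (H t).1.
apply: (eq_tendsL e01 _ T) => c w _.
pose X := pull w.1 (xm t w.1 w.2).
have Xt s : (X s <= t)%N by apply/bigmax_leqP => s' _; apply: xm_le.
pose F j a : R := \sum_(b : {ffun 'I_j -> bool} | #|[set i | b i]| == r)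
   \prod_(s : csock (@cdc _ _ _ c) | tag s == a) psi j b (tagged s) (X s).
transitivity (\sum_(j < size Gam) \sum_(a | @cdc _ _ _ c a == j) F j a).
  apply: eq_bigr => j _; rewrite /F exchange_big /=; apply: eq_bigr => b _.
  by rewrite /cstat /stat; apply: eq_bigr => a _; rewrite mul1r.
transitivity (\sum_a F (@cdc _ _ _ c a) a).
  rewrite [RHS](partition_big (fun a => Ordinal (deg_lt (cdcE c) a)) predT) //=.
  by apply: eq_bigr => j _; apply: eq_big => // a /eqP <-.
rewrite -sum1_card natr_sum [RHS]big_mkcond /=; apply: eq_bigr => a _.
pose b0 : {ffun 'I_(@cdc _ _ _ c a) -> bool} := [ffun i => X (Tagged (fun a => 'I_(cdc a)) i) == t].
have cb0 : #|[set i | b0 i]| = #|tops t w.1 w.2 a|.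
  rewrite -sum1_card -[RHS]sum1_card.
  rewrite [RHS](eq_bigl (fun s : csock (@cdc _ _ _ c) => (tag s == a) && (X s == t))); last first.
    by move=> s; rewrite inE.
  rewrite [RHS]big_mkcondr /= big_node [LHS]big_mkcond /=; apply: eq_bigr => i _.
  by rewrite inE ffunE.
rewrite inE -cb0 /F.
rewrite (eq_bigr (fun b => (b == b0)%:R)); last first.
  move=> b _; rewrite big_node /=.
  rewrite (eq_bigr (fun i => (b i == b0 i)%:R)) => [|i _]; last first.
    rewrite /psi bgetE ffunE; have := Xt (Tagged (fun a => 'I_(cdc a)) i).
    rewrite leq_eqVlt; case: eqP => [->|/eqP ne] /=; first by rewrite leqnn ltnn; case: (b i).
    by move=> h; rewrite h leqNgt h; case: (b i).
  rewrite prod_bool; congr (_%:R); congr nat_of_bool; apply/forallP/eqP => [h|-> i]; last by rewrite eqxx.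
  by apply/ffunP => i; apply/eqP; have := h i.
case: (boolP (#|[set i | b0 i]| == r)) => h.
  rewrite (bigD1 b0)//= eqxx big1 ?addr0// => b /andP[_ /negbTE ->].
  by [].
by apply: big1 => b bh; case: eqP => // e; move: bh; rewrite e (negbTE h).
Qed.

End Statistics.

Section ResidualDegrees.
Variables (n m : nat) (dv : 'I_n -> nat) (dc : 'I_m -> nat).
Variables (f : {ffun vsock dv -> csock dc}) (E : {ffun 'I_n -> bool}) (t : nat).
Hypothesis fb : bijective f.

(** An unresolved incoming edge gets an unresolved answer exactly when the check has another such
    edge. A check thus keeps all of them or loses its only one, which is the origin of the terms
    subtracted in [GamEps]. *)
Lemma kdeg_tops a : kdeg (Kset t.+1 f E) a =
  if (1 < #|tops t.+1 f E a|)%N then #|tops t.+1 f E a| else 0%N.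
Proof.
have fi := bij_inj fb; case: fb => g fK gK.
have sub : [set r in Kset t.+1 f E | tag r == a] \subset tops t.+1 f E a.
  by apply/fintype.subsetP => r; rewrite !inE => /andP[/andP[-> _] ->].
case: ifP => h.
  apply/eqP; rewrite eqn_leq (subset_leq_card sub) subset_leq_card//.
  apply/fintype.subsetP => r; rewrite !inE => /andP[ra rt]; rewrite ra rt andbT /=.
  have : (0 < #|tops t.+1 f E a :\ r|)%N.
    by move: h; rewrite (cardsD1 r) inE ra rt.
  move=> /card_gt0P[r']; rewrite !inE => /and3P[r'r r'a r't].
  rewrite -(gK r) pullE//; rewrite -(gK r') pullE// in r't.
  have : (t < ym t.+1 f E (g r))%N.
    rewrite ym_gt; apply/existsP; exists (g r'); rewrite !gK (eqP ra) (eqP r'a) eqxx (eqP r't) ltnSn !andbT.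
    by apply: contra_neq r'r => e; rewrite -(gK r') e gK.
  by have := ym_le t.+1 f E (g r); rewrite eqn_leq => -> ->.
apply/eqP; rewrite cards_eq0; apply/eqP/setP => r; rewrite inE [in RHS]inE; apply/negP => /andP[rK ra].
move: rK; rewrite inE => /andP[rt ry]; rewrite -(gK r) pullE// in ry.
have : (t < ym t.+1 f E (g r))%N by rewrite (eqP ry).
rewrite ym_gt => /existsP[s' /and3P[ne e lt]]; rewrite gK in e.
move/negP: h; apply; rewrite (cardsD1 r) inE ra rt (cardsD1 (f s')) !inE (eqP e) ra pullE//.
have -> : xm t.+1 f E s' == t.+1 by have := xm_le t.+1 f E s'; rewrite eqn_leq lt => ->.
by rewrite (_ : f s' != r)//; apply: contra_neq ne => <-; rewrite fK.
Qed.

(** All sockets of an unresolved variable lie in the class. Equality can fail, since another edge at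
    the variable of a class edge may have been resolved in the last round. *)
Lemma sum_deg_Uset : (\sum_(i in Uset t f E) dv i <= #|Kset t f E|)%N.
Proof.
have fi := bij_inj fb.
pose c : {ffun 'I_n -> bool} := [ffun i => i \in Uset t f E].
rewrite (eq_bigl (fun i => c i)) => [|i]; last by rewrite ffunE.
rewrite -card_Wset -(card_imset _ fi); apply/subset_leq_card/fintype.subsetP => _ /imsetP[s + ->].
by rewrite !inE ffunE => /Uset_xm[xs ys]; rewrite !pullE// xs ys eqxx.
Qed.

Lemma kdeg_le K a : (kdeg (dc := dc) K a <= dc a)%N.
Proof.
rewrite -[leqRHS](card_node dc); apply/subset_leq_card/fintype.subsetP => r.
by rewrite !inE => /andP[].
Qed.

End ResidualDegrees.

(** * The limit of the entropy *)

(** From [ln z <= eta * z - 1 - ln eta]: half of the allowance covers the linear term, half the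
    constant. *)
Lemma log2_small (R : realType) (L e : R) : 0 <= L -> 0 < e ->
  exists N : nat, forall n : nat, (N <= n)%N -> log2 (n%:R * L + 1) <= e * n%:R.
Proof.
move=> L0 e0; have l2 := @ln2_gt0 R.
pose eta := e * ln 2 / (2 * (L + 1)).
have L1 : 0 < L + 1 by rewrite ltr_wpDl.
have eta0 : 0 < eta by rewrite divr_gt0 ?mulr_gt0.
pose k := 2 * `|ln eta| / (e * ln 2).
have k0 : 0 <= k by rewrite divr_ge0 ?mulr_ge0 ?(ltW e0) ?(ltW l2).
exists (Num.bound k).+1 => n nN.
have n1 : 1 <= n%:R :> R by rewrite ler1n (leq_trans _ nN).
have kn : k <= n%:R.
  by apply/ltW/(lt_trans (archi_boundP k0)); rewrite ltr_nat.
have z0 : 0 < n%:R * L + 1 by rewrite ltr_wpDl// mulr_ge0.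
rewrite /log2 ler_pdivrMr//.
have ez0 : 0 < eta * (n%:R * L + 1) by rewrite mulr_gt0.
have h : ln (eta * (n%:R * L + 1)) <= eta * (n%:R * L + 1) - 1.
  have h1 : -1 < eta * (n%:R * L + 1) - 1 by lra.
  by have := le_ln1Dx h1; rewrite addrC subrK.
rewrite lnM ?posrE// in h.
have h2 : eta * (n%:R * L + 1) <= e * n%:R * ln 2 / 2.
  have -> : e * n%:R * ln 2 / 2 = eta * (n%:R * (L + 1)) by rewrite /eta; field; rewrite gt_eqF.
  rewrite ler_wpM2l ?(ltW eta0)// mulrDr mulr1 lerD2l//.
have h3 : `|ln eta| <= e * n%:R * ln 2 / 2.
  move: kn; rewrite /k ler_pdivrMr ?mulr_gt0// => kn; nra.
have := ler_norm (- ln eta); rewrite normrN; lra.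
Qed.

Section Assembly.
Variables (R : realType) (lam rho : {poly R}) (eps x y : R).
Hypothesis dl : edge_dd lam.
Hypothesis dr : edge_dd rho.
Hypothesis e01 : 0 <= eps <= 1.
Hypothesis x01 : 0 <= x <= 1.
Hypothesis xfix : x = eps * lam.[1 - rho.[1 - x]].
Hypothesis xmax : forall t : R, 0 <= t <= 1 -> t = eps * lam.[1 - rho.[1 - t]] -> t <= x.
Hypothesis yE : y = 1 - rho.[1 - x].
Hypothesis x_gt0 : 0 < x.
Local Notation Lam := (node_persp lam).
Local Notation Gam := (node_persp rho).
Local Notation xi := (xi lam rho eps).
Local Notation etad := (etad lam rho eps).
Local Notation kap := (kap lam rho).
Local Notation LE := (LamEps Lam eps y).
Local Notation GE := (GamEps Gam x).
Let D := maxn (maxn (size Lam) (size Gam)) (maxn (size LE) (size GE)).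

Let y0 : 0 < y. Proof. exact: (y_gt0 dl dr x01 xfix yE x_gt0). Qed.

Lemma coef_LamEps z l : (LamEps Lam eps z)`_l = eps * Lam`_l * z ^+ l.
Proof. by rewrite /LamEps coefZ coef_comp_scaleX mulrA. Qed.

Lemma LE_ge0 l : 0 <= LE`_l.
Proof.
rewrite coef_LamEps mulr_ge0 ?exprn_ge0 ?(ltW y0)// mulr_ge0 ?node_persp_ge0//.
by case/andP: e01.
Qed.

Lemma LE_lt2 l : (l < 2)%N -> LE`_l = 0.
Proof. by move=> l2; rewrite coef_LamEps node_persp_lt2// mulr0 mul0r. Qed.

Lemma GE_ge2 r : (1 < r)%N -> GE`_r = (topP Gam r).[x].
Proof.
move=> r1; rewrite /GamEps !coefB coef_thin coefC coefZ coefX.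
by case: r r1 => [|[|r]]//= _; rewrite mulr0 !subr0.
Qed.

Lemma derivZX (z : R) : (z *: 'X)^`() = z%:P.
Proof. by rewrite derivZ derivX alg_polyC. Qed.

Lemma deriv_thin : ((1 - x)%:P + x *: 'X)^`() = x%:P.
Proof. by rewrite derivD derivC derivZ derivX add0r alg_polyC. Qed.

Lemma horner_thin z : ((1 - x)%:P + x *: 'X).[z] = 1 - x + x * z.
Proof. by rewrite hornerD hornerC hornerZ hornerX. Qed.

Lemma GE_lt2 r : (r < 2)%N -> GE`_r = 0.
Proof.
case: r => [|[|r]]// _; rewrite /GamEps !coefB coefC coefZ coefX /=.
  by rewrite mulr0 subr0 -horner_coef0 horner_comp !hornerE subrr.
rewrite mulr1 subr0; set q := (1 - x)%:P + x *: 'X.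
have -> : (Gam \Po q)`_1 = ((Gam \Po q)^`())`_0 by rewrite coef_deriv.
rewrite -horner_coef0 deriv_comp hornerM horner_comp deriv_thin horner_thin mulr0 addr0 hornerC /dp.
by rewrite mulrC subrr.
Qed.

Lemma GE_ge0 r : 0 <= GE`_r.
Proof.
have [r2|r1] := ltnP r 2; first by rewrite GE_lt2.
rewrite GE_ge2// /topP horner_sum sumr_ge0// => j _; rewrite hornerZ mulr_ge0 ?node_persp_ge0//.
rewrite horner_binP sumr_ge0// => b _; apply: prodr_ge0 => i _; case/andP: x01 => ? ?.
by case: ifP; rewrite ?subr_ge0.
Qed.

(** The fixed point equation turns $\epsilon y\Lambda'(y)$ into $\Lambda'(1)xy$. Combined with
    [dp_GE], the residual ratio of derivatives is again [kap]. *)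
Lemma dp_LE : dp LE 1 = dp Lam 1 * x * y.
Proof.
rewrite /dp /LamEps derivZ deriv_comp hornerZ hornerM horner_comp derivZX hornerC.
rewrite (_ : (y *: 'X).[1] = y); last by rewrite hornerZ hornerX mulr1.
rewrite -[(Lam^`()).[y]]/(dp Lam y) (dp_node_persp dl y).
by rewrite [in RHS]xfix -yE /dp; ring.
Qed.

Lemma dp_GE : dp GE 1 = dp Gam 1 * x * y.
Proof.
rewrite /dp /GamEps !derivB deriv_comp deriv_thin derivC derivZX subr0.
rewrite hornerD hornerN hornerC hornerM horner_comp horner_thin mulr1 subrK hornerC.
by rewrite (dp_node_persp dr (1 - x)) yE /dp; ring.
Qed.

Lemma dp_LE_gt0 : 0 < dp LE 1.
Proof. by rewrite dp_LE !mulr_gt0// dp_node_persp1_gt0. Qed.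
Lemma dp_GE_gt0 : 0 < dp GE 1.
Proof. by rewrite dp_GE !mulr_gt0// dp_node_persp1_gt0. Qed.

Lemma ratio_kap : dp LE 1 / dp GE 1 = kap.
Proof.
have G0 := dp_node_persp1_gt0 dr.
by rewrite dp_LE dp_GE -[kap]/(dp Lam 1 / dp Gam 1); field; rewrite !gt_eqF.
Qed.

Let LED : (size LE <= D)%N. Proof. by rewrite /D; lia. Qed.
Let GED : (size GE <= D)%N. Proof. by rewrite /D; lia. Qed.
Let LamD : (size Lam <= D)%N. Proof. by rewrite /D; lia. Qed.
Let GamD : (size Gam <= D)%N. Proof. by rewrite /D; lia. Qed.

Lemma P0_trialP : P0 LE GE D = trialP lam rho eps x y.
Proof.
have hw (p : {poly R}) : (size p <= D)%N -> \sum_(l < D) p`_l = p.[1].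
  by move=> pD; rewrite (horner_coef_wide _ pD); apply: eq_bigr => i _; rewrite expr1n mulr1.
rewrite /P0 hw// -mulr_sumr hw// ratio_kap /trialP.
have -> : LE.[1] = eps * Lam.[y].
  have hz : (y *: 'X).[1] = y by rewrite hornerZ hornerX mulr1.
  by rewrite /LamEps hornerZ horner_comp hz.
have -> : GE.[1] = 1 - Gam.[1 - x] - x * dp Gam (1 - x).
  have hz (k : R) : (k *: 'X).[1] = k by rewrite hornerZ hornerX mulr1.
  by rewrite /GamEps hornerD hornerD !hornerN hz horner_comp horner_thin mulr1 subrK node_persp1// hornerC.
rewrite (dp_node_persp dr) -[dp Lam 1 / dp Gam 1]/kap -(kapG lam dr) yE; ring.
Qed.

Hypothesis HPsi : forall u : R, 0 <= u -> Psi LE GE u <= Psi LE GE 1.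

Lemma Phi_le_P0 u : 0 <= u -> Phi LE GE D u <= P0 LE GE D.
Proof.
move=> u0; have := HPsi u0.
rewrite !(Psi_Phi LED GED LE_ge0 dp_LE_gt0 dp_GE_gt0)// (Phi1 LED LE_ge0 GE_lt2 dp_LE_gt0).
by rewrite lerD2r.
Qed.

Let H t : HC lam rho eps t /\ HV lam rho eps t.
Proof.
apply: (HCV dl dr e01) => k.
- exact: (xi_gt0 dl dr e01 x01 xfix yE x_gt0).
- exact: (eta_gt0 dl dr e01 x01 xfix yE x_gt0).
- exact: (xi_dec dl dr e01 x01 xfix yE x_gt0).
- exact: (eta_dec dl dr e01 x01 xfix yE x_gt0).
Qed.

Let ga r : R := kap * GE`_r.
Definition ctop (c : cfg lam rho) (w : Om c) t r : R := #|[set a | #|tops t w.1 w.2 a| == r]|%:R.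
(** Measured from the values at the fixed point, so it contains both the fluctuation at finite [n]
    and the distance of [t] rounds from the limit. *)
Definition Del (c : cfg lam rho) (w : Om c) t : R :=
  \sum_(l < D) `|nu R (@cdv _ _ _ c) (Uset t w.1 w.2) l / (cn c)%:R - LE`_l| +
  \sum_(r < D | (1 < r)%N) `|ctop w t r / (cn c)%:R - ga r|.

Let pr0 (c : cfg lam rho) (w : Om c) : 0 <= prc eps w. Proof. exact: prc_ge0. Qed.
Let pr1 (c : cfg lam rho) : \sum_(w : Om c) prc eps w = 1. Proof. exact: sum_prc. Qed.

Lemma tendsL_sum_abs (I : eqType) (r : seq I) (P : pred I)
    (Z : I -> forall c : cfg lam rho, Om c -> R) (z : I -> R) :
  (forall i, P i -> tendsL eps (Z i) (z i)) -> forall e : R, 0 < e -> exists N : nat,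
  forall c : cfg lam rho, (N <= cn c)%N ->
    Ex (@prc _ _ _ eps c) (fun w => \sum_(i <- r | P i) `|Z i c w / (cn c)%:R - z i|) <= e.
Proof.
move=> T e e0.
have T' i : P i -> tendsL eps (fun c w => `|Z i c w - z i * (cn c)%:R|) 0.
  move=> Pi; apply: (tendsL_abs0 e01); rewrite -(subrr (z i)).
  exact: (tendsLB e01 (T i Pi) (@tendsL_cst _ _ _ _ dr _)).
have [N hN] := tendsL_sum dr e01 r T' e0; exists N.+1 => c Nc.
have n0 : 0 < (cn c)%:R :> R by rewrite ltr0n; apply: leq_trans Nc.
apply: le_trans (hN c (ltnW Nc)); apply: le_Ex => // w _.
rewrite [X in _ - X]big1// subr0 mulr_suml; apply: le_trans (ler_norm _); apply: ler_sum => i _.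
rewrite -{3}(gtr0_norm n0) -normfV -normrM mulrBl mulfK// gt_eqF//.
Qed.

Lemma Del_small (e : R) : 0 < e -> exists t N : nat, forall c : cfg lam rho, (N <= cn c)%N ->
  Ex (@prc _ _ _ eps c) (fun w => Del w t.+1) <= e.
Proof.
move=> e0; have e4 : 0 < e / 4 by rewrite divr_gt0.
have e2 : 0 < e / 2 by rewrite divr_gt0.
pose a t l := (LamEps Lam eps (etad t))`_l; pose g t r := kap * (topP Gam r).[xi t].
have ev1 : ev0 (fun t => \sum_(l < D) `|a t l - LE`_l|).
  apply: ev0_sum => l _ d d0.
  have [T hT] := horner_ev0 ((eps * Lam`_l) *: 'X^l)
    (eta_cvg dl dr e01 x01 xfix xmax yE x_gt0) d0.
  by exists T => t Tt; have := hT t Tt; rewrite /a !coef_LamEps !hornerZ !hornerXn.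
have ev2 : ev0 (fun t => \sum_(r < D | (1 < r)%N) `|g t r - ga r|).
  apply: ev0_sum => r r1 d d0.
  have [T hT] := horner_ev0 (kap *: topP Gam r) (xi_cvg dl dr e01 x01 xfix xmax yE x_gt0) d0.
  by exists T => t Tt; have := hT t Tt; rewrite /g /ga GE_ge2// !hornerZ.
(* The number of rounds is fixed before [n]: half of [e] for the distance to the fixed point, a
   quarter for the fluctuations of each side. *)
have [T hT] := ev0D ev1 ev2 e2; exists T.
have [N1 hN1] := tendsL_sum_abs (index_enum 'I_D) (P := predT)
  (fun (l : 'I_D) _ => nu_tends e01 H T.+1 l) e4.
have [N2 hN2] := tendsL_sum_abs (index_enum 'I_D) (P := fun r : 'I_D => (1 < r)%N)
  (fun (r : 'I_D) _ => top_tends dr e01 H T.+1 r) e4.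
exists (maxn N1 N2) => c; rewrite geq_max => /andP[/hN1 h1 /hN2 h2].
have h3 := hT T.+1 (leqnSn _).
apply: (@le_trans _ _ (e / 4 + e / 4 + e / 2)); last by lra.
apply: le_trans (lerD (lerD h1 h2) h3); rewrite -[X in _ + X](Ex_cst (pr1 c)) -!ExD; apply: le_Ex => // w _.
rewrite /Del addrACA -!big_split /=; apply: lerD; apply: ler_sum => i _; exact: ler_distD.
Qed.

Section Pointwise.
Variables (c : cfg lam rho) (w : Om c) (t : nat).
Hypothesis pw : prc eps w != 0.
Hypothesis n_gt0 : 0 < (cn c)%:R :> R.

Let fb : bijective w.1. Proof. by have h := pr_bij (card_vc dr c) pw. Qed.
Let dvD v : (@cdv _ _ _ c v < D)%N.
Proof. exact: leq_trans (deg_lt (cdvE c) v) LamD. Qed.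
Let dcD a : (@cdc _ _ _ c a < D)%N.
Proof. exact: leq_trans (deg_lt (cdcE c) a) GamD. Qed.
Let topsD a : (#|tops t.+1 w.1 w.2 a| < D)%N.
Proof.
apply: leq_ltn_trans (dcD a); rewrite -[leqRHS](card_node (@cdc _ _ _ c)).
by apply/subset_leq_card/fintype.subsetP => r; rewrite !inE => /andP[].
Qed.

Lemma card_R2 : #|R2set t.+1 w.1 w.2|%:R = \sum_(r < D | (1 < r)%N) ctop w t.+1 r.
Proof.
rewrite -sum1_card natr_sum (partition_big (fun a => Ordinal (topsD a)) (fun r : 'I_D => (1 < r)%N)) /=; last first.
  by move=> a; rewrite inE.
apply: eq_bigr => r r1; rewrite /ctop -sum1_card natr_sum; apply: eq_bigl => a.
by rewrite !inE -(inj_eq val_inj) /=; case: eqP => [->|]; rewrite ?r1 ?andbF.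
Qed.

Lemma card_U : #|Uset t.+1 w.1 w.2|%:R = \sum_(l < D) nu R (@cdv _ _ _ c) (Uset t.+1 w.1 w.2) l.
Proof.
rewrite -sum1_card natr_sum (sum_nu _ dvD (fun=> 1)).
by apply: eq_bigr => l _; rewrite mulr1.
Qed.

Let P0E : P0 LE GE D = \sum_(l < D) LE`_l - \sum_(r < D | (1 < r)%N) ga r.
Proof.
rewrite /P0 ratio_kap; congr (_ - _); rewrite [RHS]big_mkcond; apply: eq_bigr => r _.
by case: ifP => // /negbT; rewrite -leqNgt => r1; rewrite GE_lt2// mulr0.
Qed.

Lemma lower_pt : P0 LE GE D - Del w t.+1 <= log2 #|ecode w.1 w.2|%:R / (cn c)%:R.
Proof.
have fi := bij_inj fb.
have h : #|Uset t.+1 w.1 w.2|%:R <= log2 #|ecode w.1 w.2|%:R + #|R2set t.+1 w.1 w.2|%:R :> R.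
  have l2 k : k%:R = log2 (2 ^ k)%:R :> R by rewrite natrX log2X// log2_2 mulr1.
  rewrite (l2 #|Uset t.+1 w.1 w.2|) (l2 #|R2set t.+1 w.1 w.2|) -log2M ?ltr0n ?expn_gt0 ?ecode_gt0// -natrM; apply: ler_log2.
    by rewrite ltr0n expn_gt0.
  by rewrite ler_nat card_ecode_ge.
rewrite ler_pdivlMr// P0E /Del opprD addrACA -sumrB -opprD -big_split /= mulrDl mulNr.
move: h; rewrite card_U card_R2 -lerBlDr; apply: le_trans; apply: lerD.
  rewrite mulr_suml; apply: ler_sum => l _; rewrite -ler_pdivlMr//.
  by rewrite lerBlDr -lerBlDl -normrN opprB ler_norm.
rewrite lerN2 mulr_suml; apply: ler_sum => r _; rewrite -ler_pdivrMr//.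
by rewrite -lerBlDl ler_norm.
Qed.

Variable del : R.
Hypothesis del0 : 0 < del.
Hypothesis del1 : del <= 1.

(** The reciprocals pay for a count below [1 - del] times its ideal value: the corresponding term of
    [Del] times its reciprocal is then at least [1]. A vanishing coefficient, with reciprocal zero,
    cannot cause this event. *)
Definition Cdel : R := D%:R + \sum_(l < D) (del * LE`_l)^-1 + \sum_(r < D | (1 < r)%N) (del * ga r)^-1.
Definition Sg : R := \sum_(l < D) LE`_l + \sum_(r < D | (1 < r)%N) ga r.

Let ga0 r : 0 <= ga r. Proof. by rewrite mulr_ge0 ?GE_ge0// ltW// kap_gt0. Qed.

Lemma Del_ge0 : 0 <= Del w t.+1.
Proof. by apply: addr_ge0; apply: sumr_ge0. Qed.
Lemma Sg_ge0 : 0 <= Sg.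
Proof. by apply: addr_ge0; apply: sumr_ge0 => i _; [exact: LE_ge0|exact: ga0]. Qed.

Let s1 : 0 <= \sum_(l < D) (del * LE`_l)^-1.
Proof. by rewrite sumr_ge0// => i _; rewrite invr_ge0 mulr_ge0 ?LE_ge0// ltW. Qed.
Let s2 : 0 <= \sum_(r < D | (1 < r)%N) (del * ga r)^-1.
Proof. by rewrite sumr_ge0// => i _; rewrite invr_ge0 mulr_ge0// ltW. Qed.
Lemma Cdel_ge0 : 0 <= Cdel. Proof. by rewrite /Cdel !addr_ge0. Qed.

(** Being linear in [Del] and valid for every outcome of positive probability, the bound can be
    averaged without splitting the space. If the counts are large enough it comes from
    [log2_Nbound], otherwise from [Cdel * Del >= 1] and the trivial bound [2 ^ n] on [Nbound]. *)
Lemma upper_pt : log2 (Nbound R (@cdv _ _ _ c) (Uset t.+1 w.1 w.2) (Kset t.+1 w.1 w.2)) / (cn c)%:R <=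
  P0 LE GE D + 2 * (log2 ((cn c)%:R * dp Lam 1 + 1) / (cn c)%:R) + Cdel * Del w t.+1 + D%:R * del * Sg.
Proof.
set U := Uset _ _ _; set K := Kset _ _ _; set n := (cn c)%:R.
have Pge : 0 <= P0 LE GE D.
  exact: (P0_ge0 LE_lt2 Phi_le_P0).
have L0 := dp_node_persp1_gt0 dl.
have lg0 : 0 <= log2 (n * dp Lam 1 + 1).
  by apply: log2_ge0; rewrite lerDr mulr_ge0 ?(ltW n_gt0) ?(ltW L0).
have K1 : #|K|.+1%:R <= n * dp Lam 1 + 1.
  by rewrite -natr1 lerD2r -(card_csock dr c) ler_nat max_card.
have D0 := Del_ge0; have S0 := Sg_ge0; have C0 := Cdel_ge0.
have tail : 0 <= D%:R * del * Sg by rewrite !mulr_ge0// ltW.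
have chE r : (1 < r)%N -> ch R K r = ctop w t.+1 r.
  move=> r1; congr (_%:R); apply: eq_card => a; rewrite !inE kdeg_tops//; case: ifP => // h.
  by apply/eqP/eqP => e; move: r1 h; rewrite -e// => ->.
have [good|bad] := pselect ((forall l, (1 - del) * n * LE`_l <= nu R (@cdv _ _ _ c) U l) /\
    (forall r, (1 < r)%N -> (1 - del) * n * ga r <= ctop w t.+1 r)).
  have [g1 g2] := good.
  have dv1 v : (0 < @cdv _ _ _ c v)%N by apply: ltnW; apply: cdv_ge2.
  have UK : (\sum_(i in U) @cdv _ _ _ c i <= #|K|)%N by apply: sum_deg_Uset.
  have kD a : (kdeg K a < D)%N by apply: leq_ltn_trans (kdeg_le _ _) (dcD a).
  have k1 a : kdeg K a != 1%N by rewrite kdeg_tops//; case: ifP => //; case: #|_| => [|[]].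
  have d01 : 0 <= del <= 1 by rewrite (ltW del0).
  have g2' r : (1 < r)%N -> (1 - del) * (cn c)%:R * (dp LE 1 / dp GE 1 * GE`_r) <= ch R K r.
    by move=> r1; rewrite chE// ratio_kap; apply: g2.
  have := log2_Nbound LED LE_ge0 LE_lt2 GE_lt2 dp_LE_gt0 Phi_le_P0 dv1 UK dvD kD k1 d01 g1 g2'.
  rewrite -/n => hN.
  have hdev : dev LE GE D (@cdv _ _ _ c) U K del <= n * Del w t.+1 + del * n * Sg.
    rewrite /dev /Del /Sg !mulrDr addrACA !mulr_sumr -!big_split /=.
    have aux (X g : R) : X - (1 - del) * n * g <= n * `|X / n - g| + del * n * g.
      have h1 : X - n * g <= n * `|X / n - g|.
        apply: (@le_trans _ _ (n * (X / n - g))); last by rewrite ler_wpM2l ?(ltW n_gt0)// ler_norm.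
        by rewrite mulrBr mulrCA divff ?mulr1// gt_eqF.
      lra.
    apply: lerD; apply: ler_sum => i i1; first exact: aux.
    by rewrite chE// ratio_kap; apply: aux.
  have hK : log2 #|K|.+1%:R <= log2 (n * dp Lam 1 + 1) by apply: ler_log2.
  rewrite ler_pdivrMr//.
  have hD : D%:R * dev LE GE D (@cdv _ _ _ c) U K del <= D%:R * (n * Del w t.+1 + del * n * Sg).
    by rewrite ler_wpM2l.
  have hC : D%:R * Del w t.+1 <= Cdel * Del w t.+1.
    by rewrite ler_wpM2r// /Cdel -addrA lerDl addr_ge0.
  have hC' : D%:R * Del w t.+1 * n <= Cdel * Del w t.+1 * n by rewrite ler_wpM2r// ltW.
  (* Allows the factor [1 - del] in front of [P0] to be dropped. *)
  have hP : 0 <= del * (n * P0 LE GE D) by rewrite !mulr_ge0// ltW.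
  have -> : (P0 LE GE D + 2 * (log2 (n * dp Lam 1 + 1) / n) + Cdel * Del w t.+1 + D%:R * del * Sg) * n =
     n * P0 LE GE D + 2 * log2 (n * dp Lam 1 + 1) + Cdel * Del w t.+1 * n + D%:R * (del * n * Sg).
    by field; rewrite gt_eqF.
  lra.
have C1 : 1 <= Cdel * Del w t.+1.
  have key (g X : R) : 0 <= g -> X < (1 - del) * n * g -> 0 <= X -> 1 <= (del * g)^-1 * `|X / n - g|.
    move=> gg h X0; have g0 : 0 < g.
      rewrite lt_def gg andbT; apply/eqP => e; move: h; rewrite e mulr0 => /(le_lt_trans X0).
      by rewrite ltxx.
    rewrite mulrC ler_pdivlMr ?mulr_gt0// mul1r distrC; apply: le_trans (ler_norm _).
    rewrite lerBrDr -lerBrDl ler_pdivrMr//; lra.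
  have [b1|b2] : (exists l, nu R (@cdv _ _ _ c) U l < (1 - del) * n * LE`_l) \/
     (exists2 r, (1 < r)%N & ctop w t.+1 r < (1 - del) * n * ga r).
    apply: contrapT => /not_orP[nb1 nb2]; apply: bad; split=> [l|r r1]; rewrite leNgt; apply/negP => h.
      by apply: nb1; exists l.
    by apply: nb2; exists r.
  - have [l h] := b1.
    have lD : (l < D)%N.
      rewrite ltnNge; apply/negP => Dl; move: h; rewrite nth_default ?mulr0 ?ltrn0//.
      exact: leq_trans LED Dl.
    apply: (le_trans (key _ _ (LE_ge0 l) h (ler0n _ _))); apply: ler_pM => //.
    + by rewrite invr_ge0 mulr_ge0 ?LE_ge0// ltW.
    + rewrite /Cdel (bigD1 (Ordinal lD))//= addrAC addrCA -[leLHS]addr0 lerD2l.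
      by rewrite !addr_ge0// sumr_ge0// => i _; rewrite invr_ge0 mulr_ge0 ?LE_ge0// ltW.
    + by rewrite /Del (bigD1 (Ordinal lD))//= -addrA lerDl addr_ge0// sumr_ge0.
  - have [r r1 h] := b2.
    have rD : (r < D)%N.
      rewrite ltnNge; apply/negP => Dl; move: h; rewrite /ga nth_default ?mulr0 ?ltrn0//.
      exact: leq_trans GED Dl.
    apply: (le_trans (key _ _ (ga0 r) h (ler0n _ _))); apply: ler_pM => //.
    + by rewrite invr_ge0 mulr_ge0// ltW.
    + rewrite /Cdel [X in _ <= _ + X](bigD1 (Ordinal rD))//= addrCA -[leLHS]addr0 lerD2l.
      by rewrite !addr_ge0// sumr_ge0// => i _; rewrite invr_ge0 mulr_ge0// ltW.
    + by rewrite /Del [X in _ <= _ + X](bigD1 (Ordinal rD))//= addrCA lerDl addr_ge0// sumr_ge0.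
have Nn : log2 (Nbound R (@cdv _ _ _ c) U K) / n <= 1.
  rewrite ler_pdivrMr// mul1r; apply: (@le_trans _ _ #|U|%:R).
    apply: (@le_trans _ _ (log2 (2 ^+ #|U|))); last by rewrite log2X// log2_2 mulr1.
    by apply: ler_log2; [exact: lt_le_trans (Nbound_ge1 _ _ _ _)|exact: Nbound_le].
  by rewrite ler_nat -[leqRHS]card_ord max_card.
apply: (le_trans Nn); apply: (le_trans C1).
have : 0 <= 2 * (log2 (n * dp Lam 1 + 1) / n) by rewrite mulr_ge0// divr_ge0// ltW.
lra.
Qed.

End Pointwise.

Lemma Ex_log_le (c : cfg lam rho) t :
  Ex (@prc _ _ _ eps c) (fun w => log2 #|ecode w.1 w.2|%:R) <=
  Ex (@prc _ _ _ eps c) (fun w => log2 (Nbound R (@cdv _ _ _ c) (Uset t w.1 w.2) (Kset t w.1 w.2))).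
Proof.
rewrite (Ex_pr eps (fun f E => log2 #|ecode f E|%:R)).
rewrite (Ex_pr eps (fun f E => log2 (Nbound R (@cdv _ _ _ c) (Uset t f E) (Kset t f E)))).
rewrite ler_wpM2r ?invr_ge0// exchange_big [leRHS]exchange_big /=; apply: ler_sum => E _.
rewrite -!mulr_sumr ler_wpM2l ?pE_ge0//; apply: sum_log_code_le; exact: card_vc.
Qed.

Lemma entropy_limit (e : R) : 0 < e -> exists N : nat, forall c : cfg lam rho, (N <= cn c)%N ->
  `|(cn c)%:R^-1 * EcondH (@cdv _ _ _ c) (@cdc _ _ _ c) eps - trialP lam rho eps x y| < e.
Proof.
move=> e0; have S0 := Sg_ge0.
have DS : 0 < D%:R * Sg + 1 by rewrite ltr_wpDl// mulr_ge0.
(* Chosen before [t] and [n], because [Cdel] depends on [del] and the required smallness of [Del]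
   depends on [Cdel]. *)
pose del := Num.min 1 (e / (4 * (D%:R * Sg + 1))).
have del0 : 0 < del by rewrite lt_min ltr01 divr_gt0 ?mulr_gt0.
have del1 : del <= 1 by rewrite ge_min lexx.
have delS : D%:R * del * Sg <= e / 4.
  have h : del <= e / (4 * (D%:R * Sg + 1)) by rewrite ge_min lexx orbT.
  have DS0 : 0 <= D%:R * Sg by rewrite mulr_ge0.
  apply: (@le_trans _ _ (e / (4 * (D%:R * Sg + 1)) * (D%:R * Sg))).
    by rewrite mulrAC mulrC ler_wpM2r.
  rewrite (_ : e / (4 * (D%:R * Sg + 1)) * (D%:R * Sg) = e / 4 * (D%:R * Sg / (D%:R * Sg + 1))).
    by rewrite ler_piMr ?divr_ge0 ?(ltW e0)// ler_pdivrMr// mul1r lerDl.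
  by field; rewrite gt_eqF.
have C0 := Cdel_ge0 del0.
have C1 : 0 < Cdel del + 1 by rewrite ltr_wpDl.
pose e1 := e / (4 * (Cdel del + 1)).
have e10 : 0 < e1 by rewrite divr_gt0 ?mulr_gt0.
have [t [N1 hN1]] := Del_small e10.
have e8 : 0 < e / 16 by rewrite divr_gt0.
have [N2 hN2] := log2_small (ltW (dp_node_persp1_gt0 dl)) e8.
exists (maxn N1 (maxn N2 1)) => c; rewrite !geq_max => /and3P[/hN1 h1 /hN2 h2 n1].
have n0 : 0 < (cn c)%:R :> R by rewrite ltr0n.
rewrite -P0_trialP EcondH_Ex.
set Z := Ex _ _.
have CD : Cdel del * e1 <= e / 4.
  rewrite (_ : Cdel del * e1 = e / 4 * (Cdel del / (Cdel del + 1))); last by rewrite /e1; field; rewrite gt_eqF.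
  by rewrite ler_piMr ?divr_ge0 ?(ltW e0)// ler_pdivrMr// mul1r lerDl.
have e14 : e1 <= e / 4.
  by rewrite /e1 ler_pdivrMr ?mulr_gt0//; nra.
have lo : P0 LE GE D - e1 <= (cn c)%:R^-1 * Z.
  rewrite -ExZ; apply: (@le_trans _ _ (Ex (@prc _ _ _ eps c) (fun w => P0 LE GE D - Del w t.+1))).
    by rewrite ExB Ex_cst// lerD2l lerN2.
  by apply: le_Ex => // w pw; rewrite mulrC; apply: lower_pt.
have up : (cn c)%:R^-1 * Z <= P0 LE GE D + 2 * (log2 ((cn c)%:R * dp Lam 1 + 1) / (cn c)%:R) + e / 4 + e / 4.
  apply: (@le_trans _ _ ((cn c)%:R^-1 * Ex (@prc _ _ _ eps c) (fun w => log2 (Nbound R (@cdv _ _ _ c)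
      (Uset t.+1 w.1 w.2) (Kset t.+1 w.1 w.2))))).
    by rewrite ler_wpM2l ?invr_ge0 ?(ltW n0)//; apply: Ex_log_le.
  rewrite -ExZ; apply: (@le_trans _ _ (Ex (@prc _ _ _ eps c) (fun w => P0 LE GE D +
      2 * (log2 ((cn c)%:R * dp Lam 1 + 1) / (cn c)%:R) + Cdel del * Del w t.+1 + D%:R * del * Sg))).
    by apply: le_Ex => // w pw; rewrite mulrC; apply: upper_pt.
  rewrite !ExD !Ex_cst// ExZ lerD// lerD2l; apply: le_trans CD; exact: ler_wpM2l.
have h3 : log2 ((cn c)%:R * dp Lam 1 + 1) / (cn c)%:R <= e / 16 by rewrite ler_pdivrMr.
rewrite ltr_norml; apply/andP; split; lra.
Qed.

End Assembly.

Theorem theorem10 (R : realType) (lam rho : {poly R}) (eps x y : R) :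
  edge_dd lam -> edge_dd rho ->
  0 <= eps <= 1 ->
  (* x is the largest solution in [0,1] of x = eps lambda(1 - rho(1 - x)) *)
  0 <= x <= 1 -> x = eps * lam.[1 - rho.[1 - x]] ->
  (forall t : R, 0 <= t <= 1 -> t = eps * lam.[1 - rho.[1 - t]] -> t <= x) ->
  y = 1 - rho.[1 - x] ->
  non_exceptional lam rho eps ->
  (let Psi_eps := Psi (LamEps (node_persp lam) eps y) (GamEps (node_persp rho) x) in
   (forall u : R, 0 <= u -> Psi_eps u <= Psi_eps 1) /\
   derive1n 2 Psi_eps 1 < 0) ->
  forall e : R, 0 < e -> exists N : nat, forall n : nat, (N <= n)%N ->
    forall (dv : 'I_n -> nat) (m : nat) (dc : 'I_m -> nat),
      admissible lam rho dv dc ->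
      `| n%:R^-1 * EcondH dv dc eps - trialP lam rho eps x y | < e.
Proof.
move=> dl dr e01 x01 xfix xmax yE _ /= [HPsi Hd] e e0.
(* If [x = 0] then [y = 0] and [LamEps] vanishes, so [Psi] is identically zero and its second
   derivative cannot be negative. Positivity of [x] keeps all tails [xi] and [etad] positive, as the
   ratios [q] require. *)
have x_gt0 : 0 < x.
  rewrite lt_def; case/andP: (x01) => -> _; rewrite andbT; apply/eqP => x0; move: Hd.
  have y0 : y = 0 by rewrite yE x0 subr0; case: dr => _ [_ ->]; rewrite subrr.
  have L0 : LamEps (node_persp lam) eps y = 0.
    apply/polyP => l; rewrite coef_LamEps y0 coef0 expr0n; case: l => [|l] /=; last by rewrite mulr0.
    by rewrite node_persp_lt2// mulr0 mul0r.
  have -> : Psi (LamEps (node_persp lam) eps y) (GamEps (node_persp rho) x) = cst 0.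
    apply/funext => u; rewrite /Psi L0 size_poly0 !big_ord0.
    by rewrite /dp deriv0 horner0 oppr0 !mul0r !addr0.
  rewrite /derive1n /= (_ : derive1 (cst 0) = cst 0 :> (R -> R)); last first.
    by apply/funext => z; rewrite derive1_cst.
  by rewrite derive1_cst ltxx.
have [N hN] := entropy_limit dl dr e01 x01 xfix xmax yE x_gt0 HPsi e0.
by exists N => n Nn dv m dc adm; apply: (hN (Cfg adm) Nn).
Qed.
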